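(* Let $d\ge 1$, let $D>0$, and let $\rho_\infty>0$, $T_\infty>0$ be constants. Then there exist positive constants $C$ and $\lambda$ such that every solution $(\hat f,\hat T)$, $\hat f=\hat f(x,v,t)$, $\hat T=\hat T(x,t)$ with $x\in\mathbb{T}^d$, $v\in\mathbb{R}^d$, $t\ge 0$, of the linear system $$\partial_t \hat f + v\cdot\nabla_x \hat f = \mathbf{Q}_L(\hat f,\hat T)\,,\qquad \partial_t \hat T - D\,\Delta_x\hat T = -\int_{\mathbb{R}^d}|v|^2\,\mathbf{Q}_L(\hat f,\hat T)\,dv\,,$$ satisfying the constraints $$\int_{\mathbb{T}^d}\int_{\mathbb{R}^d}\hat f\,dv\,dx=0\,,\qquad \int_{\mathbb{T}^d}\Big(\int_{\mathbb{R}^d}|v|^2\hat f\,dv+\hat T\Big)dx=0\,,$$ satisfies, for all $t\ge 0$, $$\mathcal{H}_L(\hat f(t),\hat T(t))\le C e^{-\lambda t}\,\mathcal{H}_L(\hat f(0),\hat T(0))\,.$$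
   Context: $\mathbb{T}^d$ is the flat torus represented by $[0,1]^d$ (periodic). For $T>0$ the Maxwellian is $M(T)(v)=(\pi T)^{-d/2}\exp(-|v|^2/T)$, $v\in\mathbb{R}^d$. Set $f_\infty(v)=\rho_\infty M(T_\infty)(v)$ and $\hat\rho(x,t)=\int_{\mathbb{R}^d}\hat f(x,v,t)\,dv$. The linearized collision operator is $$\mathbf{Q}_L(\hat f,\hat T)=\hat\rho\, M(T_\infty)+f_\infty\frac{\hat T}{T_\infty}\Big(\frac{|v|^2}{T_\infty}-\frac d2\Big)-\hat f\,.$$ The quadratic entropy is $$\mathcal{H}_L(\hat f,\hat T)=\int_{\mathbb{T}^d}\Big(\int_{\mathbb{R}^d}\frac{\hat f^2}{2f_\infty}\,dv+\frac{\hat T^2}{2T_\infty^2}\Big)dx\,.$$ The functional setting is the Hilbert space $\mathbb{H}$ of all pairs $(\hat f,\hat T)$ of real functions on $\mathbb{T}^d\times\mathbb{R}^d$ and $\mathbb{T}^d$ with $\mathcal{H}_L(\hat f,\hat T)<\infty$ that satisfy the two integral constraints above; solutions are understood as mild (semigroup) solutions with values in $\mathbb{H}$. *)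

(* Defs.v *)
From HB Require Import structures.
From mathcomp Require Import all_boot all_order all_algebra.
From mathcomp Require Import all_classical all_reals all_analysis.

Set Implicit Arguments.
Unset Strict Implicit.
Unset Printing Implicit Defensive.
Import Order.TTheory GRing.Theory Num.Theory.
Import numFieldNormedType.Exports.

Local Open Scope classical_set_scope.
Local Open Scope ring_scope.

(* R^n as n-tuples, the carrier on which the library provides the product of
   the Borel sigma-algebras. *)
Notation space R n := (n.-tuple (measurableTypeR R)).

Section lebesgue_step.
Context (R : realType) (n : nat)
  (mu : {sigma_finite_measure set (space R n) -> \bar R}).

Definition cons_space (z : measurableTypeR R * space R n) : space R n.+1 :=
  [the n.+1.-tuple (measurableTypeR R) of z.1 :: z.2].

Lemma measurable_cons_space : measurable_fun setT cons_space.
Proof. exact: measurable_cons. Qed.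

Definition lebesgue_step : set (space R n.+1) -> \bar R :=
  pushforward (lebesgue_measure \x mu)%E cons_space.

Let lebesgue_step0 : lebesgue_step set0 = 0%E.
Proof. by rewrite /lebesgue_step /pushforward preimage_set0 measure0. Qed.

Let lebesgue_step_ge0 A : (0 <= lebesgue_step A)%E.
Proof. by rewrite /lebesgue_step /pushforward; apply: measure_ge0. Qed.

Let lebesgue_step_sigma_additive : semi_sigma_additive lebesgue_step.
Proof.
move=> F mF tF mUF; rewrite /lebesgue_step /pushforward preimage_bigcup.
have mc := measurable_cons_space.
apply: measure_semi_sigma_additive.
- by move=> k; rewrite -[X in measurable X]setTI; exact: mc.
- apply/trivIsetP => /= i j _ _ ij; rewrite -preimage_setI.
  by move/trivIsetP : tF => /(_ _ _ _ _ ij) ->//; rewrite preimage_set0.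
- by rewrite -preimage_bigcup -[X in measurable X]setTI; exact: mc.
Qed.

HB.instance Definition _ := isMeasure.Build _ _ _ lebesgue_step
  lebesgue_step0 lebesgue_step_ge0 lebesgue_step_sigma_additive.

Let uncons (t : space R n.+1) : measurableTypeR R * space R n :=
  (thead t, [tuple of behead t]).

Let cons_spaceK : cancel cons_space uncons.
Proof. by case=> x y; congr pair; exact/val_inj. Qed.

Let measurable_uncons : measurable_fun setT uncons.
Proof.
by apply/measurable_fun_pairP; split;
  [exact: measurable_tnth | exact: measurable_behead].
Qed.

Let lebesgue_step_sigma_finite : sigma_finite setT lebesgue_step.
Proof.
have /sigma_finiteP[F [TF ndF Foo]] := sigma_finiteT (@lebesgue_measure R).
have /sigma_finiteP[G [TG ndG Goo]] := sigma_finiteT mu.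
exists (fun k => uncons @^-1` (F k `*` G k)).
  rewrite -preimage_bigcup -[LHS](preimage_setT uncons); congr (_ @^-1` _).
  rewrite -setXTT TF TG; apply/seteqP; split=> -[x y] /=; last first.
    by move=> [k _ [? ?]]; split; exists k.
  move=> [[i _ Fix] [j _ Gjy]]; exists (maxn i j) => //; split.
  - by move: x Fix; exact/subsetPset/ndF/leq_maxl.
  - by move: y Gjy; exact/subsetPset/ndG/leq_maxr.
move=> k; have [mF Fk] := Foo k; have [mG Gk] := Goo k.
split.
  rewrite -[X in measurable X]setTI; apply: measurable_uncons => //.
  exact: measurableX.
rewrite /lebesgue_step /pushforward -comp_preimage.
rewrite (_ : uncons \o cons_space = id); last exact/funext/cons_spaceK.
by rewrite preimage_id product_measure1E// lte_mul_pinfty// ge0_fin_numE.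
Qed.

HB.instance Definition _ := Measure_isSigmaFinite.Build _ _ _ lebesgue_step
  lebesgue_step_sigma_finite.

Lemma lebesgue_step_cons (A : set (measurableTypeR R)) (B : set (space R n)) :
  measurable A -> measurable B ->
  lebesgue_step (cons_space @` (A `*` B)) = (lebesgue_measure A * mu B)%E.
Proof.
move=> mA mB; rewrite /lebesgue_step /pushforward -product_measure1E//.
congr (_ _); apply/seteqP; split => [z [w ABw /(can_inj cons_spaceK) <-]//|z ABz].
by exists z.
Qed.

End lebesgue_step.

Section dirac_point.
Context (R : realType).
Definition lebesgue0 : set (space R 0) -> \bar R := dirac [tuple].
HB.instance Definition _ := Measure.on lebesgue0.
Let lebesgue0_sigma_finite : sigma_finite setT lebesgue0.
Proof. exact: sigma_finiteT. Qed.
HB.instance Definition _ := Measure_isSigmaFinite.Build _ _ _ lebesgue0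
  lebesgue0_sigma_finite.
End dirac_point.

Fixpoint lebesgue (R : realType) (n : nat) :
    {sigma_finite_measure set (space R n) -> \bar R} :=
  match n with
  | 0 => @lebesgue0 R
  | n'.+1 => lebesgue_step (lebesgue R n')
  end.

Lemma lebesgue_box (R : realType) (n : nat)
    (A : 'I_n -> set (measurableTypeR R)) : (forall i, measurable (A i)) ->
  lebesgue R n [set x | forall i, A i (tnth x i)] =
  (\prod_(i < n) lebesgue_measure (A i))%E.
Proof.
elim: n A => [|n IHn] A mA.
  rewrite big_ord0 /= /lebesgue0 diracE mem_set//= => -[].
  by [].
rewrite big_ord_recl -(IHn (fun i => A (lift ord0 i)))// -lebesgue_step_cons//.
  congr (lebesgue_step _ _); apply/seteqP; split => [x Ax|_ [[x y] /= [Ax Ay] <-] i].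
    exists (thead x, [tuple of behead x]); last by rewrite [RHS]tuple_eta; exact/val_inj.
    split=> /=; first exact: Ax.
    by move=> i; rewrite tnth_behead (_ : inord _ = lift ord0 i) //;
      apply/val_inj; rewrite /= inordK// ltnS.
  by case: (unliftP ord0 i) => [j ->|->//]; rewrite tnthS.
rewrite (_ : mkset _ = \bigcap_(i in [set: 'I_n])
    ((fun x : space R n => tnth x i) @^-1` A (lift ord0 i))).
  apply: fin_bigcap_measurable => // i _; rewrite -[X in measurable X]setTI.
  exact: measurable_tnth.
by apply/seteqP; split => [x Ax i _|x Ax i] /=; [exact: Ax|exact: (Ax i)].
Qed.

Section model.
Context (R : realType) (d : nat).
Implicit Types (x y v : space R d) (t : R).

Definition sqnorm x : R := \sum_(i < d) tnth x i ^+ 2.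

Definition translate x t v : space R d :=
  [tuple tnth x i - t * tnth v i | i < d].

Definition unit_cell : set (space R d) :=
  [set x | forall i, 0 <= tnth x i <= 1].

(* Functions on the torus are 1-periodic functions on R^d. *)
Definition periodic (g : space R d -> R) : Prop :=
  forall (i : 'I_d) x,
    g [tuple tnth x j + (j == i)%:R | j < d] = g x.

(* A pair (f, T): the first component is a function of (x, v). Elements of the
   Hilbert space are handled through representatives: two states are identified
   when the quadratic entropy of their difference vanishes. *)
Definition state : Type :=
  ((space R d * space R d -> R^o) * (space R d -> R^o))%type.
HB.instance Definition _ := GRing.Lmodule.on state.

Definition maxwellian (T : R) v : R :=
  (pi * T) `^ (- (d%:R / 2)) * expR (- (sqnorm v / T)).

Section parameters.
Context (D rho_inf T_inf : R).

Definition f_inf v : R := rho_inf * maxwellian T_inf v.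

(* For a state of finite entropy this integral, and the velocity moments below,
   converge for almost every x. *)
Definition density (u : state) x : R := \int[lebesgue R d]_v u.1 (x, v).

Definition collision (u : state) x v : R :=
  density u x * maxwellian T_inf v
  + f_inf v * (u.2 x / T_inf) * (sqnorm v / T_inf - d%:R / 2)
  - u.1 (x, v).

Definition entropy (u : state) : \bar R :=
  (\int[lebesgue R d]_(x in unit_cell)
     ((\int[lebesgue R d]_v (u.1 (x, v) ^+ 2 / (2 * f_inf v))%:E)
      + (u.2 x ^+ 2 / (2 * T_inf ^+ 2))%:E))%E.

Record in_hilbert (u : state) : Prop := InHilbert {
  measurable_f : measurable_fun setT u.1;
  measurable_T : measurable_fun setT u.2;
  periodic_f : forall v, periodic (fun x => u.1 (x, v));
  periodic_T : periodic u.2;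
  finite_entropy : (entropy u < +oo)%E;
  zero_mass :
    \int[lebesgue R d]_(x in unit_cell) (\int[lebesgue R d]_v u.1 (x, v)) = 0;
  zero_energy :
    \int[lebesgue R d]_(x in unit_cell)
      ((\int[lebesgue R d]_v (sqnorm v * u.1 (x, v))) + u.2 x) = 0
}.

(* The semigroup of D * Laplacian on the torus: convolution over R^d of the
   Gaussian heat kernel with periodic functions. *)
Definition heat t (g : space R d -> R) x : R :=
  if t <= 0 then g x else
  \int[lebesgue R d]_y
    ((4 * pi * D * t) `^ (- (d%:R / 2))
     * expR (- (sqnorm (translate x 1 y) / (4 * D * t))) * g y).

(* The semigroup generated by (f, T) |-> (- v . grad_x f, D Laplace_x T). *)
Definition free_flow t (u : state) : state :=
  (fun z => u.1 (translate z.1 t z.2, z.2), heat t u.2).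

Definition source (u : state) : state :=
  (fun z => collision u z.1 z.2,
   fun x => - \int[lebesgue R d]_v (sqnorm v * collision u x v)).

(* I is the Riemann integral of g over [0, t], in the norm of the Hilbert
   space, whose square is proportional to the entropy. *)
Definition is_integral (g : R -> state) t (I : state) : Prop :=
  forall eps : R, 0 < eps -> exists2 delta : R, 0 < delta &
    forall (n : nat) (p xi : nat -> R),
      p 0%N = 0 -> p n = t ->
      (forall k, (k < n)%N ->
         p k <= xi k <= p k.+1 /\ p k.+1 - p k < delta) ->
      (entropy (\sum_(k < n) (p k.+1 - p k) *: g (xi k) - I)%R < eps%:E)%E.

(* u is continuous from [0, +oo[ to the Hilbert space and satisfies
   u(t) = free_flow t u(0) + \int_0^t free_flow (t - s) (source u(s)) ds;
   the values of u at negative times are irrelevant. *)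
Record mild_solution (u : R -> state) : Prop := MildSolution {
  mild_in_hilbert : forall t, 0 <= t -> in_hilbert (u t);
  mild_continuous : forall t, 0 <= t ->
    entropy (u s - u t) @[s --> within `[0, +oo[ (nbhs t)] --> 0%E;
  mild_duhamel : forall t, 0 <= t ->
    is_integral (fun s => free_flow (t - s) (source (u s))) t
      (u t - free_flow t (u 0))
}.

End parameters.
End model.

(* Main.v *)
(* The system is u' = A u + B u with A = (- v . grad_x, D Laplace_x) generating a
   contraction semigroup S, and B the collision term. B is bounded and
   dissipative: <u, B u> = - q(u), where q(u) = |Q_L u|^2, and |B u|^2 <= b q(u).
   If the energy hardly decreases on [s, s + N], then q is small there on average
   and u(s + N) is close to S(N) u(s), so that both u(s) and S(N) u(s) are nearly
   local equilibria. But over a long time N free transport mixes: its matrix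
   elements between local equilibria a(x) psi(v) f_inf and a'(x) psi'(v) f_inf are
   velocity averages of the correlation of a and a' along N v, hence converge to
   the product of the means of a and a', uniformly on bounded sets (Gaussian
   integrals are continuous under translation by z / N, z in the unit cell).
   Therefore S(N) u(s) is nearly the equilibrium given by the means of density and
   temperature, which the conservation laws force to be small, and the energy
   drops by a fixed factor over the time N + 1. *)

From HB Require Import structures.
From mathcomp Require Import all_boot all_order all_algebra.
From mathcomp Require Import all_classical all_reals all_analysis.
From mathcomp Require Import measurable_realfun.
From mathcomp Require Import ring lra.
Require Import Defs.
Set Implicit Arguments.
Unset Strict Implicit.
Unset Printing Implicit Defensive.
Import Order.TTheory GRing.Theory Num.Theory.
Import numFieldNormedType.Exports.
Local Open Scope classical_set_scope.
Local Open Scope ring_scope.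

(** * Semi-inner products *)

(** Solutions are only mild, so the energy |u t|^2 cannot simply be differentiated. Duhamel's
    formula is restarted at time t, in the form of Riemann sums, and bounds the upper right Dini
    derivative of the energy by - 2 q; a one-sided comparison lemma integrates such bounds.
    Continuity of S in time is obtained along the solution only, from the continuity of u and
    Duhamel's formula. A small energy loss bounds the time average of q but not its values: hence
    the averaging estimate is used for all s in a window of length one, and the period is N + 1
    rather than N. That estimate looks only at the two ends of [s, s + N]; what happens in between
    enters through the drift |u (s + N) - S N (u s)|. The temperature of the later state is read
    from its kinetic part: near local equilibrium, pairing f with |v|^2 / T - d / 2 gives a positive
    multiple of the temperature. The time N comes from dominated convergence, so the final constants
    are not explicit. *)

Section semi_inner_product.
Context (R : realType) (V : lmodType R) (ip : V -> V -> R).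
Hypothesis ipC : forall u w, ip u w = ip w u.
Hypothesis ipDl : forall u v w, ip (u + v) w = ip u w + ip v w.
Hypothesis ipZl : forall a u w, ip (a *: u) w = a * ip u w.
Hypothesis ip_ge0 : forall u, 0 <= ip u u.

Definition seminorm u := Num.sqrt (ip u u).
Local Notation nrm := seminorm.

Lemma ip0l w : ip 0 w = 0.
Proof. by rewrite -(scale0r 0) ipZl mul0r. Qed.

Lemma ipNl u w : ip (- u) w = - ip u w.
Proof. by rewrite -scaleN1r ipZl mulN1r. Qed.

Lemma ipDr u v w : ip w (u + v) = ip w u + ip w v.
Proof. by rewrite !(ipC w) ipDl. Qed.

Lemma ipZr a u w : ip u (a *: w) = a * ip u w.
Proof. by rewrite ipC ipZl ipC. Qed.

Lemma ip_sumr n u (w : nat -> V) :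
  ip u (\sum_(k < n) w k) = \sum_(k < n) ip u (w k).
Proof.
elim: n => [|n IHn]; first by rewrite !big_ord0 ipC ip0l.
by rewrite !big_ord_recr/= ipDr IHn.
Qed.

Lemma seminorm_ge0 u : 0 <= nrm u. Proof. exact: sqrtr_ge0. Qed.

Lemma seminorm_sqr u : nrm u ^+ 2 = ip u u.
Proof. by rewrite sqr_sqrtr. Qed.

Lemma seminormN u : nrm (- u) = nrm u.
Proof. by rewrite /seminorm ipNl ipC ipNl opprK. Qed.

Lemma seminorm_distrC u w : nrm (u - w) = nrm (w - u).
Proof. by rewrite -seminormN opprB. Qed.

Lemma seminorm0 : nrm 0 = 0.
Proof. by rewrite /seminorm ip0l sqrtr0. Qed.

Lemma seminormZ a u : nrm (a *: u) = `|a| * nrm u.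
Proof.
by rewrite /seminorm ipZl ipZr mulrA -expr2 sqrtrM ?sqr_ge0// sqrtr_sqr.
Qed.

Lemma ip_sqr_le u w : ip u w ^+ 2 <= ip u u * ip w w.
Proof.
have key a : 0 <= ip u u + 2 * a * ip u w + a ^+ 2 * ip w w.
  have := ip_ge0 (u + a *: w); rewrite ipDl !ipDr !ipZl !ipZr (ipC w u).
  by rewrite (_ : _ + _ = ip u u + 2 * a * ip u w + a ^+ 2 * ip w w)//; ring.
have [w0|w0] := eqVneq (ip w w) 0.
  rewrite w0 mulr0 leNgt; apply/negP => uw.
  have uw0 : ip u w != 0 by apply: contraTneq uw => ->; rewrite expr0n/= ltxx.
  (* For a null vector w the quadratic is affine in a, and this a gives it the value - 1. *)
  have := key (- (ip u u + 1) / (2 * ip u w)).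
  rewrite w0 mulr0 addr0.
  rewrite (_ : 2 * _ * _ = - (ip u u + 1)); last by field.
  lra.
have {}w0 : 0 < ip w w by rewrite lt_neqAle eq_sym w0 ip_ge0.
have := key (- ip u w / ip w w).
rewrite (_ : _ + _ = (ip u u * ip w w - ip u w ^+ 2) / ip w w); last first.
  by field; rewrite gt_eqF.
by rewrite pmulr_lge0 ?invr_gt0// subr_ge0.
Qed.

Lemma ip_le u w : `|ip u w| <= nrm u * nrm w.
Proof.
rewrite -sqrtrM ?ip_ge0// -sqrtr_sqr ler_wsqrtr//; exact: ip_sqr_le.
Qed.

Lemma ip_ler u w : ip u w <= nrm u * nrm w.
Proof. exact: le_trans (ler_norm _) (ip_le u w). Qed.

Lemma seminormD u w : nrm (u + w) <= nrm u + nrm w.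
Proof.
rewrite -(@ler_pXn2r _ 2)// ?nnegrE ?addr_ge0 ?seminorm_ge0//.
rewrite sqrrD !seminorm_sqr ipDl !ipDr (ipC w u).
have := ip_ler u w; lra.
Qed.

Lemma seminorm_triangle v u w : nrm (u - w) <= nrm (u - v) + nrm (v - w).
Proof. by rewrite (le_trans _ (seminormD _ _))// subrKA. Qed.

Lemma seminorm_sum n (w : nat -> V) :
  nrm (\sum_(k < n) w k) <= \sum_(k < n) nrm (w k).
Proof.
elim: n => [|n IHn]; first by rewrite !big_ord0 seminorm0.
rewrite !big_ord_recr/= (le_trans (seminormD _ _))// lerD2r//.
Qed.

End semi_inner_product.

(** * A monotonicity criterion by one-sided derivatives *)

Section comparison.
Context (R : realType).
Implicit Types (phi : R -> R) (a b : R).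

(** Consider the times up to which phi stays below the line of slope eps through phi a. Their
    supremum is again such a time, because the second hypothesis forbids upward jumps from the left,
    and it cannot be smaller than b, because the first hypothesis lets the bound advance. *)
Lemma nonincreasing_of_dini phi a b : a <= b ->
  (forall t, a <= t < b -> forall eps, 0 < eps -> exists2 delta, 0 < delta &
     forall h, 0 <= h <= delta -> phi (t + h) <= phi t + eps * h) ->
  (forall t, a < t <= b -> forall eps, 0 < eps -> exists2 delta, 0 < delta &
     forall s, a <= s -> t - delta <= s <= t -> phi t <= phi s + eps) ->
  phi b <= phi a.
Proof.
move=> ab right left; apply/ler_addgt0Pr => e e0.
(* The + 1 keeps the denominator positive when a = b. *)
pose eps := e / (b - a + 1).
have ba0 : 0 < b - a + 1 by lra.
have eps0 : 0 < eps by rewrite divr_gt0.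
pose A := [set t | a <= t <= b /\
  forall s, a <= s <= t -> phi s <= phi a + eps * (s - a)].
have Aa : A a.
  split; first by rewrite lexx.
  by move=> s; rewrite -eq_le => /eqP <-; rewrite subrr mulr0 addr0.
have hA : has_sup A.
  split; first by exists a.
  by exists b => t [/andP[]].
set c := sup A.
have ac : a <= c by apply: sup_upper_bound.
have cb : c <= b by apply: ge_sup; [exists a | move=> t [/andP[]]].
have below s : a <= s < c -> phi s <= phi a + eps * (s - a).
  move=> /andP[as_ sc].
  have [t [tb At] st] := @sup_adherent R A (c - s) ltac:(lra) hA.
  by apply: At; move: st; rewrite -/c; lra.
have Ac : A c.
  split; first lra.
  move=> s /andP[as_]; rewrite le_eqVlt => /orP[/eqP ->|sc]; last first.
    by apply: below; rewrite as_.
  have [->|ca] := eqVneq c a; first by rewrite subrr mulr0 addr0.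
  have {}ca : a < c by rewrite lt_neqAle eq_sym ca.
  apply/ler_addgt0Pr => e' e'0.
  have [delta d0 hd] := left c ltac:(lra) e' e'0.
  pose s' := Num.max a (c - delta).
  have s'c : a <= s' < c by rewrite /s' le_max lexx/= gt_max ca; lra.
  have := below s' s'c; have := hd s'; rewrite /s' le_max lexx/= => /(_ isT).
  have -> : Num.max a (c - delta) <= c by move: s'c; rewrite /s'; lra.
  rewrite le_max lexx orbT/= => /(_ isT).
  rewrite -/s'.
  have : eps * (s' - a) <= eps * (c - a) by rewrite ler_wpM2l ?ltW//; lra.
  lra.
have [_ /(_ c)] := Ac; rewrite ac lexx => /(_ isT) phic.
have {}cb : c = b.
  apply/eqP; rewrite eq_le cb/= leNgt; apply/negP => cb'.
  have [delta d0 hd] := right c ltac:(lra) eps eps0.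
  pose h := Num.min delta (b - c).
  have h0 : 0 < h by rewrite /h lt_min d0/=; lra.
  suff : A (c + h).
    by move=> /(sup_upper_bound hA); rewrite -/c; lra.
  have hb : h <= b - c by rewrite /h ge_min lexx orbT.
  have hdelta : h <= delta by rewrite /h ge_min lexx.
  split; first lra.
  move=> s /andP[as_ sh].
  have [sc|sc] := ltP s c; first by apply: below; rewrite as_.
  have := hd (s - c) ltac:(lra); rewrite (addrC c) subrK.
  lra.
rewrite -cb (le_trans phic)// lerD2l /eps mulrAC ler_pdivrMr//.
by rewrite ler_wpM2l ?ltW//; lra.
Qed.

End comparison.

(** * Decay for dissipative perturbations of contraction semigroups *)

Section hypocoercive_decay.
Context (R : realType) (V : lmodType R) (ip : V -> V -> R).
Hypothesis ipC : forall u w, ip u w = ip w u.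
Hypothesis ipDl : forall u v w, ip (u + v) w = ip u w + ip v w.
Hypothesis ipZl : forall a u w, ip (a *: u) w = a * ip u w.
Hypothesis ip_ge0 : forall u, 0 <= ip u u.
Local Notation nrm := (seminorm ip).

Variables (S : R -> V -> V) (B : V -> V) (q : V -> R) (b L : R).
(** The laws of S are required up to vectors of seminorm 0: elements of V will be functions rather
    than classes, and the heat semigroup satisfies its laws only in this sense. *)
Hypothesis S_linear : forall (h a : R) u w, 0 <= h ->
  nrm (S h (u + a *: w) - (S h u + a *: S h w)) = 0.
Hypothesis S_contract : forall (h : R) u, 0 <= h -> nrm (S h u) <= nrm u.
Hypothesis S_add : forall (h t : R) u, 0 <= h -> 0 <= t ->
  nrm (S h (S t u) - S (h + t) u) = 0.
(* For [S h = (e^{hA}, e^{hL})] with A skew-adjoint and L self-adjoint, moving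
   [S r] to the left of the product gives [e^{(h-r)A}] and [e^{(h+r)L}]. *)
Hypothesis S_ip : forall (h r : R) u w, 0 <= r <= h ->
  `|ip (S h u) (S r w) - ip u w| <=
  nrm w * (nrm (S (h - r) u - u) + nrm (S (h + r) u - u)).
Hypothesis L_ge0 : 0 <= L.
Hypothesis B_lipschitz : forall u w, nrm (B u - B w) <= L * nrm (u - w).
Hypothesis B_dissip : forall u, ip u (B u) = - q u.
Hypothesis b_gt0 : 0 < b.
Hypothesis B_bound : forall u, ip (B u) (B u) <= b * q u.

(* Only left-endpoint Riemann sums are required to converge. *)
Definition mild (u : R -> V) : Prop :=
  (forall t : R, 0 <= t -> forall eps : R, 0 < eps ->
   exists2 delta : R, 0 < delta &
     forall s : R, 0 <= s -> `|s - t| <= delta -> nrm (u s - u t) <= eps) /\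
  (forall t : R, 0 <= t -> forall eps : R, 0 < eps ->
   exists2 delta : R, 0 < delta &
     forall (n : nat) (p : nat -> R), p 0%N = 0 -> p n = t ->
       (forall k, (k < n)%N -> 0 <= p k.+1 - p k < delta) ->
       nrm (\sum_(k < n) (p k.+1 - p k) *: S (t - p k) (B (u (p k)))
            - (u t - S t (u 0))) <= eps).

Lemma nrm_ge0 u : 0 <= nrm u. Proof. exact: seminorm_ge0. Qed.
Hint Resolve nrm_ge0 : core.

Let tri := seminorm_triangle ipC ipDl ipZl ip_ge0.
Let nrmD := seminormD ipC ipDl ipZl ip_ge0.
Let iDr := ipDr ipC ipDl.
Let iZr := ipZr ipC ipZl.
Let sqr u : nrm u ^+ 2 = ip u u.
Proof. exact: seminorm_sqr. Qed.
Let nrmC u w : nrm (u - w) = nrm (w - u).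
Proof. exact: seminorm_distrC. Qed.
Let nrmN u : nrm (- u) = nrm u.
Proof. exact: seminormN. Qed.

Lemma q_ge0 u : 0 <= q u.
Proof. by rewrite -(pmulr_rge0 _ b_gt0) (le_trans _ (B_bound u)). Qed.

Lemma S_sub (h : R) u w : 0 <= h -> nrm (S h u - S h w) <= nrm (u - w).
Proof.
move=> h0; have := S_linear 1 (u - w) w h0; rewrite !scale1r subrK => e0.
have := S_contract (u - w) h0.
have := tri (S h (u - w) + S h w) (S h u) (S h w).
by rewrite e0 add0r addrK => /le_trans; apply.
Qed.

Lemma S_sum (h : R) n (v : V) (c : nat -> R) (w : nat -> V) : 0 <= h ->
  nrm (S h (v + \sum_(k < n) c k *: w k)
       - (S h v + \sum_(k < n) c k *: S h (w k))) = 0.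
Proof.
move=> h0; elim: n => [|n IHn].
  by rewrite !big_ord0 !addr0 subrr seminorm0.
rewrite !big_ord_recr/= !addrA.
set x := v + _; set y := S h v + _.
have e0 := S_linear (c n) x (w n) h0.
apply/eqP; rewrite eq_le nrm_ge0 andbT.
apply: (le_trans (tri
  (S h x + c n *: S h (w n)) _ _)).
by rewrite e0 add0r opprD addrACA subrr addr0 IHn.
Qed.

Section solution.
Variable u : R -> V.
Hypothesis mild_u : mild u.

(** Duhamel's formula restarted at time t. Applying S h to the Riemann sum for t and subtracting it
    from the one for t + h leaves the part of the sum over [t, t + h]. *)
Lemma local_duhamel (t h eps : R) : 0 <= t -> 0 <= h -> 0 < eps -> exists m : nat,
  (0 < m)%N /\
  nrm (u (t + h) - (S h (u t) + \sum_(j < m) (h / m%:R) *: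
        S (h - j%:R * (h / m%:R)) (B (u (t + j%:R * (h / m%:R)))))) <= eps.
Proof.
move=> t0 h0 eps0; have [_ D] := mild_u.
have eps20 : 0 < eps / 2 by rewrite divr_gt0.
have [d1 d10 D1] := D t t0 _ eps20.
have [d2 d20 D2] := D (t + h) (addr_ge0 t0 h0) _ eps20.
have mesh (x : R) : 0 <= x -> exists2 m : nat, (0 < m)%N &
    0 <= x / m%:R < Num.min d1 d2.
  move=> x0; set d := Num.min d1 d2.
  have d0 : 0 < d by rewrite lt_min d10.
  exists (Num.truncn (x / d)).+1 => //.
  rewrite divr_ge0//= ltr_pdivrMr ?ltr0n// mulrC -ltr_pdivrMr//.
  exact: truncnS_gt.
have [n n0 /andP[hn0 hn]] := mesh t t0; have [m m0 /andP[hm0 hm]] := mesh h h0.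
move: hn hm; rewrite !lt_min => /andP[hn1 hn2] /andP[hm1 hm2].
exists m; split => //.
pose a := t / n%:R; pose c := h / m%:R.
have an : n%:R * a = t by rewrite /a mulrC divfK// pnatr_eq0 -lt0n.
have cm : m%:R * c = h by rewrite /c mulrC divfK// pnatr_eq0 -lt0n.
pose p1 k := k%:R * a.
(* This partition of [0, t + h] extends the partition [p1] of [0, t], so that S h maps the sum for t
   to the first n terms of the sum for t + h. *)
pose p2 k := if (k <= n)%N then k%:R * a else t + (k - n)%:R * c.
have p1S k : p1 k.+1 - p1 k = a by rewrite /p1 -natr1; ring.
have p2l k : (k <= n)%N -> p2 k = p1 k by rewrite /p2 => ->.
have p2r j : p2 (n + j)%N = t + j%:R * c.
  rewrite /p2; case: ifPn => [|_]; last by rewrite addKn.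
  by rewrite -{2}(addn0 n) leq_add2l leqn0 => /eqP ->; rewrite addn0 an mul0r addr0.
have {D1} := D1 n p1; rewrite /p1 mul0r => /(_ erefl an).
move=> /(_ _)/wrap[k kn|E1]; first by rewrite p1S /a hn1 andbT.
have {D2} := D2 (n + m)%N p2; rewrite p2r cm p2l// /p1 mul0r => /(_ erefl erefl).
move=> /(_ _)/wrap[k kn|].
  have [kltn|nk] := ltnP k n.
    by rewrite !p2l ?p1S ?hn2 ?andbT// ltnW.
  rewrite -(subnKC nk) -addnS !p2r -natr1.
  by rewrite (_ : _ - _ = c) ?hm2 ?andbT//; ring.
rewrite big_split_ord/=.
rewrite (eq_bigr (fun k : 'I_n => a *: S (t + h - p1 k) (B (u (p1 k))))); last first.
  by move=> k _; rewrite !p2l ?p1S// ltnW.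
rewrite (eq_bigr (fun j : 'I_m => c *: S (h - j%:R * c) (B (u (t + j%:R * c)))));
  last first.
  move=> j _; rewrite -addnS !p2r -natr1; congr (_ *: S _ _); ring.
set s2 := \sum_(k < m) _; set s1 := \sum_(k < n) _ => E2.
pose s0 := \sum_(k < n) a *: S (t - p1 k) (B (u (p1 k))).
have {}E1 : nrm (s0 - (u t - S t (u 0))) <= eps / 2.
  by move: E1; under eq_bigr do rewrite p1S.
have e1 : nrm (S h (S t (u 0) + s0)
    - (S h (S t (u 0)) + \sum_(k < n) a *: S h (S (t - p1 k) (B (u (p1 k)))))) = 0.
  exact: (S_sum n (S t (u 0)) (fun=> a)
    (fun k => S (t - p1 k) (B (u (p1 k))))).
have p1t (k : 'I_n) : 0 <= p1 k <= t.
  rewrite /p1 mulr_ge0//= -an ler_wpM2r// ler_nat ltnW//.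
have e2 : nrm (\sum_(k < n) a *: S h (S (t - p1 k) (B (u (p1 k)))) - s1) = 0.
  apply/eqP; rewrite eq_le nrm_ge0 andbT -sumrB.
  apply: (le_trans (seminorm_sum ipC ipDl ipZl ip_ge0 n
    (fun k => a *: S h (S (t - p1 k) (B (u (p1 k))))
              - a *: S (t + h - p1 k) (B (u (p1 k)))))).
  rewrite big1// => k _; rewrite -scalerBr seminormZ//.
  have tp : 0 <= t - p1 k by rewrite subr_ge0; case/andP: (p1t k).
  have := S_add (B (u (p1 k))) h0 tp.
  by rewrite (addrCA h) (addrA t) => ->; rewrite mulr0.
have e3 : nrm (S h (S t (u 0)) - S (t + h) (u 0)) = 0.
  by rewrite (addrC t) S_add.
have e4 : nrm (S h (u t) - S h (S t (u 0) + s0)) <= eps / 2.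
  apply: (le_trans (S_sub _ _ h0)); rewrite nrmC.
  by rewrite (_ : _ - u t = s0 - (u t - S t (u 0)))//; rewrite opprB addrA (addrC s0).
rewrite -/c -/s2.
set s1' := \sum_(k < n) a *: S h _ in e1 e2.
have cancelr x y z : x + z - (y + z) = x - y :> V.
  by rewrite opprD addrACA subrr addr0.
have cancell x y z : z + x - (z + y) = x - y :> V.
  by rewrite opprD addrACA subrr add0r.
apply: (le_trans (tri (S (t + h) (u 0) + s1 + s2) _ _)).
rewrite [eps]splitr; apply: lerD.
  rewrite (_ : _ - _ = - (s1 + s2 - (u (t + h) - S (t + h) (u 0)))) ?nrmN//.
  by rewrite !opprB -addrA opprD addrA.
rewrite cancelr.
apply: (le_trans (tri (S h (S t (u 0)) + s1') _ _)).
rewrite -[X in _ <= X]add0r; apply: lerD.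
  apply: (le_trans (tri (S (t + h) (u 0) + s1') _ _)).
  by rewrite cancell cancelr nrmC e2 add0r
    nrmC e3.
apply: (le_trans (tri (S h (S t (u 0) + s0)) _ _)).
by rewrite nrmC e1 add0r nrmC.
Qed.

Lemma seminorm_mean m (h c : R) (w : nat -> V) : (0 < m)%N -> 0 <= h ->
  (forall j, (j < m)%N -> nrm (w j) <= c) ->
  nrm (\sum_(j < m) (h / m%:R) *: w j) <= h * c.
Proof.
move=> m0 h0 wc.
apply: (le_trans (seminorm_sum ipC ipDl ipZl ip_ge0 m (fun j => (h / m%:R) *: w j))).
apply: (@le_trans _ _ (\sum_(j < m) (h / m%:R * c))).
  apply: ler_sum => j _; rewrite seminormZ// ger0_norm ?divr_ge0//.
  by rewrite ler_wpM2l ?divr_ge0// wc.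
rewrite sumr_const card_ord -[leLHS]mulr_natl mulrA (mulrC m%:R) divfK//.
by rewrite pnatr_eq0 -lt0n.
Qed.

Lemma duhamel_bound (t h c : R) : 0 <= t -> 0 <= h ->
  (forall s, t <= s <= t + h -> nrm (B (u s)) <= c) ->
  nrm (u (t + h) - S h (u t)) <= h * c.
Proof.
move=> t0 h0 Bc; apply/ler_addgt0Pr => e e0.
have [m [m0 hm]] := local_duhamel t0 h0 e0.
set I := \sum_(j < m) _ in hm.
apply: (le_trans (tri (S h (u t) + I) _ _)).
rewrite addrC; apply: lerD hm; rewrite addrAC subrr add0r.
apply: (seminorm_mean (w := fun j => S (h - j%:R * (h / m%:R))
  (B (u (t + j%:R * (h / m%:R)))))) => // j jm.
have : 0 <= j%:R * (h / m%:R) <= h.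
  rewrite mulr_ge0 ?divr_ge0//= mulrA ler_pdivrMr ?ltr0n// mulrC.
  by rewrite ler_wpM2l// ler_nat ltnW.
move=> jh; apply: (le_trans (S_contract _ _)); first by rewrite subr_ge0; lra.
by apply: Bc; lra.
Qed.

Lemma B_le_near (t s eta : R) : nrm (u s - u t) <= eta ->
  nrm (B (u s) - B (u t)) <= L * eta /\
  nrm (B (u s)) <= nrm (B (u t)) + L * eta.
Proof.
move=> st; have Bst : nrm (B (u s) - B (u t)) <= L * eta.
  by rewrite (le_trans (B_lipschitz _ _))// ler_wpM2l.
split => //; rewrite -[in leLHS](subrK (B (u t)) (B (u s))).
by rewrite (le_trans (nrmD _ _))// addrC lerD2l.
Qed.

(** Expand |S h (u t) + I|^2 with I the Riemann sum over [t, t + h]. The first square is at most |u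
    t|^2 and |I|^2 is of order h^2. In the cross term, [S_ip] removes S at the cost of the
    displacement of u t under S over times up to 2 h, itself small by [duhamel_bound] and the
    continuity of u; what remains is h times <u t, B (u t)> = - q (u t). *)
Lemma energy_dini (t : R) : 0 <= t -> forall eps : R, 0 < eps ->
  exists2 delta : R, 0 < delta & forall h, 0 <= h <= delta ->
    ip (u (t + h)) (u (t + h)) <= ip (u t) (u t) - 2 * q (u t) * h + eps * h.
Proof.
move=> t0 eps eps0; have [cont _] := mild_u.
set n0 := nrm (u t); pose c := nrm (B (u t)) + L.
have c0 : 0 <= c by rewrite addr_ge0.
have n00 : 0 <= n0 by exact: nrm_ge0.
(* Per unit of h the errors are 2 n0 L eta from B, 2 c (4 h c + 2 eta) from [S_ip] and h c^2 from
   |I|^2; with h <= eta they add up to at most eta K. *)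
pose K := 2 * (n0 * L) + 9 * c ^+ 2 + 4 * c + 1.
have K0 : 0 < K.
  by have := mulr_ge0 n00 L_ge0; have := sqr_ge0 c; rewrite /K; lra.
pose eta := Num.min 1 (eps / K).
have eta0 : 0 < eta by rewrite lt_min ltr01 divr_gt0.
have eta1 : eta <= 1 by rewrite ge_min lexx.
have etaK : eta * K <= eps by rewrite -ler_pdivlMr// ge_min lexx orbT.
have [d d0 hd] := cont t t0 _ eta0.
(* [S_ip] involves S at times up to 2 h, hence d / 2: u has to stay near u t on [t, t + 2 h]. *)
exists (Num.min (d / 2) eta); first by rewrite lt_min eta0 divr_gt0.
move=> h /andP[h0]; rewrite le_min => /andP[hd2 heta].
have near s : t <= s <= t + 2 * h -> nrm (u s - u t) <= eta.
  move=> ts; apply: hd; first lra.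
  by rewrite ger0_norm; lra.
have nearB s : t <= s <= t + 2 * h ->
    nrm (B (u s) - B (u t)) <= L * eta /\ nrm (B (u s)) <= c.
  move=> /near /B_le_near[? Bs]; split => //.
  by rewrite (le_trans Bs)// lerD2l ler_piMr.
have drift r : 0 <= r <= 2 * h -> nrm (S r (u t) - u t) <= 2 * h * c + eta.
  move=> r2; apply: (le_trans (tri (u (t + r)) _ _)); apply: lerD.
    rewrite nrmC (le_trans (@duhamel_bound t r c t0 _ _))//; first lra.
      by move=> s ts; apply: (nearB _ _).2; lra.
    by rewrite ler_wpM2r//; lra.
  by apply: near; lra.
set Z := _ + eps * h.
have bound m : (0 < m)%N ->
  nrm (S h (u t) + \sum_(j < m) (h / m%:R) *:
        S (h - j%:R * (h / m%:R)) (B (u (t + j%:R * (h / m%:R))))) ^+ 2 <= Z.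
  move=> m0.
  pose w j := S (h - j%:R * (h / m%:R)) (B (u (t + j%:R * (h / m%:R)))).
  have jh j : (j < m)%N -> 0 <= j%:R * (h / m%:R) <= h.
    move=> jm; rewrite mulr_ge0 ?divr_ge0//= mulrA ler_pdivrMr ?ltr0n// mulrC.
    by rewrite ler_wpM2l// ler_nat ltnW.
  have wc j : (j < m)%N -> nrm (w j) <= c.
    move=> /jh jm; apply: (le_trans (S_contract _ _)); first lra.
    by apply: (nearB _ _).2; lra.
  rewrite -/w; set I := \sum_(j < m) _.
  have Ic : nrm I <= h * c by exact: (seminorm_mean (w := w)).
  pose P := - q (u t) + n0 * (L * eta) + c * (4 * h * c + 2 * eta).
  have ipw j : (j < m)%N -> ip (S h (u t)) (w j) <= P.
    move=> /jh jm; set s := t + j%:R * (h / m%:R).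
    have ts : t <= s <= t + 2 * h by rewrite /s; lra.
    have [Bs1 Bs2] := nearB _ ts.
    have r0 : 0 <= h - j%:R * (h / m%:R) <= h by lra.
    have := S_ip (u t) (B (u s)) r0; rewrite -/(w j).
    move=> /(le_trans (ler_norm _)).
    have : ip (u t) (B (u s)) <= - q (u t) + n0 * (L * eta).
      rewrite -(subrK (B (u t)) (B (u s))) iDr B_dissip addrC lerD2l.
      by rewrite (le_trans (ip_ler ipC ipDl ipZl ip_ge0 _ _))// ler_wpM2l.
    have := drift (h - (h - j%:R * (h / m%:R))) ltac:(lra).
    have := drift (h + (h - j%:R * (h / m%:R))) ltac:(lra).
    set d1 := nrm (S _ _ - _); set d2 := nrm (S _ _ - _) => D1 D2.
    have : nrm (B (u s)) * (d2 + d1) <= c * (4 * h * c + 2 * eta).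
      have d10 : 0 <= d1 by exact: nrm_ge0.
      have d20 : 0 <= d2 by exact: nrm_ge0.
      by apply: ler_pM => //; lra.
    rewrite /P; lra.
  have ipI : ip (S h (u t)) I <= h * P.
    rewrite /I (ip_sumr ipC ipDl ipZl _ _ (fun j => (h / m%:R) *: w j)).
    apply: (@le_trans _ _ (\sum_(j < m) (h / m%:R * P))).
      by apply: ler_sum => j _; rewrite iZr ler_wpM2l ?divr_ge0// ipw.
    rewrite sumr_const card_ord -[leLHS]mulr_natl mulrA (mulrC m%:R) divfK//.
    by rewrite pnatr_eq0 -lt0n.
  rewrite sqr ipDl !iDr (ipC I) -(sqr I).
  have : ip (S h (u t)) (S h (u t)) <= ip (u t) (u t).
    by rewrite -!sqr ler_pXn2r// ?nnegrE// S_contract.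
  have : nrm I ^+ 2 <= h * (h * c ^+ 2).
    by rewrite (_ : _ * _ = (h * c) ^+ 2); [rewrite ler_pXn2r ?nnegrE ?mulr_ge0|ring].
  have : h * (2 * (n0 * (L * eta)) + 2 * c * (4 * h * c + 2 * eta) + h * c ^+ 2)
      <= h * eps.
    rewrite ler_wpM2l// (le_trans _ etaK)// /K.
    have : h * c ^+ 2 <= eta * c ^+ 2 by rewrite ler_wpM2r ?sqr_ge0.
    lra.
  rewrite /Z /P in ipI *; lra.
have Z0 : 0 <= Z.
  by apply: le_trans (bound 1%N isT); rewrite sqr_ge0.
(* The bound Z on the Riemann sums does not depend on m, so it passes to u (t + h), which they
   approximate. *)
rewrite -sqr -(sqr_sqrtr Z0) ler_pXn2r ?nnegrE ?sqrtr_ge0//.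
apply/ler_addgt0Pr => e e0.
have [m [m0 hm]] := local_duhamel t0 h0 e0.
set I := _ + \sum_(j < m) _ in hm.
rewrite -(subrK I (u (t + h))) (le_trans (nrmD _ _))// addrC lerD//.
have bm : nrm I ^+ 2 <= Num.sqrt Z ^+ 2 by rewrite (sqr_sqrtr Z0); exact: bound.
by move: bm; rewrite ler_pXn2r ?nnegrE ?sqrtr_ge0.
Qed.

Lemma energy_left (t : R) : 0 <= t -> forall eps : R, 0 < eps ->
  exists2 delta : R, 0 < delta & forall s, 0 <= s -> t - delta <= s <= t ->
    ip (u t) (u t) <= ip (u s) (u s) + eps.
Proof.
move=> t0 eps eps0; have [cont _] := mild_u.
set n := nrm (u t); have n0 : 0 <= n by exact: nrm_ge0.
(* From n <= m + eta and m <= n + 1 the squares differ by at most eta (2 (n + 1) + 1). *)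
pose K := 2 * n + 3; have K0 : 0 < K by rewrite /K; lra.
pose eta := Num.min 1 (eps / K).
have eta0 : 0 < eta by rewrite lt_min ltr01 divr_gt0.
have eta1 : eta <= 1 by rewrite ge_min lexx.
have etaK : eta * K <= eps by rewrite -ler_pdivlMr// ge_min lexx orbT.
have [d d0 hd] := cont t t0 _ eta0.
exists d => // s s0 st.
have us : nrm (u s - u t) <= eta by apply: hd; rewrite // ler_norml; lra.
rewrite -!sqr -/n; set m := nrm (u s).
have m0 : 0 <= m by exact: nrm_ge0.
have nm : n <= m + eta.
  by rewrite /n -(subrK (u s) (u t)) (le_trans (nrmD _ _))// addrC lerD2l nrmC.
have mn : m <= n + eta.
  by rewrite /m -(subrK (u t) (u s)) (le_trans (nrmD _ _))// addrC lerD2l.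
have : n ^+ 2 <= (m + eta) ^+ 2 by rewrite ler_pXn2r ?nnegrE ?addr_ge0// ltW.
have : eta * m <= eta * (n + 1) by rewrite ler_pM2l//; lra.
have : eta * eta <= eta * 1 by rewrite ler_pM2l.
rewrite /K in etaK; lra.
Qed.

Lemma energy_nonincreasing (s t : R) : 0 <= s -> s <= t ->
  ip (u t) (u t) <= ip (u s) (u s).
Proof.
move=> s0 st; apply: (nonincreasing_of_dini (phi := fun r => ip (u r) (u r))) => //.
- move=> r /andP[sr _] eps eps0.
  have [d d0 hd] := energy_dini (le_trans s0 sr) eps0; exists d => // h hh.
  have := hd h hh; have := mulr_ge0 (q_ge0 (u r)) (andP hh).1; lra.
- move=> r /andP[sr _] eps eps0.
  have [d d0 hd] := energy_left (le_trans s0 (ltW sr)) eps0; exists d => // h sh.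
  by apply: hd; exact: le_trans s0 sh.
Qed.

(** S h contracts the drift accumulated up to time r, so only the Duhamel defect on [r, r + h] is
    added. *)
Lemma drift_step (s r h : R) : 0 <= s -> s <= r -> 0 <= h ->
  nrm (u (r + h) - S (r + h - s) (u s)) <=
  nrm (u r - S (r - s) (u s)) + nrm (u (r + h) - S h (u r)).
Proof.
move=> s0 sr h0; have rs : 0 <= r - s by rewrite subr_ge0.
rewrite [leRHS]addrC (le_trans (tri (S h (u r)) _ _))// lerD2l.
rewrite (le_trans (tri (S h (S (r - s) (u s))) _ _))//.
rewrite (_ : r + h - s = h + (r - s)); last by ring.
by rewrite S_add// addr0 S_sub.
Qed.

(* [phi r = |u r - S (r - s) (u s)| - eta (r - s) + a |u r|^2] is nonincreasing:
   the drift grows at most at rate [|B u| <= sqrt (b q)], and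
   [sqrt (b q) <= eta + b q / (4 eta)] while the energy is lost at rate [2 q]. *)
Lemma drift_bound (s N eta : R) : 0 <= s -> 0 <= N -> 0 < eta ->
  nrm (u (s + N) - S N (u s)) <=
  eta * N + b / (8 * eta) * (ip (u s) (u s) - ip (u (s + N)) (u (s + N))).
Proof.
move=> s0 N0 eta0; have [cont _] := mild_u.
set a := b / (8 * eta); have a0 : 0 < a by rewrite divr_gt0 ?mulr_gt0.
have a8 : 2 * a = b / (4 * eta) by rewrite /a; field; rewrite gt_eqF.
pose phi r := nrm (u r - S (r - s) (u s)) - eta * (r - s) + a * ip (u r) (u r).
have phis : phi s = a * ip (u s) (u s).
  rewrite /phi !subrr mulr0 subr0 (_ : nrm _ = 0) ?add0r//.
  apply/eqP; rewrite eq_le nrm_ge0 andbT.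
  have := @duhamel_bound s 0 (nrm (B (u s))) s0 (lexx _).
  rewrite addr0 mul0r; apply => r; rewrite -eq_le => /eqP <- //.
suff : phi (s + N) <= phi s.
  rewrite phis /phi (_ : s + N - s = N); last by ring.
  lra.
apply: nonincreasing_of_dini; first by lra.
- move=> r /andP[sr _] eps eps0; have r0 := le_trans s0 sr.
  have L1 : 0 < L + 1 by have := L_ge0; lra.
  have eta10 : 0 < eps / 2 / (L + 1) by rewrite !divr_gt0.
  have eps20 : 0 < eps / 2 / a by apply: divr_gt0 => //; apply: divr_gt0.
  have [d1 d10 hd1] := cont r r0 _ eta10.
  have [d2 d20 hd2] := energy_dini r0 eps20.
  exists (Num.min d1 d2); first by rewrite lt_min d10.
  move=> h /andP[h0]; rewrite le_min => /andP[h1 h2].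
  have := hd2 h; rewrite h0 h2 => /(_ isT) E2.
  have B1 : nrm (B (u r)) <= eta + 2 * a * q (u r).
    have := B_bound (u r); rewrite -sqr; set x := nrm _ => xq.
    have x0 : 0 <= x by exact: nrm_ge0.
    rewrite a8 mulrAC -lerBlDl ler_pdivlMr ?mulr_gt0//.
    apply: le_trans xq; have := sqr_ge0 (x - 2 * eta); lra.
  have B2 : nrm (u (r + h) - S h (u r)) <= h * (nrm (B (u r)) + eps / 2).
    apply: duhamel_bound => // r' rr'.
    have ru : nrm (u r' - u r) <= eps / 2 / (L + 1).
      by apply: hd1; [lra|rewrite ler_norml; lra].
    apply: (le_trans (B_le_near ru).2); rewrite lerD2l mulrA ler_pdivrMr//.
    by rewrite mulrC ler_wpM2l//; lra.
  have h1' : h * nrm (B (u r)) <= h * (eta + 2 * a * q (u r)) by rewrite ler_wpM2l.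
  have : a * ip (u (r + h)) (u (r + h)) <=
      a * (ip (u r) (u r) - 2 * q (u r) * h + eps / 2 / a * h).
    by rewrite ler_pM2l.
  rewrite (_ : a * (_ + _) = a * ip (u r) (u r) - 2 * a * q (u r) * h + eps / 2 * h);
    last by field; rewrite gt_eqF.
  have := drift_step s0 sr h0.
  rewrite /phi; lra.
- move=> r /andP[sr _] eps eps0; have r0 : 0 <= r by lra.
  have [d1 d10 hd1] := cont r r0 1 ltr01.
  have eps20 : 0 < eps / 2 / a by apply: divr_gt0 => //; apply: divr_gt0.
  have [d2 d20 hd2] := energy_left r0 eps20.
  pose c := nrm (B (u r)) + L.
  have c0 : 0 <= c by rewrite addr_ge0.
  pose d3 := eps / 2 / (eta + c + 1).
  have ec : 0 < eta + c + 1 by lra.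
  have d30 : 0 < d3 by rewrite !divr_gt0.
  exists (Num.min d1 (Num.min d2 d3)); first by rewrite !lt_min d10 d20.
  move=> r' sr' /andP[r1 r2].
  have [l1 l2 l3] : [/\ r - d1 <= r', r - d2 <= r' & r - d3 <= r'].
    by move: r1; rewrite lerBlDr -lerBlDl !le_min => /andP[? /andP[? ?]]; split; lra.
  have r'0 : 0 <= r' by lra.
  have := drift_step s0 sr' (_ : 0 <= r - r').
  rewrite (addrC r') subrK subr_ge0 => /(_ r2) W.
  have Er := hd2 r' r'0 ltac:(lra).
  have Bc x : r' <= x <= r' + (r - r') -> nrm (B (u x)) <= c.
    move=> xr; have /B_le_near[_] : nrm (u x - u r) <= 1.
      by apply: hd1; [lra|rewrite ler_norml; lra].
    by rewrite mulr1.
  have := duhamel_bound r'0 (_ : 0 <= r - r') Bc.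
  rewrite (addrC r') subrK subr_ge0 => /(_ r2) W2.
  have : a * ip (u r) (u r) <= a * (ip (u r') (u r') + eps / 2 / a).
    by rewrite ler_pM2l.
  rewrite (_ : a * (_ + _) = a * ip (u r') (u r') + eps / 2); last first.
    by field; rewrite gt_eqF.
  have : (r - r') * (eta + c + 1) <= eps / 2 by rewrite -ler_pdivlMr// -/d3; lra.
  have : 0 <= (r - r') * eta by rewrite mulr_ge0//; lra.
  rewrite /phi; lra.
Qed.

(** Optimize [drift_bound] in eta: eta = W / (2 N) lets half of W be absorbed on the left. When N =
    0, eta is sent to infinity instead and the drift vanishes. *)
Lemma drift_sqr (s N : R) : 0 <= s -> 0 <= N ->
  ip (u (s + N) - S N (u s)) (u (s + N) - S N (u s)) <=
  N * b / 2 * (ip (u s) (u s) - ip (u (s + N)) (u (s + N))).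
Proof.
move=> s0 N0; rewrite -sqr; set W := nrm _.
set e := ip (u s) (u s) - _.
have e0 : 0 <= e by rewrite subr_ge0 energy_nonincreasing// lerDl.
have [->|W0] := eqVneq W 0.
  by rewrite expr0n/= mulr_ge0// divr_ge0// mulr_ge0// ltW.
have {}W0 : 0 < W by rewrite lt_neqAle eq_sym W0 nrm_ge0.
have [NE|NN] := eqVneq N 0.
  have : W <= 0.
    apply/ler_addgt0Pr => x x0; rewrite add0r.
    pose eta := b * (e + 1) / (8 * x).
    have eta0 : 0 < eta.
      by rewrite divr_gt0 ?mulr_gt0//; lra.
    have := drift_bound s0 N0 eta0; rewrite -/W -/e NE mulr0 add0r.
    move=> /le_trans; apply.
    rewrite (_ : b / (8 * eta) * e = x * (e / (e + 1))); last first.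
      rewrite /eta; field; rewrite !gt_eqF//; lra.
    by rewrite ler_piMr ?(ltW x0)// ler_pdivrMr; lra.
  by rewrite leNgt W0.
have {}N0 : 0 < N by rewrite lt_neqAle eq_sym NN.
have eta0 : 0 < W / (2 * N) by rewrite divr_gt0// mulr_gt0.
have := drift_bound s0 (ltW N0) eta0; rewrite -/W -/e.
rewrite (_ : _ * N = W / 2); last by field; rewrite gt_eqF.
rewrite (_ : b / _ * e = (N * b / 2 * e) / (2 * W)); last first.
  by field; rewrite !gt_eqF.
move=> W1; have : W / 2 <= N * b / 2 * e / (2 * W) by lra.
rewrite ler_pdivlMr ?mulr_gt0// => W2; rewrite expr2; lra.
Qed.

Variables (N C : R).
Hypothesis N_ge0 : 0 <= N.
Hypothesis C_gt0 : 0 < C.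
Hypothesis averaging : forall s, 0 <= s ->
  ip (u (s + N)) (u (s + N)) <= 1 / 4 * ip (u s) (u s) +
    C * (q (u s) + q (u (s + N)) +
         ip (u (s + N) - S N (u s)) (u (s + N) - S N (u s))).

(* The averaging estimate from s to s + N, for s in [t, t + 1], bounds the
   dissipation q from below on a set of times of length one. *)
Lemma energy_step (t C' : R) : 0 <= t -> C' = C * (1 + N * b / 2) ->
  ip (u (t + (N + 1))) (u (t + (N + 1))) <=
  (1 / 4 + C') / (1 + C') * ip (u t) (u t).
Proof.
move=> t0 C'E; have Nge0 : 0 <= N by exact: N_ge0.
have nb0 : 0 <= N * b / 2 by rewrite divr_ge0// mulr_ge0// ltW.
have C'0 : 0 < C' by rewrite C'E mulr_gt0//; lra.
rewrite mulrAC ler_pdivlMr; last by lra.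
pose E (r : R) : R := ip (u r) (u r).
rewrite -/(E t) -/(E (t + (N + 1))).
have Emono x y : t <= x -> x <= y -> E y <= E x.
  by move=> tx xy; apply: energy_nonincreasing => //; lra.
pose Dl : R := E t - E (t + (N + 1)).
(* The averaging estimate solved for the dissipation, with the energies replaced by their extreme
   values on the window, so that the lower bound is the same for all s. *)
pose K := (E (t + (N + 1)) - 1 / 4 * E t) / C - N * b / 2 * Dl.
have Kq s : t <= s < t + 1 -> K <= q (u s) + q (u (s + N)).
  move=> /andP[ts st]; have s0 : 0 <= s by lra.
  have := averaging s0; rewrite -/(E s) -/(E (s + N)) => A.
  have D := drift_sqr s0 N_ge0; rewrite -/(E s) -/(E (s + N)) in D.
  have E1 : E s <= E t by apply: Emono; lra.
  have E2 : E (t + (N + 1)) <= E (s + N) by apply: Emono; [lra|rewrite (addrC N) addrA lerD2r ltW].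
  have D2 : N * b / 2 * (E s - E (s + N)) <= N * b / 2 * Dl.
    by rewrite ler_wpM2l// /Dl; lra.
  rewrite /K lerBlDr ler_pdivrMr//.
  have : C * (q (u s) + q (u (s + N)) + ip (u (s + N) - S N (u s)) (u (s + N) - S N (u s)))
     <= C * (q (u s) + q (u (s + N)) + N * b / 2 * Dl).
    by rewrite ler_pM2l//; lra.
  rewrite mulrC; lra.
(* Both energies decrease at rate at least 2 q, so their sum decreases at rate at least 2 K. Over a
   window of length one this yields K <= [Dl], which is the claim after clearing denominators. *)
pose phi s := E s + E (s + N) + 2 * K * (s - t).
have : phi (t + 1) <= phi t.
  apply: nonincreasing_of_dini; first by lra.
  - move=> s st eps eps0.
    have s0 : 0 <= s by lra.
    have sN0 : 0 <= s + N by lra.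
    have eps20 : 0 < eps / 2 by rewrite divr_gt0.
    have [d1 d10 hd1] := energy_dini s0 eps20.
    have [d2 d20 hd2] := energy_dini sN0 eps20.
    exists (Num.min d1 d2); first by rewrite lt_min d10.
    move=> h /andP[h0]; rewrite le_min => /andP[h1 h2].
    have := hd1 h; rewrite h0 h1 => /(_ isT).
    have := hd2 h; rewrite h0 h2 => /(_ isT).
    have : K * h <= (q (u s) + q (u (s + N))) * h by rewrite ler_wpM2r ?Kq.
    rewrite /phi -!/(E _) (_ : s + h + N = s + N + h); last by ring.
    lra.
  - move=> s /andP[ts _] eps eps0.
    have s0 : 0 <= s by lra.
    have sN0 : 0 <= s + N by lra.
    have eps30 : 0 < eps / 3 by rewrite divr_gt0.
    have [d1 d10 hd1] := energy_left s0 eps30.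
    have [d2 d20 hd2] := energy_left sN0 eps30.
    pose d3 := eps / 3 / (`|2 * K| + 1).
    have k1 : 0 < `|2 * K| + 1 by have := normr_ge0 (2 * K); lra.
    have d30 : 0 < d3 by rewrite !divr_gt0.
    exists (Num.min d1 (Num.min d2 d3)); first by rewrite !lt_min d10 d20.
    move=> r tr /andP[r1 r2].
    have [l1 l2 l3] : [/\ s - d1 <= r, s - d2 <= r & s - d3 <= r].
      by move: r1; rewrite lerBlDr -lerBlDl !le_min => /andP[? /andP[? ?]]; split; lra.
    have e1 := hd1 r ltac:(lra) ltac:(lra).
    have e2 := hd2 (r + N) ltac:(lra) ltac:(lra).
    have : 2 * K * (s - r) <= eps / 3.
      apply: (@le_trans _ _ (`|2 * K| * (s - r))).
        by rewrite ler_wpM2r ?ler_norm//; lra.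
      apply: (@le_trans _ _ ((s - r) * (`|2 * K| + 1))); first lra.
      by rewrite -ler_pdivlMr// -/d3; lra.
    rewrite /phi -!/(E _) in e1 e2 *; lra.
rewrite /phi => ph.
have e1 : E (t + N) <= E t by apply: Emono; lra.
have e2 : E (t + 1) <= E t by apply: Emono; lra.
have e3 : E (t + (N + 1)) <= E (t + 1) by apply: Emono; lra.
have e4 : E (t + 1 + N) = E (t + (N + 1)) by congr E; ring.
have KD : K <= Dl.
  have : E (t + N) <= E t by [].
  rewrite /Dl; rewrite e4 in ph; lra.
move: KD; rewrite /K lerBlDr ler_pdivrMr// => KD.
have : (Dl + N * b / 2 * Dl) * C = C' * Dl by rewrite C'E; ring.
move=> CD; rewrite CD in KD; rewrite /Dl in KD; lra.
Qed.

End solution.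

Theorem hypocoercive_decay (K : V -> Prop) (N C : R) : 0 <= N -> 0 < C ->
  (forall w z, K w -> K z ->
     ip z z <= 1 / 4 * ip w w + C * (q w + q z + ip (z - S N w) (z - S N w))) ->
  exists M lambda : R, [/\ 0 < M, 0 < lambda &
    forall u, mild u -> (forall t, 0 <= t -> K (u t)) -> forall t, 0 <= t ->
      ip (u t) (u t) <= M * expR (- lambda * t) * ip (u 0) (u 0)].
Proof.
move=> N0 C0 avg.
pose C' := C * (1 + N * b / 2).
have C'0 : 0 < C'.
  by rewrite mulr_gt0// ltr_wpDr// divr_ge0// mulr_ge0// ltW.
pose k := (1 / 4 + C') / (1 + C').
have k0 : 0 < k by rewrite divr_gt0//; lra.
have k1 : k < 1 by rewrite ltr_pdivrMr; lra.
have lnk : ln k < 0 by rewrite ln_lt0// k0.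
have N1 : 0 < N + 1 by lra.
(* The energy shrinks by k over each period N + 1; the factor 1 / k pays for the incomplete last
   period. *)
exists k^-1, (- ln k / (N + 1)); split.
- by rewrite invr_gt0.
- by rewrite divr_gt0// oppr_gt0.
move=> u mu Ku t t0.
pose E r := ip (u r) (u r); rewrite -/(E t) -/(E 0).
have iter n : E (n%:R * (N + 1)) <= k ^+ n * E 0.
  elim: n => [|n IHn]; first by rewrite mul0r expr0 mul1r.
  have n0 : 0 <= n%:R * (N + 1) by rewrite mulr_ge0// ltW.
  have := energy_step mu N0 C0 (fun s s0 => avg _ _ (Ku s s0) (Ku _ (addr_ge0 s0 N0)))
    n0 (erefl C').
  rewrite -/k -/(E _).
  rewrite (_ : n%:R * (N + 1) + (N + 1) = n.+1%:R * (N + 1)); last first.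
    by rewrite -natr1; ring.
  move=> /le_trans; apply; rewrite exprS -mulrA ler_pM2l//.
pose n := Num.truncn (t / (N + 1)).
have tN0 : 0 <= t / (N + 1) by rewrite divr_ge0// ltW.
have nt : n%:R * (N + 1) <= t.
  by rewrite -ler_pdivlMr// /n truncn_le.
have tn : t / (N + 1) < n%:R + 1 by rewrite natr1 truncnS_gt.
apply: (@le_trans _ _ (E (n%:R * (N + 1)))).
  by apply: energy_nonincreasing => //; rewrite mulr_ge0// ltW.
apply: (le_trans (iter n)); rewrite ler_wpM2r ?ip_ge0//.
rewrite -[leLHS](lnK (_ : k ^+ n \is Num.pos)) ?posrE ?exprn_gt0//.
rewrite -[k^-1](lnK (_ : k^-1 \is Num.pos)) ?posrE ?invr_gt0//.
rewrite -expRD ler_expR lnV ?posrE// lnXn// -mulr_natl.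
rewrite (_ : - ln k + _ = ln k * (t / (N + 1) - 1)); last by ring.
rewrite (mulrC _ (ln k)) ler_nM2l//; lra.
Qed.

End hypocoercive_decay.

(** * Integration on R^n and on the torus *)

Section reflection.
Context (R : realType).
Implicit Type c : R.

(** Reflections are taken as the basic symmetries: two of them compose to a translation, and they
    also express evenness, on which the symmetry of the heat semigroup rests. *)
Definition reflect_at c : measurableTypeR R -> measurableTypeR R :=
  fun x => c - x.

Lemma measurable_reflect_at c : measurable_fun setT (reflect_at c).
Proof. by apply: measurable_funB. Qed.

HB.instance Definition _ c := isMeasurableFun.Build _ _ _ _ (reflect_at c)
  (measurable_reflect_at c).

Lemma lebesgue_measure_reflect c (A : set (measurableTypeR R)) : measurable A ->
  pushforward lebesgue_measure (reflect_at c) A = lebesgue_measure A.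
Proof.
move=> mA; apply/esym/lebesgue_measure_unique => //= _ [[a b]] _ <-.
rewrite /pushforward (_ : _ @^-1` _ = `[c - b, c - a[%classic); last first.
  apply/seteqP; split=> x /=; rewrite !in_itv/= /reflect_at => /andP[? ?];
    apply/andP; split; lra.
rewrite !lebesgue_measure_itv/= !lte_fin -!EFinB.
rewrite (_ : (c - b < c - a) = (a < b)); last by apply/idP/idP; lra.
by rewrite (_ : c - a - (c - b) = b - a)//; ring.
Qed.

Lemma ge0_integral_reflect c (f : measurableTypeR R -> \bar R) :
  measurable_fun setT f -> (forall x, 0 <= f x)%E ->
  (\int[lebesgue_measure]_x f (c - x)%R = \int[lebesgue_measure]_x f x)%E.
Proof.
move=> mf f0.
transitivity (\int[pushforward lebesgue_measure (reflect_at c)]_x f x)%E.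
  rewrite ge0_integral_pushforward//; exact: measurable_reflect_at.
by apply: eq_measure_integral => //= A mA _; exact: lebesgue_measure_reflect.
Qed.

End reflection.

Section periodic_line.
Context (R : realType).
Variable f : measurableTypeR R -> \bar R.
Hypothesis mf : measurable_fun setT f.
Hypothesis f_ge0 : forall x, (0 <= f x)%E.

Lemma ge0_integral_translate (c : R) (i : interval R) :
  (\int[lebesgue_measure]_(x in [set` i]) f (x - c)%R =
   \int[lebesgue_measure]_(x in [set x | (x + c)%R \in i]) f x)%E.
Proof.
set A := [set` i]; set B := [set x | _].
have mA : measurable (A : set (measurableTypeR R)) by exact: measurable_itv.
have mB : measurable (B : set (measurableTypeR R)).
  rewrite -[X in measurable X]setTI.
  have mc : measurable_fun setT (fun x : measurableTypeR R => x + c : measurableTypeR R).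
    exact: measurable_funD.
  by move: (mc measurableT _ mA).
rewrite integral_mkcond [RHS]integral_mkcond.
have mBf : measurable_fun setT (f \_ B).
  by apply/(measurable_restrictT _ _).1 => //; exact: measurable_funTS.
have Bf0 x : (0 <= (f \_ B) x)%E by exact: erestrict_ge0.
rewrite -(ge0_integral_reflect 0 mBf Bf0).
rewrite -(ge0_integral_reflect c (f := fun x => (f \_ B) (0 - x)))//; last first.
  apply: measurableT_comp => //; exact: (measurable_reflect_at 0).
apply: eq_integral => x _; rewrite !patchE !sub0r opprB.
congr (if _ then _ else _); apply/idP/idP; rewrite !inE /A /B/= subrK//.
Qed.

Hypothesis f_per : forall x : R, f (x + 1) = f x.

Lemma periodic_int (m : int) (x : R) : f (x + m%:~R) = f x.
Proof.
have nat_case (n : nat) y : f (y + n%:R) = f y.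
  elim: n => [|n IHn]; first by rewrite addr0.
  by rewrite -natr1 addrA f_per.
case: m => n; first exact: nat_case.
by rewrite NegzE mulrNz -[in RHS](subrK n.+1%:R x) nat_case.
Qed.

(** Reduce c modulo 1 to a in [0, 1[, translate to [- a, 1 - a[, cut at 0 and move the negative
    piece by one period onto [1 - a, 1[. *)
Lemma ge0_integral_periodic (c : R) :
  (\int[lebesgue_measure]_(x in `[0%R, 1%R]) f (x - c)%R =
   \int[lebesgue_measure]_(x in `[0%R, 1%R]) f x)%E.
Proof.
pose a := c - (Num.floor c)%:~R.
have a01 : 0 <= a < 1.
  by have := floor_itv c; rewrite /a intrD; lra.
have ca (x : R) : f (x - c) = f (x - a).
  by rewrite -(periodic_int (Num.floor c)) /a; congr f; ring.
under eq_integral do rewrite ca.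
have mfE (A : set (measurableTypeR R)) : measurable_fun A f by exact: measurable_funTS.
have mfa (A : set (measurableTypeR R)) : measurable_fun A (fun x => f (x - a)).
  apply: measurable_funTS; apply: (measurableT_comp mf).
  exact: measurable_funB.
rewrite -!integral_itv_bndo_bndc//.
rewrite ge0_integral_translate.
rewrite (_ : [set x | x + a \in `[0, 1[] = `[- a, 0[ `|` `[0, 1 - a[); last first.
  apply/seteqP; split => x /=; rewrite !in_itv/=.
    move=> /andP[? ?]; have [x0|x0] := ltP x 0.
      by left; apply/andP; split; lra.
    by right; apply/andP; split; lra.
  by case=> /andP[? ?]; apply/andP; split; lra.
rewrite ge0_integral_setU//=; last first.
  apply/disj_setPS => x [/=]; rewrite !in_itv/= => /andP[? ?] /andP[? ?]; lra.
transitivity (\int[lebesgue_measure]_(x in `[(1 - a)%R, 1%R[) f x +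
    \int[lebesgue_measure]_(x in `[0%R, (1 - a)%R[) f x)%E.
  congr (_ + _)%E.
  transitivity (\int[lebesgue_measure]_(x in `[(1 - a)%R, 1%R[) f (x - 1)%R)%E.
    rewrite ge0_integral_translate; congr (integral _ _ _).
    apply/seteqP; split => x /=; rewrite !in_itv/= => /andP[? ?];
      apply/andP; split; lra.
  by apply: eq_integral => x _; rewrite -f_per subrK.
rewrite addeC -ge0_integral_setU//=.
  congr (integral _ _ _); apply/seteqP; split => x /=; rewrite !in_itv/=.
    by case=> /andP[? ?]; apply/andP; split; lra.
  move=> /andP[? ?]; have [x0|x0] := ltP x (1 - a).
    by left; apply/andP; split; lra.
  by right; apply/andP; split; lra.
apply/disj_setPS => x [/=]; rewrite !in_itv/= => /andP[? ?] /andP[? ?]; lra.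
- exact: mfE.
- exact: mfa.
Qed.

End periodic_line.

Section tuple_space.
Context (R : realType).

Lemma measurable_fun_space d (T : measurableType d) n (f : T -> space R n) :
  (forall i, measurable_fun setT (fun x => tnth (f x) i)) ->
  measurable_fun setT f.
Proof. by move=> mf; apply/measurable_fun_tnthP => i; exact: mf. Qed.

Lemma measurable_tnth_comp d (T : measurableType d) n (f : T -> space R n) i :
  measurable_fun setT f -> measurable_fun setT (fun x => tnth (f x) i).
Proof.
by move=> mf; apply: (measurableT_comp (measurable_tnth i) mf).
Qed.

Lemma ge0_integral_cons n (f : space R n.+1 -> \bar R) :
  measurable_fun setT f -> (forall x, 0 <= f x)%E ->
  (\int[lebesgue R n.+1]_z f z =
   \int[lebesgue_measure]_x \int[lebesgue R n]_y f (cons_space (x, y)))%E.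
Proof.
move=> mf f0.
transitivity (\int[lebesgue_measure \x lebesgue R n]_z f (cons_space z))%E.
  rewrite [LHS](@ge0_integral_pushforward _ _ _ _ R (@cons_space R n)
    (@measurable_cons_space R n))//.
rewrite fubini_tonelli1//.
by apply: measurableT_comp => //; exact: measurable_cons_space.
Qed.

Lemma ge0_integral_space0 (f : space R 0 -> \bar R) :
  measurable_fun setT f -> (forall x, 0 <= f x)%E ->
  (\int[lebesgue R 0]_z f z = f [tuple])%E.
Proof.
by move=> mf f0; rewrite [LHS]integral_dirac// diracT mul1e.
Qed.

Lemma measurable_cons_space2 n (x : measurableTypeR R) :
  measurable_fun setT (fun y : space R n => cons_space (x, y)).
Proof.
apply: (measurableT_comp (@measurable_cons_space R n)).
exact: measurable_pair1.
Qed.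

Definition reflect_space n (c x : space R n) : space R n :=
  [tuple tnth c i - tnth x i | i < n].

Lemma measurable_reflect_space d (T : measurableType d) n
    (c x : T -> space R n) : measurable_fun setT c -> measurable_fun setT x ->
  measurable_fun setT (fun t => reflect_space (c t) (x t)).
Proof.
move=> mc mx; apply: measurable_fun_space => i.
under eq_fun do rewrite tnth_mktuple.
by apply: measurable_funB; exact: measurable_tnth_comp.
Qed.

Lemma ge0_integral_reflect_space n (c : space R n) (f : space R n -> \bar R) :
  measurable_fun setT f -> (forall x, 0 <= f x)%E ->
  (\int[lebesgue R n]_x f (reflect_space c x) = \int[lebesgue R n]_x f x)%E.
Proof.
elim: n c f => [|n IHn] c f mf f0.
  rewrite !ge0_integral_space0//; first by congr f; apply: eq_from_tnth => -[].
  apply: (measurableT_comp mf).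
  by apply: (measurable_reflect_space (c := cst c)) => //; exact: measurable_id.
have mfc : measurable_fun setT (fun x => f (reflect_space c x)).
  apply: (measurableT_comp mf).
  by apply: (measurable_reflect_space (c := cst c)) => //; exact: measurable_id.
rewrite (ge0_integral_cons mfc (fun=> f0 _)) (ge0_integral_cons mf f0).
pose c' : space R n := [tuple of behead c].
have E x y : reflect_space c (cons_space (x, y)) =
    cons_space (thead c - x, reflect_space c' y).
  apply: eq_from_tnth => i; rewrite tnth_mktuple.
  case: (unliftP ord0 i) => [j ->|->]; rewrite ?tnthS ?tnth0//=.
  rewrite !tnth_mktuple /c' tnth_behead; congr (tnth c _ - _).
  by apply/val_inj => /=; rewrite inordK// ltnS.
under eq_integral => x _.
  under eq_integral do rewrite E.
  rewrite (IHn c' (fun y => f (cons_space (thead c - x, y))))//; last first.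
    by apply: (measurableT_comp mf); exact: measurable_cons_space2.
  over.
rewrite (ge0_integral_reflect (thead c)
  (f := fun x => \int[lebesgue R n]_y f (cons_space (x, y)))%E)//.
- apply: (@measurable_fun_fubini_tonelli_F _ _ _ _ _ _ (f \o @cons_space R n)).
    by apply: measurableT_comp => //; exact: measurable_cons_space.
  by move=> x; exact: f0.
- by move=> x; exact: integral_ge0.
Qed.

Lemma integral_reflect_space n (c : space R n) (f : space R n -> \bar R) :
  measurable_fun setT f ->
  (\int[lebesgue R n]_x f (reflect_space c x) = \int[lebesgue R n]_x f x)%E.
Proof.
move=> mf; rewrite integralE [RHS]integralE; congr (_ - _)%E.
- rewrite -(ge0_integral_reflect_space c (f := f^\+%E)).
  + by apply: eq_integral => x _; rewrite !funeposE.
  + exact: measurable_funepos.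
  + by move=> x; exact: funepos_ge0.
- rewrite -(ge0_integral_reflect_space c (f := f^\-%E)).
  + by apply: eq_integral => x _; rewrite !funenegE.
  + exact: measurable_funeneg.
  + by move=> x; exact: funeneg_ge0.
Qed.

Local Notation ucell := (@unit_cell R _).

Lemma measurable_unit_cell n : measurable (@unit_cell R n).
Proof.
rewrite (_ : ucell = \bigcap_(i in [set: 'I_n])
    ((fun x : space R n => tnth x i) @^-1` `[0%R, 1%R]%classic)); last first.
  by apply/seteqP; split => [x cx i _|x cx i] /=; rewrite ?in_itv/=;
    [exact: cx|move: (cx i I); rewrite /= in_itv].
apply: fin_bigcap_measurable => // i _; rewrite -[X in measurable X]setTI.
exact: measurable_tnth.
Qed.

Lemma unit_cell_cons n (x : measurableTypeR R) (y : space R n) :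
  (cons_space (x, y) \in ucell) = (x \in `[0%R, 1%R]%classic) && (y \in ucell).
Proof.
apply/idP/andP; rewrite !inE /=.
  move=> cx; split; first by have := cx ord0; rewrite tnth0 in_itv.
  by move=> i; have := cx (lift ord0 i); rewrite tnthS.
move=> [x01 cy] i; case: (unliftP ord0 i) => [j ->|->].
  by rewrite tnthS; exact: cy.
by rewrite tnth0; move: x01; rewrite in_itv.
Qed.

Lemma ge0_integral_unit_cell_cons n (f : space R n.+1 -> \bar R) :
  measurable_fun setT f -> (forall x, 0 <= f x)%E ->
  (\int[lebesgue R n.+1]_(z in ucell) f z =
   \int[lebesgue_measure]_(x in `[0%R, 1%R])
      \int[lebesgue R n]_(y in ucell) f (cons_space (x, y)))%E.
Proof.
move=> mf f0; rewrite integral_mkcond ge0_integral_cons.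
- rewrite [RHS]integral_mkcond; apply: eq_integral => x _.
  rewrite [RHS]patchE; case: ifPn => x01.
    rewrite [RHS]integral_mkcond; apply: eq_integral => y _.
    by rewrite !patchE unit_cell_cons x01.
  rewrite integral0_eq// => y _.
  by rewrite patchE unit_cell_cons (negbTE x01).
- apply/(measurable_restrictT _ _).1; first exact: measurable_unit_cell.
  exact: measurable_funTS.
- by move=> x; apply: erestrict_ge0.
Qed.

Lemma ge0_integral_unit_cell0 (f : space R 0 -> \bar R) :
  measurable_fun setT f -> (forall x, 0 <= f x)%E ->
  (\int[lebesgue R 0]_(z in ucell) f z = f [tuple])%E.
Proof.
move=> mf f0; rewrite (_ : ucell = setT) ?ge0_integral_space0//.
by apply/seteqP; split => // x _ [].
Qed.

Lemma lebesgue_unit_cell n : lebesgue R n ucell = 1%E.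
Proof.
rewrite (_ : ucell = [set x | forall i, `[0%R, 1%R]%classic (tnth x i)]).
  rewrite (@lebesgue_box R n (fun=> `[0%R, 1%R]%classic)) => [|i]; last first.
    exact: measurable_itv.
  by rewrite big1// => i _; rewrite lebesgue_measure_itv/= lte_fin ltr01 sube0.
by apply/seteqP; split => x cx i; move: (cx i); rewrite /= in_itv.
Qed.

Definition shift_space n (c x : space R n) : space R n :=
  [tuple tnth x i - tnth c i | i < n].

Lemma measurable_shift_space d (T : measurableType d) n
    (c x : T -> space R n) : measurable_fun setT c -> measurable_fun setT x ->
  measurable_fun setT (fun t => shift_space (c t) (x t)).
Proof.
move=> mc mx; apply: measurable_fun_space => i.
under eq_fun do rewrite tnth_mktuple.
by apply: measurable_funB; exact: measurable_tnth_comp.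
Qed.

Definition eperiodic n (f : space R n -> \bar R) : Prop :=
  forall i x, f [tuple tnth x j + (j == i)%:R | j < n] = f x.

Lemma measurable_integral_unit_cell n (f : space R n.+1 -> \bar R) :
  measurable_fun setT f -> (forall x, 0 <= f x)%E ->
  measurable_fun setT (fun x =>
    \int[lebesgue R n]_(y in ucell) f (cons_space (x, y)))%E.
Proof.
move=> mf f0.
under eq_fun do rewrite integral_mkcond.
pose g (z : measurableTypeR R * space R n) : \bar R :=
  ((f \o @cons_space R n) \_ (snd @^-1` ucell)) z.
rewrite (_ : (fun _ => _) = (fun x => \int[lebesgue R n]_y g (x, y))%E); last first.
  apply/funext => x; apply: eq_integral => y _; rewrite /g !patchE.
  congr (if _ then _ else _); apply/idP/idP; rewrite !inE//.
apply: (@measurable_fun_fubini_tonelli_F _ _ _ _ _ _ g).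
  apply/(measurable_restrictT _ _).1.
    rewrite -[X in measurable X]setTI; apply: measurable_snd => //.
    exact: measurable_unit_cell.
  apply: measurable_funTS.
  by apply: measurableT_comp => //; exact: measurable_cons_space.
by move=> z; apply: erestrict_ge0 => x _; exact: f0.
Qed.

Lemma ge0_integral_unit_cell_shift n (c : space R n) (f : space R n -> \bar R) :
  measurable_fun setT f -> (forall x, 0 <= f x)%E -> eperiodic f ->
  (\int[lebesgue R n]_(x in ucell) f (shift_space c x) =
   \int[lebesgue R n]_(x in ucell) f x)%E.
Proof.
elim: n c f => [|n IHn] c f mf f0 pf.
  have mfc : measurable_fun setT (fun x => f (shift_space c x)).
    apply: (measurableT_comp mf).
    by apply: (measurable_shift_space (c := cst c)) => //; exact: measurable_id.
  rewrite (ge0_integral_unit_cell0 mfc (fun=> f0 _)) (ge0_integral_unit_cell0 mf f0).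
  by congr f; apply: eq_from_tnth => -[].
have mfc : measurable_fun setT (fun x => f (shift_space c x)).
  apply: (measurableT_comp mf).
  by apply: (measurable_shift_space (c := cst c)) => //; exact: measurable_id.
rewrite (ge0_integral_unit_cell_cons mfc (fun=> f0 _)).
rewrite (ge0_integral_unit_cell_cons mf f0).
pose c' : space R n := [tuple of behead c].
have E x y : shift_space c (cons_space (x, y)) =
    cons_space (x - thead c, shift_space c' y).
  apply: eq_from_tnth => i; rewrite tnth_mktuple.
  case: (unliftP ord0 i) => [j ->|->]; rewrite ?tnthS ?tnth0//=.
  rewrite !tnth_mktuple /c' tnth_behead; congr (_ - tnth c _).
  by apply/val_inj => /=; rewrite inordK// ltnS.
under eq_integral => x _.
  under eq_integral do rewrite E.
  rewrite (IHn c' (fun y => f (cons_space (x - thead c, y))))//; first over.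
  - by apply: (measurableT_comp mf); exact: measurable_cons_space2.
  - move=> i y; rewrite -[RHS](pf (lift ord0 i)); congr f.
    apply: eq_from_tnth => j; rewrite tnth_mktuple.
    case: (unliftP ord0 j) => [k ->|->]; rewrite ?tnthS ?tnth0 ?tnth_mktuple.
      by congr (_ + _%:R); rewrite (inj_eq lift_inj).
    by rewrite addr0.
rewrite (ge0_integral_periodic
  (f := fun x => \int[lebesgue R n]_(y in ucell) f (cons_space (x, y)))%E)//.
- exact: measurable_integral_unit_cell.
- by move=> x; exact: integral_ge0.
- move=> x; apply: eq_integral => y _; rewrite -[RHS](pf ord0); congr f.
  apply: eq_from_tnth => j; rewrite tnth_mktuple.
  case: (unliftP ord0 j) => [k ->|->]; rewrite ?tnthS ?tnth0 //=.
  by rewrite addr0.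
Qed.

Lemma integral_unit_cell_shift n (c : space R n) (f : space R n -> \bar R) :
  measurable_fun setT f -> eperiodic f ->
  (\int[lebesgue R n]_(x in ucell) f (shift_space c x) =
   \int[lebesgue R n]_(x in ucell) f x)%E.
Proof.
move=> mf pf; rewrite integralE [RHS]integralE; congr (_ - _)%E.
- rewrite -(ge0_integral_unit_cell_shift c (f := f^\+%E)).
  + by apply: eq_integral => x _; rewrite !funeposE.
  + exact: measurable_funepos.
  + by move=> x; exact: funepos_ge0.
  + by move=> i x; rewrite !funeposE pf.
- rewrite -(ge0_integral_unit_cell_shift c (f := f^\-%E)).
  + by apply: eq_integral => x _; rewrite !funenegE.
  + exact: measurable_funeneg.
  + by move=> x; exact: funeneg_ge0.
  + by move=> i x; rewrite !funenegE pf.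
Qed.

End tuple_space.

(** * Maxwellians *)

Section gaussian.
Context (R : realType).

Lemma measurable_sqnorm n : measurable_fun setT (@sqnorm R n).
Proof.
apply: measurable_sum => i; apply: measurable_funX.
exact: measurable_tnth.
Qed.

Lemma sqnorm_ge0 n (v : space R n) : 0 <= sqnorm v.
Proof. by apply: sumr_ge0 => i _; exact: sqr_ge0. Qed.

Lemma measurable_maxwellian n (T : R) :
  measurable_fun setT (@maxwellian R n T).
Proof.
apply: measurable_funM => //; apply: measurableT_comp => //.
apply: measurableT_comp => //; apply: measurable_funM => //.
exact: measurable_sqnorm.
Qed.

Lemma maxwellian_ge0 n (T : R) (v : space R n) : 0 <= maxwellian T v.
Proof. by rewrite mulr_ge0 ?powR_ge0 ?expR_ge0. Qed.

Lemma maxwellian_gt0 n (T : R) (v : space R n) : 0 < T -> 0 < maxwellian T v.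
Proof. by move=> T0; rewrite mulr_gt0 ?expR_gt0// powR_gt0// mulr_gt0// pi_gt0. Qed.

(** In one dimension exp (- x^2 / T) is a normal law of variance T / 2. Splitting off one coordinate
    allows the normalization to be proved by induction. *)
Lemma maxwellian_cons n (T : R) (x : measurableTypeR R) (v : space R n) : 0 < T ->
  maxwellian T (cons_space (x, v)) =
  normal_pdf 0 (Num.sqrt (T / 2)) x * maxwellian T v.
Proof.
move=> T0; have T20 : 0 < T / 2 by rewrite divr_gt0.
have s0 : Num.sqrt (T / 2) != 0 by rewrite gt_eqF// sqrtr_gt0.
have pT : 0 < pi * T by rewrite mulr_gt0// pi_gt0.
rewrite normal_pdfE// /normal_peak /normal_fun sqr_sqrtr ?ltW// subr0.
have -> : T / 2 * pi *+ 2 = pi * T by rewrite -mulr_natr; field.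
have -> : T / 2 *+ 2 = T by rewrite -mulr_natr; field.
rewrite /maxwellian mulrACA -expRD; congr (_ * expR _).
  rewrite -powR12_sqrt ?ltW// -powRN -powRD; last by apply/implyP => _; rewrite gt_eqF.
  by congr (_ `^ _); rewrite -natr1; field.
rewrite /sqnorm big_ord_recl tnth0.
under eq_bigr do rewrite tnthS.
by rewrite mulrDl opprD !mulNr.
Qed.

Lemma integral_maxwellian n (T : R) : 0 < T ->
  (\int[lebesgue R n]_v (maxwellian T v)%:E = 1)%E.
Proof.
move=> T0; elim: n => [|n IHn].
  rewrite ge0_integral_space0.
  - by rewrite /maxwellian /sqnorm big_ord0 !mul0r !oppr0 powRr0 expR0 mulr1.
  - by apply/measurable_EFinP; exact: measurable_maxwellian.
  - by move=> v; rewrite lee_fin maxwellian_ge0.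
rewrite ge0_integral_cons; last 2 first.
- by apply/measurable_EFinP; exact: measurable_maxwellian.
- by move=> v; rewrite lee_fin maxwellian_ge0.
under eq_integral => x _.
  under eq_integral do rewrite maxwellian_cons// EFinM.
  rewrite ge0_integralZl_EFin ?normal_pdf_ge0//; last 2 first.
  - by move=> v _; rewrite lee_fin maxwellian_ge0.
  - by apply/measurable_EFinP; exact: measurable_maxwellian.
  rewrite IHn mule1.
  over.
by rewrite integral_normal_pdf.
Qed.

Lemma integrable_maxwellian n (T : R) : 0 < T ->
  (lebesgue R n).-integrable setT (EFin \o maxwellian T).
Proof.
move=> T0; apply/integrableP; split.
  by apply/measurable_EFinP; exact: measurable_maxwellian.
under eq_integral do rewrite /= ger0_norm ?maxwellian_ge0//.
by rewrite integral_maxwellian// ltry.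
Qed.

Lemma Rintegral_maxwellian n (T : R) : 0 < T ->
  \int[lebesgue R n]_v maxwellian T v = 1.
Proof. by move=> T0; rewrite /Rintegral integral_maxwellian. Qed.

(** A Gaussian majorant also dominates all translates by bounded vectors, as dominated convergence
    requires in the equidistribution argument. *)
Definition gauss_bounded n (k : space R n -> R) : Prop :=
  measurable_fun setT k /\
  exists A c : R, [/\ 0 <= A, 0 < c & forall v, `|k v| <= A * expR (- (c * sqnorm v))].

Lemma integrable_gauss n (c : R) : 0 < c ->
  (lebesgue R n).-integrable setT (fun v => (expR (- (c * sqnorm v)))%:E).
Proof.
move=> c0; have c10 : 0 < c^-1 by rewrite invr_gt0.
pose a : R := ((pi * c^-1) `^ (- (n%:R / 2)))^-1.
rewrite (_ : (fun _ => _) = (fun v => a%:E * (EFin \o maxwellian c^-1) v)%E).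
  by apply: integrableZl => //; exact: integrable_maxwellian.
apply/funext => v /=; rewrite -EFinM /maxwellian /a invrK mulrA mulVf ?mul1r.
  by rewrite (mulrC c).
by rewrite gt_eqF// powR_gt0// mulr_gt0// pi_gt0.
Qed.

Lemma integrable_gauss_bounded n (k : space R n -> R) : gauss_bounded k ->
  (lebesgue R n).-integrable setT (EFin \o k).
Proof.
move=> [mk [A [c [A0 c0 kA]]]].
apply: (le_integrable _ _ _ (integrableZl _ A (integrable_gauss n c0))) => //.
  exact/measurable_EFinP.
move=> v _ /=; rewrite lee_fin normrM (ger0_norm A0).
by rewrite (ger0_norm (expR_ge0 _)).
Qed.

(** Half of the exponential absorbs the polynomial: 1 + s <= 4 exp (s / 4), squared. *)
Lemma poly_expR_le (s : R) : 0 <= s -> (1 + s) ^+ 2 * expR (- s) <= 16 * expR (- (s / 2)).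
Proof.
move=> s0.
have -> : expR (- s) = expR (- (s / 2)) * expR (- (s / 4)) ^+ 2.
  by rewrite -expRM_natl -expRD; congr expR; field.
rewrite mulrCA mulrC ler_wpM2r ?expR_ge0// -exprMn.
have : 0 <= (1 + s) * expR (- (s / 4)) <= 4.
  rewrite mulr_ge0 ?expR_ge0//=; last by lra.
  rewrite -ler_pdivlMr ?expR_gt0// -expRN opprK.
  have := @expR_ge1Dx R (s / 4); lra.
move=> /andP[x0 x4]; rewrite (_ : 16 = 4 ^+ 2); last by ring.
by rewrite ler_pXn2r// nnegrE.
Qed.

Lemma gauss_bounded_radial n (T A : R) (p : R -> R) : 0 < T -> 0 <= A ->
  measurable_fun setT p ->
  (forall s, 0 <= s -> `|p s| <= A * (1 + s / T) ^+ 2) ->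
  gauss_bounded (fun v : space R n => p (sqnorm v) * maxwellian T v).
Proof.
move=> T0 A0 mp pA; split.
  apply: measurable_funM; last exact: measurable_maxwellian.
  by apply: measurableT_comp => //; exact: measurable_sqnorm.
pose a : R := (pi * T) `^ (- (n%:R / 2)).
have a0 : 0 <= a by exact: powR_ge0.
exists (A * a * 16), (2 * T)^-1; split.
- by rewrite !mulr_ge0.
- by rewrite invr_gt0 mulr_gt0.
move=> v; rewrite normrM (ger0_norm (maxwellian_ge0 _ _)) /maxwellian -/a.
have s0 := sqnorm_ge0 v; have sT0 : 0 <= sqnorm v / T by rewrite divr_ge0// ltW.
have := poly_expR_le sT0.
rewrite (_ : sqnorm v / T / 2 = (2 * T)^-1 * sqnorm v); last first.
  by field; rewrite gt_eqF.
set E := expR (- (_ / T)); set E' := expR _ => EE.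
have E0 : 0 <= E by exact: expR_ge0.
apply: (@le_trans _ _ (A * (1 + sqnorm v / T) ^+ 2 * (a * E))).
  by rewrite ler_wpM2r ?mulr_ge0// pA.
rewrite mulrACA -[leRHS]mulrA.
by rewrite ler_wpM2l ?mulr_ge0.
Qed.

(** The moment is the derivative at l = 1 of the normalization of the Maxwellian of temperature T /
    l. The differentiation is replaced by convexity of the exponential, which gives an inequality
    for every l; taking l on either side of 1 and letting it tend to 1 pins the value down. *)
Lemma second_moment n (T : R) : 0 < T ->
  \int[lebesgue R n]_v (sqnorm v / T * maxwellian T v) = n%:R / 2.
Proof.
move=> T0; set I := Rintegral _ _ _; set m : R := n%:R / 2.
have m0 : 0 <= m by rewrite divr_ge0.
have iI : (lebesgue R n).-integrable setT
    (EFin \o (fun v => sqnorm v / T * maxwellian T v)).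
  apply: integrable_gauss_bounded.
  apply: (@gauss_bounded_radial n T 1 (fun s => s / T)) => //.
    exact: measurable_funM.
  move=> s s0; have sT : 0 <= s / T by rewrite divr_ge0// ltW.
  by rewrite ger0_norm// mul1r; have := sqr_ge0 (s / T); lra.
have I0 : 0 <= I.
  apply: Rintegral_ge0 => v _; rewrite mulr_ge0 ?maxwellian_ge0// divr_ge0 ?sqnorm_ge0//.
  exact: ltW.
have im := @integrable_maxwellian n _ T0.
(* with [M] scaled to temperature [T / l], [l = exp (- 2 q / n)] *)
have scale (l : R) (v : space R n) : 0 < l ->
    maxwellian T v * expR (- ((l - 1) * (sqnorm v / T)))
    = l `^ (- m) * maxwellian (T / l) v.
  move=> l0; rewrite /maxwellian -/m -mulrA -expRD [RHS]mulrA -powRM; last 2 first.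
  - exact: ltW.
  - by rewrite mulr_ge0 ?pi_ge0// ltW// divr_gt0.
  congr (_ `^ _ * expR _); first by field; rewrite gt_eqF.
  by field; rewrite !gt_eqF.
(* Integrate 1 - (l - 1) s <= exp (- (l - 1) s), where s = |v|^2 / T, against the Maxwellian. *)
have squeeze (l : R) : 0 < l ->
    (1 - l) * I <= l `^ (- m) - 1.
  move=> l0; have Tl : 0 < T / l by rewrite divr_gt0.
  have il := @integrable_maxwellian n _ Tl.
  have -> : l `^ (- m) - 1 = \int[lebesgue R n]_v
      (l `^ (- m) * maxwellian (T / l) v - maxwellian T v).
    rewrite RintegralB//; last exact: (integrableZl _ _ il).
    by rewrite RintegralZl// !Rintegral_maxwellian// mulr1.
  rewrite /I -RintegralZl//.
  apply: le_Rintegral => //.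
  - exact: (integrableZl _ _ iI).
  - exact: (integrableB measurableT (integrableZl measurableT _ il) im).
  - move=> v _; rewrite -scale// mulrCA.
    set s := sqnorm v / T; set M := maxwellian T v.
    have M0 : 0 <= M by exact: maxwellian_ge0.
    have := @expR_ge1Dx R (- ((l - 1) * s)).
    move=> /(ler_wpM2l M0); lra.
have powE (r : R) : expR r `^ (- m) = expR (- (m * r)).
  by rewrite /powR gt_eqF ?expR_gt0// expRK mulNr.
have Le (r : R) : expR r * (1 - r) <= 1.
  rewrite -[leRHS](expRxMexpNx_1 r) ler_wpM2l ?expR_ge0//.
  exact: expR_ge1Dx.
(* l = exp r and l = exp (- r) give the two sides; [Le] replaces the exponentials by rational
   functions of r, leaving an error of order r. *)
have key (r : R) : 0 < r -> r < 1 -> m * r < 1 ->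
    `|I - m| <= r * (m + m * I + I + m).
  move=> r0 r1 mr1.
  have mr : 0 <= m * r by rewrite mulr_ge0// ltW.
  have mI : 0 <= m * I by rewrite mulr_ge0.
  rewrite ler_norml; apply/andP; split.
    have := squeeze _ (expR_gt0 r); rewrite powE.
    have e1 := Le r.
    have e2 : expR (- (m * r)) * (1 + m * r) <= 1.
      by have := Le (- (m * r)); rewrite opprK.
    set x := expR r in e1 *; set y := expR _ in e2 *.
    move=> h.
    have x1 : (x - 1) * (1 - r) <= r by lra.
    have y1 : m * r <= (1 - y) * (1 + m * r) by lra.
    have h1 : (1 - y) * (1 + m * r) * (1 - r) <= (x - 1) * I * (1 + m * r) * (1 - r).
      by rewrite !ler_wpM2r//; lra.
    have h2 : m * r * (1 - r) <= (1 - y) * (1 + m * r) * (1 - r).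
      by rewrite ler_wpM2r//; lra.
    have h3 : (x - 1) * (1 - r) * (I * (1 + m * r)) <= r * (I * (1 + m * r)).
      by rewrite ler_wpM2r// mulr_ge0//; lra.
    have : r * (m * (1 - r)) <= r * (I * (1 + m * r)) by lra.
    rewrite ler_pM2l//; have := mulr_ge0 (ltW r0) I0; have := mulr_ge0 (ltW r0) m0.
    lra.
  have := squeeze _ (expR_gt0 (- r)); rewrite powE mulrN opprK.
  have e1 := Le (- r); rewrite opprK in e1.
  have e2 := Le (m * r).
  set x := expR (- r) in e1 *; set y := expR _ in e2 *.
  move=> h.
  have x1 : r <= (1 - x) * (1 + r) by lra.
  have y1 : (y - 1) * (1 - m * r) <= m * r by lra.
  have h1 : (1 - x) * I * (1 + r) * (1 - m * r) <= (y - 1) * (1 + r) * (1 - m * r).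
    rewrite ler_wpM2r//; first by lra.
    by rewrite ler_wpM2r//; lra.
  have h2 : (y - 1) * (1 - m * r) * (1 + r) <= m * r * (1 + r).
    by rewrite ler_wpM2r//; lra.
  have h3 : r * (I * (1 - m * r)) <= (1 - x) * (1 + r) * (I * (1 - m * r)).
    by rewrite ler_wpM2r// mulr_ge0//; lra.
  have : r * (I * (1 - m * r)) <= r * (m * (1 + r)) by lra.
  rewrite ler_pM2l//; have := mulr_ge0 (ltW r0) I0; have := mulr_ge0 (ltW r0) m0.
  lra.
apply/eqP; rewrite -subr_eq0 -normr_le0; apply/ler_addgt0Pr => e e0; rewrite add0r.
set K := m + m * I + I + m in key.
have K0 : 0 <= K by rewrite !addr_ge0// mulr_ge0.
pose r := Num.min (1 / 2) (Num.min (1 / (m + 1) / 2) (e / (K + 1))).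
have m1 : 0 < m + 1 by lra.
have K1 : 0 < K + 1 by lra.
have r0 : 0 < r by rewrite /r !lt_min !divr_gt0.
have ra : r <= 1 / 2 by rewrite /r ge_min lexx.
have rb : r <= 1 / (m + 1) / 2 by rewrite /r !ge_min lexx orbT.
have rc : r * (K + 1) <= e by rewrite -ler_pdivlMr// /r !ge_min lexx !orbT.
apply: (le_trans (key r r0 _ _)); [lra| |lra].
have : (m + 1) * r <= 1 / 2.
  by rewrite mulrC -ler_pdivlMr// (le_trans rb)// ler_pdivlMr// mulrAC divfK ?gt_eqF.
lra.
Qed.

(** Completing the square in z. The last factor is a translate of a normalized Gaussian in z, so
    integrating over z gives the convolution law of the heat kernels. *)
Lemma maxwellian_convolution n (a b : R) (z w : space R n) : 0 < a -> 0 < b ->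
  maxwellian a z * maxwellian b (translate w 1 z) =
  maxwellian (a + b) w * maxwellian (a * b / (a + b)) (translate z (a / (a + b)) w).
Proof.
move=> a0 b0; have ab0 : 0 < a + b by rewrite addr_gt0.
have c0 : 0 < a * b / (a + b) by rewrite divr_gt0// mulr_gt0.
have pi0 := pi_gt0 R.
rewrite /maxwellian mulrACA [RHS]mulrACA -!expRD -!powRM ?mulr_ge0 ?(ltW a0) ?(ltW b0) ?(ltW ab0) ?(ltW c0) ?(ltW pi0)
  ?invr_ge0 ?(ltW ab0)//.
congr (_ `^ _ * expR _); first by field; rewrite gt_eqF.
rewrite -!opprD; congr (- _).
rewrite /sqnorm !mulr_suml -!big_split/=; apply: eq_bigr => i _.
rewrite !tnth_mktuple; field.
by rewrite !gt_eqF// mulr_gt0.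
Qed.

End gaussian.

(** * Weighted spaces of square-integrable functions *)

(* The side condition will be periodicity in x. Elements are functions, not
   classes, so that [dot] is only semidefinite. *)
Record l2_setting d (T : measurableType d) (R : realType) := L2Setting {
  l2_measure : {measure set T -> \bar R};
  l2_weight : T -> R;
  l2_side : (T -> R^o) -> Prop;
  measurable_l2_weight : measurable_fun setT l2_weight;
  l2_weight_ge0 : forall x, 0 <= l2_weight x;
  l2_side0 : l2_side 0;
  l2_sideD : forall a f g, l2_side f -> l2_side g -> l2_side (a *: f + g)
}.

Section l2_space.
Context d (T : measurableType d) (R : realType) (s : l2_setting T R).
Local Notation mu := (l2_measure s).
Local Notation w := (l2_weight s).

Definition is_l2 (f : T -> R) : Prop :=
  [/\ measurable_fun setT f,
      mu.-integrable setT (fun x => (f x ^+ 2 * w x)%:E) & l2_side s f].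

Definition l2_pred : {pred T -> R^o} := fun f => `[< is_l2 f >].

Lemma l2_predP f : reflect (is_l2 f) (f \in l2_pred).
Proof. exact: asboolP. Qed.

Lemma integrable_l2_mul f g : is_l2 f -> is_l2 g ->
  mu.-integrable setT (fun x => (f x * g x * w x)%:E).
Proof.
move=> [mf if2 _] [mg ig2 _].
apply: (le_integrable _ _ _ (integrableD measurableT if2 ig2)) => //.
  apply/measurable_EFinP; apply: measurable_funM; last exact: measurable_l2_weight.
  exact: measurable_funM.
move=> x _; rewrite -EFinD /= lee_fin -mulrDl.
rewrite [leLHS]normrM [leRHS]normrM ler_wpM2r// normrM.
rewrite [leRHS]ger0_norm ?addr_ge0 ?sqr_ge0//.
rewrite -(real_normK (num_real (f x))) -(real_normK (num_real (g x))).
set a := `|f x|; set b := `|g x|.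
have := sqr_ge0 (a - b); have := sqr_ge0 a; have := sqr_ge0 b; lra.
Qed.

Lemma l2_submod_closed : submod_closed l2_pred.
Proof.
split.
  apply/l2_predP; split; [exact: measurable_cst| |exact: l2_side0].
  by under eq_fun do rewrite /= expr0n/= mul0r; exact: integrable0.
move=> a f g /l2_predP[mf if2 sf] /l2_predP[mg ig2 sg].
apply/l2_predP; split; last exact: l2_sideD.
- apply: measurable_funD => //; exact: measurable_funM.
- have ifg : mu.-integrable setT (fun x => (f x * g x * w x)%:E).
    exact: integrable_l2_mul.
  rewrite (_ : (fun _ => _) = (fun x => (a ^+ 2)%:E * (f x ^+ 2 * w x)%:E +
      ((2 * a)%:E * (f x * g x * w x)%:E + (g x ^+ 2 * w x)%:E))%E); last first.
    apply/funext => x; rewrite -!EFinM -!EFinD; congr EFin.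
    rewrite (_ : (a *: f + g) x = a * f x + g x)//; ring.
  apply: integrableD => //; first exact: integrableZl.
  by apply: integrableD => //; exact: integrableZl.
Qed.

HB.instance Definition _ := GRing.isSubmodClosed.Build R (T -> R^o) l2_pred
  l2_submod_closed.

Record l2 := MkL2 { l2_fun : T -> R^o ; _ : l2_fun \in l2_pred }.
HB.instance Definition _ := [isSub for l2_fun].
HB.instance Definition _ := [Choice of l2 by <:].
HB.instance Definition _ := [SubChoice_isSubLmodule of l2 by <:].

Definition l2_app (f : l2) : T -> R := l2_fun f.
Coercion l2_app : l2 >-> Funclass.

Lemma l2P (f : l2) : is_l2 f. Proof. by apply/l2_predP; exact: valP. Qed.

Lemma l2_measurable (f : l2) : measurable_fun setT f.
Proof. by case: (l2P f). Qed.

Lemma l2_sideP (f : l2) : l2_side s f. Proof. by case: (l2P f). Qed.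

Lemma l2_integrable (f g : l2) : mu.-integrable setT (fun x => (f x * g x * w x)%:E).
Proof. by apply: integrable_l2_mul; exact: l2P. Qed.

Lemma l2_funD (f g : l2) x : (f + g) x = f x + g x. Proof. by []. Qed.
Lemma l2_funZ a (f : l2) x : (a *: f) x = a * f x. Proof. by []. Qed.
Lemma l2_funN (f : l2) x : (- f) x = - f x. Proof. by []. Qed.

Lemma l2_ext (f g : l2) : f =1 g -> f = g.
Proof. by move=> fg; exact/val_inj/funext. Qed.

(** Functions outside the space are sent to 0, so each operator defined this way comes with a proof
    of [is_l2]. *)
Definition to_l2 (f : T -> R) : l2 := insubd (0 : l2) f.

Lemma to_l2E f : is_l2 f -> to_l2 f = f :> (T -> R).
Proof. by move=> /l2_predP ff; rewrite /l2_app /to_l2 [LHS]insubdK. Qed.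

Definition dot (f g : l2) : R := \int[mu]_x (f x * g x * w x).

Lemma dotC f g : dot f g = dot g f.
Proof. by apply: eq_Rintegral => x _; rewrite (mulrC (f x)). Qed.

Lemma dotDl f g h : dot (f + g) h = dot f h + dot g h.
Proof.
rewrite /dot -RintegralD//; try exact: l2_integrable.
by apply: eq_Rintegral => x _; rewrite l2_funD !mulrDl.
Qed.

Lemma dotZl a f g : dot (a *: f) g = a * dot f g.
Proof.
rewrite /dot -RintegralZl//; last exact: l2_integrable.
by apply: eq_Rintegral => x _; rewrite l2_funZ !mulrA.
Qed.

Lemma dot_ge0 f : 0 <= dot f f.
Proof.
by apply: Rintegral_ge0 => x _; rewrite mulr_ge0 ?l2_weight_ge0// -expr2 sqr_ge0.
Qed.

Lemma dot_integralE (f : l2) :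
  (dot f f)%:E = (\int[mu]_x (f x ^+ 2 * w x)%:E)%E.
Proof.
rewrite /dot /Rintegral fineK; last first.
  by apply: integrable_fin_num => //; exact: l2_integrable.
by apply: eq_integral => x _; rewrite expr2.
Qed.

End l2_space.

(** * Real-valued integrals: divergent integrals and Fubini's theorem *)

Section Rintegral_unintegrable.
Context d (T : measurableType d) (R : realType) (mu : {measure set T -> \bar R}).

(** The integrals of the positive and negative parts add up to +oo, so their extended difference is
    infinite, oo - oo included, and [fine] turns it into 0. *)
Lemma Rintegral_unintegrable (f : T -> R) : measurable_fun setT f ->
  ~ mu.-integrable setT (EFin \o f) -> \int[mu]_x f x = 0.
Proof.
move=> mf nif; rewrite /Rintegral integralE.
have mEf : measurable_fun setT (EFin \o f) by exact/measurable_EFinP.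
have : (\int[mu]_x (EFin \o f)^\+ x + \int[mu]_x (EFin \o f)^\- x = +oo)%E.
  rewrite -ge0_integralD//; try by [exact: measurable_funepos|exact: measurable_funeneg].
  apply/eqP; rewrite -leye_eq leNgt; apply/negP => foo; apply: nif.
  apply/integrableP; split => //; apply: le_lt_trans foo.
  rewrite le_eqVlt; apply/orP; left; apply/eqP; apply: eq_integral => x _.
  by rewrite -[LHS]/((abse \o (EFin \o f)) x) fune_abse.
have p0 : (0 <= \int[mu]_x (EFin \o f)^\+ x)%E by exact: integral_ge0.
have n0 : (0 <= \int[mu]_x (EFin \o f)^\- x)%E by exact: integral_ge0.
by case: (\int[mu]_x (EFin \o f)^\+ x)%E p0 => [p| |]//;
  case: (\int[mu]_x (EFin \o f)^\- x)%E n0 => [n| |].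
Qed.

(** Thanks to the value 0 of divergent integrals, scalars can be moved through fibre integrals at
    every point, not just at almost every one. *)
Lemma RintegralZl_measurable (c : R) (f : T -> R) : measurable_fun setT f ->
  \int[mu]_x (c * f x) = c * \int[mu]_x f x.
Proof.
move=> mf; have [->|c0] := eqVneq c 0.
  rewrite mul0r; under eq_Rintegral do rewrite mul0r.
  by rewrite /Rintegral integral0.
have [fi|nfi] := pselect (mu.-integrable setT (EFin \o f)); first exact: RintegralZl.
rewrite (Rintegral_unintegrable mf nfi) mulr0 Rintegral_unintegrable//.
  exact: measurable_funM.
move=> icf; apply: nfi.
rewrite (_ : EFin \o f = (fun x => c^-1%:E * (c * f x)%:E)%E).
  exact: integrableZl.
by apply/funext => x /=; rewrite -EFinM mulKf.
Qed.

End Rintegral_unintegrable.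

Section real_fubini.
Context d1 d2 (T1 : measurableType d1) (T2 : measurableType d2) (R : realType).
Context (m1 : {sigma_finite_measure set T1 -> \bar R}).
Context (m2 : {sigma_finite_measure set T2 -> \bar R}).
Local Notation mm := (m1 \x m2)%E.

Lemma measurable_Rintegral1 (f : T1 * T2 -> R) : measurable_fun setT f ->
  measurable_fun setT (fun x => \int[m2]_y f (x, y)).
Proof.
move=> mf; apply: (measurableT_comp (@fine_measurable R setT measurableT)).
have mEf : measurable_fun setT (EFin \o f) by exact/measurable_EFinP.
rewrite (_ : (fun _ => _) = (fun x => \int[m2]_y ((EFin \o f)^\+ (x, y))
    - \int[m2]_y ((EFin \o f)^\- (x, y)))%E); last first.
  apply/funext => x; rewrite integralE; congr (_ - _)%E;
    by apply: eq_integral => y _; rewrite ?funeposE ?funenegE.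
apply: emeasurable_funB.
- apply: (@measurable_fun_fubini_tonelli_F _ _ _ _ _ _ (EFin \o f)^\+%E) => //.
  exact: measurable_funepos.
- apply: (@measurable_fun_fubini_tonelli_F _ _ _ _ _ _ (EFin \o f)^\-%E) => //.
  exact: measurable_funeneg.
Qed.

Section integrable.
Variable f : T1 * T2 -> R.
Hypothesis fi : mm.-integrable setT (EFin \o f).

Let mf : measurable_fun setT f.
Proof. by apply/measurable_EFinP; exact: measurable_int fi. Qed.

Lemma integrable_Rintegral1 :
  m1.-integrable setT (fun x => (\int[m2]_y f (x, y))%:E).
Proof.
apply: (le_integrable _ _ _ (integrable_fubini_F fi)) => //.
  by apply/measurable_EFinP; exact: measurable_Rintegral1.
move=> x _; rewrite /Rintegral /fubini_F.
by case: (integral _ _ _) => [r| |]//=; rewrite normr0 leey.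
Qed.

(** The inner integral may diverge for x in a null set, where the real-valued and the extended one
    differ; agreement almost everywhere is enough. *)
Lemma Rfubini1 : \int[m1]_x \int[m2]_y f (x, y) = \int[mm]_z f z.
Proof.
rewrite /Rintegral -integral12_prod_meas1//; congr fine.
apply: ae_eq_integral => //.
- exact: measurable_int integrable_Rintegral1.
- exact: measurable_fubini_F fi.
have := integrable_ae measurableT (integrable_fubini_F fi).
by apply: filterS => x /(_ I) fx _; rewrite fineK.
Qed.

Lemma Rfubini2 : \int[m2]_y \int[m1]_x f (x, y) = \int[mm]_z f z.
Proof.
rewrite /Rintegral -integral21_prod_meas1//; congr fine.
apply: ae_eq_integral => //.
- apply/measurable_EFinP.
  apply: (measurableT_comp (@fine_measurable R setT measurableT)).
  exact: measurable_fubini_G fi.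
- exact: measurable_fubini_G fi.
have swapi : (m2 \x m1)%E.-integrable setT (fun z => (f (z.2, z.1))%:E).
  apply/integrable21ltyP.
    apply/measurable_EFinP; apply: measurableT_comp => //.
    by apply: measurable_fun_pair; [exact: measurable_snd|exact: measurable_fst].
  by move: fi => /integrable12ltyP; apply; exact/measurable_EFinP.
have := integrable_ae measurableT (integrable_fubini_F swapi).
by apply: filterS => x /(_ I) fx _; rewrite fineK.
Qed.

End integrable.

Lemma integrable_tensor (f : T1 -> R) (g : T2 -> R) :
  m1.-integrable setT (EFin \o f) -> m2.-integrable setT (EFin \o g) ->
  mm.-integrable setT (fun z => (f z.1 * g z.2)%:E).
Proof.
move=> fi gi.
have mf : measurable_fun setT f by apply/measurable_EFinP; exact: measurable_int fi.
have mg : measurable_fun setT g by apply/measurable_EFinP; exact: measurable_int gi.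
have mfg : measurable_fun setT (fun z : T1 * T2 => (f z.1 * g z.2)%:E).
  apply/measurable_EFinP; apply: measurable_funM.
    exact: measurableT_comp.
  exact: measurableT_comp.
apply/integrable12ltyP => //=.
under eq_integral => x _.
  under eq_integral do rewrite normrM EFinM.
  rewrite ge0_integralZl_EFin//; last first.
    by apply/measurable_EFinP; exact: measurableT_comp.
  over.
have /integrableP[_ fi'] := fi; have /integrableP[_ gi'] := gi.
have g0 : (0 <= \int[m2]_x (`|g x|)%:E)%E by exact: integral_ge0.
rewrite -(fineK (_ : (\int[m2]_x (`|g x|)%:E)%E \is a fin_num)); last first.
  by rewrite ge0_fin_numE.
under eq_integral do rewrite muleC.
rewrite ge0_integralZl_EFin// ?fine_ge0//; last first.
  by apply/measurable_EFinP; exact: measurableT_comp.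
by rewrite lte_mul_pinfty// ?lee_fin ?fine_ge0.
Qed.

End real_fubini.

(** * Function spaces over the torus and free transport *)

Section torus.
Context (R : realType) (d : nat).
Local Notation X := (space R d).
Local Notation mu := (lebesgue R d).
Local Notation cell := (@unit_cell R d).

Lemma translateE (x : X) t (v : X) i : tnth (translate x t v) i = tnth x i - t * tnth v i.
Proof. by rewrite tnth_mktuple. Qed.

Lemma measurable_translate d' (T : measurableType d') (x v : T -> X) (t : T -> R) :
  measurable_fun setT x -> measurable_fun setT t -> measurable_fun setT v ->
  measurable_fun setT (fun z => translate (x z) (t z) (v z)).
Proof.
move=> mx mt mv; apply: measurable_fun_space => i.
under eq_fun do rewrite translateE.
apply: measurable_funB; first exact: measurable_tnth_comp.
by apply: measurable_funM => //; exact: measurable_tnth_comp.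
Qed.

(** Integrals over the cell are written on the whole space against this weight, which makes the
    torus and phase space instances of [l2_setting]. *)
Definition cellw (x : X) : R := \1_cell x.

Lemma measurable_cellw : measurable_fun setT cellw.
Proof. by apply: measurable_indic; exact: measurable_unit_cell. Qed.

Lemma cellw_ge0 x : 0 <= cellw x. Proof. exact: ler0n. Qed.

Lemma integral_cellw (F : X -> \bar R) :
  (\int[mu]_x (F x * (cellw x)%:E) = \int[mu]_(x in cell) F x)%E.
Proof.
rewrite [RHS]integral_mkcond; apply: eq_integral => x _.
rewrite patchE /cellw indicE; case: ifPn => _; first by rewrite mule1.
by rewrite mule0.
Qed.

Lemma Rintegral_cellw (f : X -> R) :
  \int[mu]_x (f x * cellw x) = \int[mu]_(x in cell) f x.
Proof.
rewrite /Rintegral -integral_cellw; congr fine.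
Qed.

Lemma integral_cell_translate (F : X -> \bar R) t (v : X) :
  measurable_fun setT F -> eperiodic F ->
  (\int[mu]_x (F (translate x t v) * (cellw x)%:E) = \int[mu]_x (F x * (cellw x)%:E))%E.
Proof.
move=> mF pF; rewrite !integral_cellw.
pose c : X := [tuple t * tnth v i | i < d].
rewrite -(integral_unit_cell_shift c mF pF); apply: eq_integral => x _.
by congr F; apply: eq_from_tnth => i; rewrite !tnth_mktuple.
Qed.

Lemma Rintegral_cell_translate (f : X -> R) t (v : X) :
  measurable_fun setT f -> periodic f ->
  \int[mu]_x (f (translate x t v) * cellw x) = \int[mu]_x (f x * cellw x).
Proof.
move=> mf pf; congr fine.
apply: (@integral_cell_translate (EFin \o f)); first exact/measurable_EFinP.
by move=> i x /=; rewrite pf.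
Qed.

Lemma periodic_translate (f : X -> R) t (v : X) :
  periodic f -> periodic (fun x => f (translate x t v)).
Proof.
move=> pf i x; rewrite -[RHS](pf i); congr f; apply: eq_from_tnth => j.
by rewrite !tnth_mktuple addrAC.
Qed.

Lemma periodic0 : periodic (0 : X -> R^o). Proof. by []. Qed.

Lemma periodicD a (f g : X -> R^o) : periodic f -> periodic g -> periodic (a *: f + g).
Proof.
move=> pf pg i x.
by rewrite (_ : forall y, (a *: f + g) y = a * f y + g y)// pf pg.
Qed.

Definition torus_setting : l2_setting X R :=
  L2Setting mu measurable_cellw cellw_ge0 periodic0 periodicD.

Local Notation BS := (l2 torus_setting).

Section phase.
Variables (rho T : R).

(* The absolute value makes the weight nonnegative without assumption on rho. *)
Definition phasew (z : X * X) : R :=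
  cellw z.1 * ((`|rho| * (pi * T) `^ (- (d%:R / 2)))^-1 * expR (sqnorm z.2 / T)).

Lemma measurable_phasew : measurable_fun setT phasew.
Proof.
apply: measurable_funM.
  by apply: measurableT_comp => //; exact: measurable_cellw.
apply: measurable_funM => //; apply: measurableT_comp => //.
apply: measurable_funM => //; apply: measurableT_comp => //.
exact: measurable_sqnorm.
Qed.

Lemma phasew_ge0 z : 0 <= phasew z.
Proof. by rewrite !mulr_ge0 ?cellw_ge0 ?expR_ge0// invr_ge0 mulr_ge0// powR_ge0. Qed.

Definition xperiodic (f : X * X -> R^o) : Prop := forall v, periodic (fun x => f (x, v)).

Lemma xperiodic0 : xperiodic 0. Proof. by []. Qed.

Lemma xperiodicD a (f g : X * X -> R^o) : xperiodic f -> xperiodic g ->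
  xperiodic (a *: f + g).
Proof.
by move=> pf pg v; exact: (periodicD a (pf v) (pg v)).
Qed.

Definition phase_setting : l2_setting (X * X)%type R :=
  L2Setting (mu \x mu)%E measurable_phasew phasew_ge0 xperiodic0 xperiodicD.

Local Notation FS := (l2 phase_setting).

Hypotheses (rho0 : 0 < rho) (T0 : 0 < T).
Local Notation finf := (@f_inf R d rho T).

Lemma f_inf_gt0 (v : X) : 0 < f_inf rho T v.
Proof. by rewrite mulr_gt0// maxwellian_gt0. Qed.

Lemma measurable_f_inf : measurable_fun setT finf.
Proof. by apply: measurable_funM => //; exact: measurable_maxwellian. Qed.

Lemma measurable_f_infV : measurable_fun setT (fun v => (finf v)^-1).
Proof.
rewrite (_ : (fun _ => _) =
    (fun v => (rho * (pi * T) `^ (- (d%:R / 2)))^-1 * expR (sqnorm v / T))).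
  apply: measurable_funM => //; apply: measurableT_comp => //.
  by apply: measurable_funM => //; exact: measurable_sqnorm.
apply/funext => v; rewrite /f_inf /maxwellian mulrA invfM; congr (_ * _).
by rewrite -expRN opprK.
Qed.

Lemma phasewE z : phasew z = cellw z.1 * (f_inf rho T z.2)^-1.
Proof.
rewrite /phasew /f_inf /maxwellian ger0_norm ?ltW// mulrA.
by rewrite [in RHS]invfM -expRN opprK.
Qed.

Lemma measurable_transport t (f : X * X -> R) : measurable_fun setT f ->
  measurable_fun setT (fun z => f (translate z.1 t z.2, z.2)).
Proof.
move=> mf; apply: (measurableT_comp mf); apply: measurable_fun_pair => /=.
  apply: (measurable_translate (x := fst) (v := snd) (t := cst t)) => //.
exact: measurable_snd.
Qed.

(** For fixed v transport is a translation in x, which preserves cell integrals of periodic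
    functions; hence the velocity is taken as the outer variable. *)
Lemma transport_l2 t (f : FS) :
  is_l2 phase_setting (fun z => f (translate z.1 t z.2, z.2)).
Proof.
have [mf if2 pf] := l2P f; split.
- exact: measurable_transport.
- pose g (z : X * X) : R := (f z : R) ^+ 2 * ((`|rho| * (pi * T) `^ (- (d%:R / 2)))^-1
    * expR (sqnorm z.2 / T)).
  have mg : measurable_fun setT g.
    apply: measurable_funM; first exact: measurable_funX.
    apply: measurable_funM => //; apply: measurableT_comp => //.
    apply: measurable_funM => //; apply: measurableT_comp => //.
    exact: measurable_sqnorm.
  have g0 z : 0 <= g z.
    rewrite /g mulr_ge0 ?sqr_ge0// mulr_ge0 ?expR_ge0// invr_ge0.
    by rewrite mulr_ge0 ?powR_ge0.
  have gE z : f z ^+ 2 * phasew z = g z * cellw z.1.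
    by rewrite /g /phasew; ring.
  have gtE z : f (translate z.1 t z.2, z.2) ^+ 2 * phasew z =
      g (translate z.1 t z.2, z.2) * cellw z.1.
    by rewrite /g /phasew/=; ring.
  have mcell : measurable_fun setT (fun z : X * X => cellw z.1).
    by apply: measurableT_comp => //; exact: measurable_cellw.
  move: if2; under eq_fun do rewrite gE.
  move=> /integrable21ltyP H; under eq_fun do rewrite gtE.
  apply/integrable21ltyP.
    apply/measurable_EFinP; apply: measurable_funM => //.
    exact: measurable_transport.
  have {}H := H (_ : measurable_fun _ _).
  apply: (le_lt_trans _ (H _)); last first.
    by apply/measurable_EFinP; exact: measurable_funM.
  rewrite le_eqVlt; apply/orP; left; apply/eqP; apply: eq_integral => v _.
  have nE z y : (`|g z * cellw y|%:E = (g z)%:E * (cellw y)%:E)%E.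
    by rewrite (ger0_norm (mulr_ge0 (g0 z) (cellw_ge0 y))) EFinM.
  under eq_integral do rewrite /= nE.
  under [RHS]eq_integral do rewrite /= nE.
  apply: (@integral_cell_translate (fun x => (g (x, v))%:E)).
    by apply/measurable_EFinP; apply: measurableT_comp => //; exact: measurable_pair2.
  by move=> i x; rewrite /g /= pf.
- by move=> v; exact: periodic_translate (pf v).
Qed.

Definition transport t (f : FS) : FS :=
  to_l2 _ (fun z => f (translate z.1 t z.2, z.2)).

Lemma transportE t f z : transport t f z = f (translate z.1 t z.2, z.2).
Proof. by rewrite /transport to_l2E//; exact: transport_l2. Qed.

Lemma transportD t f g : transport t (f + g) = transport t f + transport t g.
Proof. by apply: l2_ext => z; rewrite l2_funD !transportE. Qed.

Lemma transportZ t a f : transport t (a *: f) = a *: transport t f.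
Proof. by apply: l2_ext => z; rewrite l2_funZ !transportE. Qed.

Lemma transportN t f : transport t (- f) = - transport t f.
Proof. by apply: l2_ext => z; rewrite l2_funN !transportE. Qed.

Lemma transport_add s t f : transport s (transport t f) = transport (s + t) f.
Proof.
apply: l2_ext => z; rewrite !transportE/=; congr (f (_, _)).
by apply: eq_from_tnth => i; rewrite !tnth_mktuple; ring.
Qed.

Lemma transport0 f : transport 0 f = f.
Proof.
apply: l2_ext => z; rewrite !transportE/= [in RHS](surjective_pairing z).
congr (f (_, _)).
by apply: eq_from_tnth => i; rewrite !tnth_mktuple mul0r subr0.
Qed.

Lemma dot_transport t f g : dot (transport t f) (transport t g) = dot f g.
Proof.
rewrite /dot -(Rfubini2 (l2_integrable f g)).
rewrite -(Rfubini2 (l2_integrable (transport t f) (transport t g))).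
apply: eq_Rintegral => v _.
pose c := (`|rho| * (pi * T) `^ (- (d%:R / 2)))^-1 * expR (sqnorm v / T).
transitivity (\int[mu]_x (f (translate x t v, v) * g (translate x t v, v) * c * cellw x)).
  by apply: eq_Rintegral => x _; rewrite /= !transportE /phasew /c/=; ring.
have mv (h : FS) : measurable_fun setT (fun x => h (x, v)).
  by apply: (measurableT_comp (l2_measurable h)); exact: measurable_pair2.
rewrite (@Rintegral_cell_translate (fun x => f (x, v) * g (x, v) * c)).
- by apply: eq_Rintegral => x _; rewrite /= /phasew /c/=; ring.
- by do 2 apply: measurable_funM => //; exact: mv.
- by move=> i x; rewrite (l2_sideP f) (l2_sideP g).
Qed.

End phase.
End torus.

Section l2_norm.
Context d (T : measurableType d) (R : realType) (s : l2_setting T R).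
Implicit Types f g h : l2 s.
Local Notation nrm := (seminorm (@dot _ T R s)).

Lemma dotDr f g h : dot h (f + g) = dot h f + dot h g.
Proof. by rewrite !(dotC h) dotDl. Qed.

Lemma dotZr a f g : dot g (a *: f) = a * dot g f.
Proof. by rewrite !(dotC g) dotZl. Qed.

Lemma dotNl f g : dot (- f) g = - dot f g.
Proof. by rewrite -scaleN1r dotZl mulN1r. Qed.

Lemma dotNr f g : dot f (- g) = - dot f g.
Proof. by rewrite dotC dotNl dotC. Qed.

Lemma dotBl f g h : dot (f - g) h = dot f h - dot g h.
Proof. by rewrite dotDl dotNl. Qed.

Lemma dotBr f g h : dot h (f - g) = dot h f - dot h g.
Proof. by rewrite dotDr dotNr. Qed.

Lemma dot_le f g : `|dot f g| <= nrm f * nrm g.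
Proof.
by apply: ip_le; [exact: dotC|exact: dotDl|exact: dotZl|exact: dot_ge0].
Qed.

Lemma l2norm_sqr f : nrm f ^+ 2 = dot f f.
Proof. by rewrite sqr_sqrtr// dot_ge0. Qed.

Lemma l2norm_ge0 f : 0 <= nrm f. Proof. exact: sqrtr_ge0. Qed.

Lemma l2normD f g : nrm (f + g) <= nrm f + nrm g.
Proof.
by apply: seminormD; [exact: dotC|exact: dotDl|exact: dotZl|exact: dot_ge0].
Qed.

Lemma l2normN f : nrm (- f) = nrm f.
Proof. by rewrite /seminorm dotNl dotNr opprK. Qed.

Lemma l2normB f g : nrm (f - g) <= nrm f + nrm g.
Proof. by rewrite (le_trans (l2normD _ _))// l2normN. Qed.

Lemma l2normZ a f : nrm (a *: f) = `|a| * nrm f.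
Proof.
by apply: seminormZ; [exact: dotC|exact: dotZl].
Qed.

Lemma l2norm_le_dual f (c : R) : 0 <= c -> dot f f <= c * nrm f -> nrm f <= c.
Proof.
move=> c0; rewrite -l2norm_sqr expr2 => h.
have [->//|f0] := eqVneq (nrm f) 0.
by rewrite -(ler_pM2r (_ : 0 < nrm f))// lt_neqAle eq_sym f0 l2norm_ge0.
Qed.

End l2_norm.

(** * Shifts and correlations on the torus, lifts and velocity moments *)

Section torus_operators.
Context (R : realType) (d : nat).
Local Notation X := (space R d).
Local Notation mu := (lebesgue R d).
Local Notation cell := (@unit_cell R d).
Local Notation BS := (l2 (torus_setting R d)).

Lemma integrable_cellw : mu.-integrable setT (EFin \o @cellw R d).
Proof.
apply/integrableP; split.
  by apply/measurable_EFinP; exact: measurable_cellw.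
rewrite (_ : integral _ _ _ = \int[mu]_(x in cell) 1)%E.
  rewrite integral_cst; last exact: measurable_unit_cell.
  by rewrite mul1e [X in (X < _)%E](lebesgue_unit_cell R d) ltry.
rewrite -integral_cellw; apply: eq_integral => x _.
by rewrite /= (ger0_norm (cellw_ge0 x)) mul1e.
Qed.

Lemma cst_l2 (c : R) : is_l2 (torus_setting R d) (fun=> c).
Proof.
by split => //; exact: (integrableZl measurableT (c ^+ 2) integrable_cellw).
Qed.

Definition l2_one : BS := to_l2 _ (fun=> 1).

Lemma l2_oneE x : l2_one x = 1.
Proof. by rewrite /l2_one to_l2E//; exact: cst_l2. Qed.

Lemma dot_one : dot l2_one l2_one = 1.
Proof.
rewrite /dot; under eq_Rintegral do rewrite l2_oneE mul1r.
rewrite Rintegral_cellw /Rintegral integral_cst; last exact: measurable_unit_cell.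
by rewrite mul1e [X in fine X](lebesgue_unit_cell R d).
Qed.

Lemma dot_onel (b : BS) : dot l2_one b = \int[mu]_(x in cell) b x.
Proof.
by rewrite -Rintegral_cellw; apply: eq_Rintegral => x _; rewrite l2_oneE mul1r.
Qed.

Lemma measurable_translater (f : X -> R) t (v : X) : measurable_fun setT f ->
  measurable_fun setT (fun x => f (translate x t v)).
Proof.
move=> mf; apply: (measurableT_comp mf).
by apply: (measurable_translate (x := id) (t := cst t) (v := cst v)).
Qed.

Lemma shift_l2 y (b : BS) : is_l2 (torus_setting R d) (fun x => b (translate x 1 y)).
Proof.
have [mb ib pb] := l2P b; split.
- exact: measurable_translater.
- move: ib => /integrableP[_ ib]; apply/integrableP; split.
    apply/measurable_EFinP; apply: measurable_funM; last exact: measurable_cellw.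
    by apply: measurable_funX; exact: measurable_translater.
  apply: le_lt_trans ib; rewrite le_eqVlt; apply/orP; left; apply/eqP.
  have nE (z : R) x : (`|z ^+ 2 * cellw x|%:E = (z ^+ 2)%:E * (cellw x)%:E)%E.
    by rewrite (ger0_norm (mulr_ge0 (sqr_ge0 z) (cellw_ge0 x))) EFinM.
  under eq_integral do rewrite /= nE.
  under [RHS]eq_integral do rewrite /= nE.
  apply: (@integral_cell_translate _ _ (fun x => (b x ^+ 2)%:E)).
    by apply/measurable_EFinP; exact: measurable_funX.
  by move=> i x /=; rewrite pb.
- exact: periodic_translate.
Qed.

Definition shift y (b : BS) : BS := to_l2 _ (fun x => b (translate x 1 y)).

Lemma shiftE y b x : shift y b x = b (translate x 1 y).
Proof. by rewrite /shift to_l2E//; exact: shift_l2. Qed.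

Lemma dot_shift y (b c : BS) : dot (shift y b) (shift y c) = dot b c.
Proof.
rewrite /dot; under eq_Rintegral do rewrite !shiftE.
apply: (@Rintegral_cell_translate _ _ (fun x => b x * c x)).
  by apply: measurable_funM; exact: l2_measurable.
by move=> i x; rewrite (l2_sideP b) (l2_sideP c).
Qed.

(** Sums y + z of points are written [translate y (-1) z]; likewise [translate [tuple 0 | i < d] 1
    y] stands for - y. *)
Lemma shift_shift y z b : shift y (shift z b) = shift (translate y (-1) z) b.
Proof.
apply: l2_ext => x; rewrite !shiftE; congr (b _).
by apply: eq_from_tnth => i; rewrite !tnth_mktuple; ring.
Qed.

Definition scale t (v : X) : X := [tuple t * tnth v i | i < d].

(* Free transport of local equilibria pairs to velocity averages of this periodic
   function along dilations. *)
Definition corr (b c : BS) (y : X) : R := dot (shift y b) c.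

Lemma measurable_corr b c : measurable_fun setT (corr b c).
Proof.
rewrite /corr /dot.
apply: (@measurable_Rintegral1 _ _ _ _ _ mu (fun z : X * X =>
  shift z.1 b z.2 * c z.2 * cellw z.2)).
apply: measurable_funM; last first.
  by apply: measurableT_comp; [exact: measurable_cellw|exact: measurable_snd].
apply: measurable_funM; last first.
  by apply: measurableT_comp; [exact: l2_measurable|exact: measurable_snd].
under eq_fun do rewrite shiftE.
apply: measurableT_comp; first exact: l2_measurable.
by apply: (measurable_translate (x := snd) (t := cst 1) (v := fst)).
Qed.

Lemma corr_le b c y : `|corr b c y| <=
  seminorm (@dot _ _ _ _) b * seminorm (@dot _ _ _ _) c.
Proof.
by rewrite (le_trans (dot_le _ _))// /seminorm dot_shift.
Qed.

Lemma corr_sym b c y : corr b c y = corr c b (translate [tuple 0 | i < d] 1 y).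
Proof.
rewrite /corr (dotC (shift _ c)) -(dot_shift (translate [tuple 0 | i < d] 1 y)).
rewrite shift_shift; congr (dot _ _).
apply: l2_ext => x; rewrite shiftE; congr (b _).
by apply: eq_from_tnth => i; rewrite !tnth_mktuple; ring.
Qed.

Lemma integrable_l2_cellw (b : BS) : mu.-integrable setT (fun x => (b x * cellw x)%:E).
Proof.
have := l2_integrable b l2_one.
by rewrite (_ : (fun _ => _) = (fun x => (b x * cellw x)%:E))//;
  apply/funext => x; rewrite l2_oneE mulr1.
Qed.

(** Integrate in z before x: by periodicity the cell integral of b (x - y + z) over z is the mean of
    b, whatever x and y are. *)
Lemma mean_corr b c y :
  \int[mu]_(z in cell) corr b c (translate y 1 z) = dot b l2_one * dot c l2_one.
Proof.
rewrite -Rintegral_cellw.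
pose F (p : X * X) : R := b (translate p.2 1 (translate y 1 p.1)) * c p.2
  * cellw p.2 * cellw p.1.
have mF : measurable_fun setT F.
  apply: measurable_funM; last first.
    by apply: measurableT_comp; [exact: measurable_cellw|exact: measurable_fst].
  apply: measurable_funM; last first.
    by apply: measurableT_comp; [exact: measurable_cellw|exact: measurable_snd].
  apply: measurable_funM; last first.
    by apply: measurableT_comp; [exact: l2_measurable|exact: measurable_snd].
  apply: measurableT_comp; first exact: l2_measurable.
  apply: (measurable_translate (x := snd) (t := cst 1)) => //.
  by apply: (measurable_translate (x := cst y) (t := cst 1) (v := fst)).
pose w (x : X) := translate y 1 x.
have FE z x : F (z, x) = b (translate z (-1) (translate x 1 y)) * (c x * cellw x) * cellw z.
  rewrite /F/= -!mulrA; congr (b _ * _).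
  by apply: eq_from_tnth => i; rewrite !tnth_mktuple; ring.
have intF : (mu \x mu)%E.-integrable setT (EFin \o F).
  have := integrable_tensor (integrable_l2_cellw b) (integrable_l2_cellw c).
  move=> /integrable21ltyP H; apply/integrable21ltyP; first exact/measurable_EFinP.
  apply: le_lt_trans (H _); last first.
    apply/measurable_EFinP; apply: measurable_funM.
      apply: (measurableT_comp (f := fun x => b x * cellw x)) => //.
      by apply: measurable_funM; [exact: l2_measurable|exact: measurable_cellw].
    apply: (measurableT_comp (f := fun x => c x * cellw x)) => //.
    by apply: measurable_funM; [exact: l2_measurable|exact: measurable_cellw].
  rewrite le_eqVlt; apply/orP; left; apply/eqP; apply: eq_integral => x _.
  pose K := `|c x * cellw x|.
  have nE (r : R) z : (`|r * (c x * cellw x) * cellw z|%:E =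
      (`|r| * K)%:E * (cellw z)%:E)%E.
    by rewrite 2!normrM (ger0_norm (cellw_ge0 z)) EFinM.
  under eq_integral do rewrite /= FE nE.
  under [RHS]eq_integral do rewrite /= mulrAC nE.
  apply: (@integral_cell_translate _ _ (fun z => (`|b z| * K)%:E)).
    apply/measurable_EFinP; apply: measurable_funM => //.
    by apply: measurableT_comp => //; exact: l2_measurable.
  by move=> i z /=; rewrite (l2_sideP b).
transitivity (\int[mu]_z \int[mu]_x F (z, x)).
  apply: eq_Rintegral => z _; rewrite mulrC /corr /dot -RintegralZl//; last first.
    exact: l2_integrable.
  by apply: eq_Rintegral => x _; rewrite shiftE /F/=; ring.
rewrite Rfubini1// -Rfubini2//.
transitivity (\int[mu]_x (dot b l2_one * (c x * l2_one x * cellw x))).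
  apply: eq_Rintegral => x _; pose K := c x * cellw x.
  transitivity (\int[mu]_z (b (translate z (-1) (translate x 1 y)) * K * cellw z)).
    by apply: eq_Rintegral => z _; rewrite FE.
  rewrite (@Rintegral_cell_translate _ _ (fun z => b z * K)); last 2 first.
  - by apply: measurable_funM => //; exact: l2_measurable.
  - by move=> i z; rewrite (l2_sideP b).
  rewrite l2_oneE mulr1 -/K mulrC /dot -RintegralZl//; last exact: l2_integrable.
  by apply: eq_Rintegral => z _; rewrite l2_oneE /=; ring.
by rewrite RintegralZl//; exact: (l2_integrable c l2_one).
Qed.

Section phase_operators.
Variables (rho T : R).
Hypotheses (rho0 : 0 < rho) (T0 : 0 < T).
Local Notation finf := (@f_inf R d rho T).
Local Notation FS := (l2 (phase_setting d rho T)).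

Lemma velocity_weight_ge0 (v : X) : 0 <= `|rho| * maxwellian T v.
Proof. by rewrite mulr_ge0// maxwellian_ge0. Qed.

Lemma measurable_velocity_weight :
  measurable_fun setT (fun v : X => `|rho| * maxwellian T v).
Proof. by apply: measurable_funM => //; exact: measurable_maxwellian. Qed.

Definition velocity_setting : l2_setting X R :=
  @L2Setting _ _ _ mu _ (fun=> True) measurable_velocity_weight
    velocity_weight_ge0 I (fun _ _ _ _ _ => I).

Local Notation VS := (l2 velocity_setting).

Lemma velocity_weightE v : `|rho| * maxwellian T v = finf v.
Proof. by rewrite gtr0_norm. Qed.

Let finf_neq0 v : finf v != 0.
Proof. by rewrite gt_eqF// f_inf_gt0. Qed.

Let mfinf := @measurable_f_inf R d rho T.

Let mfinfV := @measurable_f_infV R d rho T.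

Lemma lift_l2 (psi : VS) (b : BS) :
  is_l2 (phase_setting d rho T) (fun z => psi z.2 * finf z.2 * b z.1).
Proof.
split.
- apply: measurable_funM; last by apply: measurableT_comp; first exact: l2_measurable.
  apply: measurable_funM; first by apply: measurableT_comp; first exact: l2_measurable.
  exact: (measurableT_comp mfinf).
- rewrite (_ : (fun _ => _) = (fun z => ((b z.1 * b z.1 * cellw z.1) *
      (psi z.2 * psi z.2 * (`|rho| * maxwellian T z.2)))%:E)).
    exact: (integrable_tensor (l2_integrable b b) (l2_integrable psi psi)).
  apply/funext => z; congr EFin; rewrite /= phasewE// velocity_weightE.
  by field.
- by move=> v i x /=; rewrite (l2_sideP b).
Qed.

(** Against the weight 1 / f_inf of phase space, the factor f_inf makes inner products of lifts
    factorize ([dot_lift]) and makes [moment psi] the adjoint of [lift psi] ([dot_moment]). *)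
Definition lift (psi : VS) (b : BS) : FS :=
  to_l2 _ (fun z => psi z.2 * finf z.2 * b z.1).

Lemma liftE psi b z : lift psi b z = psi z.2 * finf z.2 * b z.1.
Proof. by rewrite /lift to_l2E//; exact: lift_l2. Qed.

Lemma liftB psi b c : lift psi (b - c) = lift psi b - lift psi c.
Proof. by apply: l2_ext => z; rewrite !l2_funD !l2_funN !liftE mulrDr mulrN. Qed.

Definition moment_fun (psi : VS) (f : FS) (x : X) : R := \int[mu]_v (psi v * f (x, v)).

Lemma measurable_moment psi f : measurable_fun setT (moment_fun psi f).
Proof.
apply: (@measurable_Rintegral1 _ _ _ _ _ mu (fun z : X * X => psi z.2 * f z)).
apply: measurable_funM; last exact: l2_measurable.
by apply: measurableT_comp; first exact: l2_measurable.
Qed.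

(** Cauchy-Schwarz in the velocity. The + 1 makes the right-hand side +oo whenever the velocity
    integral diverges, even for psi of norm 0, so that the bound holds at every x. *)
Lemma moment_sqr_le (psi : VS) (f : FS) x :
  ((moment_fun psi f x ^+ 2)%:E <=
   (dot psi psi + 1)%:E * \int[mu]_v (f (x, v) ^+ 2 / finf v)%:E)%E.
Proof.
have mfx : measurable_fun setT (fun v => f (x, v)).
  by apply: (measurableT_comp (l2_measurable f)); exact: measurable_pair1.
have mg : measurable_fun setT (fun v => f (x, v) ^+ 2 / finf v).
  by apply: measurable_funM => //; exact: measurable_funX.
have g0 v : 0 <= f (x, v) ^+ 2 / finf v.
  by rewrite mulr_ge0 ?sqr_ge0// invr_ge0 ltW// f_inf_gt0.
have psi1 : 0 < dot psi psi + 1 by have := dot_ge0 psi; lra.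
have [ig|nig] := pselect (mu.-integrable setT (fun v => (f (x, v) ^+ 2 / finf v)%:E));
    last first.
  rewrite (_ : integral _ _ _ = +oo%E) ?gt0_muley ?lte_fin ?leey//.
  apply/eqP; rewrite -leye_eq leNgt; apply/negP => goo; apply: nig.
  apply/integrableP; split; first exact/measurable_EFinP.
  apply: le_lt_trans goo; rewrite le_eqVlt; apply/orP; left; apply/eqP.
  by apply: eq_integral => v _; rewrite /= ger0_norm.
have l2h : is_l2 velocity_setting (fun v => f (x, v) / finf v).
  split => //; first exact: measurable_funM.
  move: ig; rewrite [X in mu.-integrable _ X -> _](_ : _ =
    (fun v => ((f (x, v) / finf v) ^+ 2 * (`|rho| * maxwellian T v))%:E))//.
  by apply/funext => v; congr EFin; rewrite velocity_weightE; field.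
pose h : VS := to_l2 _ (fun v => f (x, v) / finf v).
have hE v : h v = f (x, v) / finf v by rewrite /h to_l2E.
have -> : moment_fun psi f x = dot psi h.
  apply: eq_Rintegral => v _; rewrite hE /= velocity_weightE; field; exact: finf_neq0.
have -> : (\int[mu]_v (f (x, v) ^+ 2 / finf v)%:E)%E = (dot h h)%:E.
  rewrite dot_integralE; apply: eq_integral => v _; congr EFin.
  by rewrite hE /= velocity_weightE; field; exact: finf_neq0.
rewrite -EFinM lee_fin -(@real_normK _ (dot psi h)) ?num_real//.
apply: (@le_trans _ _ (dot psi psi * dot h h)); last first.
  by rewrite ler_wpM2r ?dot_ge0// lerDl.
rewrite -!l2norm_sqr -exprMn ler_pXn2r ?nnegrE ?mulr_ge0 ?l2norm_ge0//.
exact: dot_le.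
Qed.

Lemma moment_l2 psi f : is_l2 (torus_setting R d) (moment_fun psi f).
Proof.
split.
- exact: measurable_moment.
- apply/integrableP; split.
    apply/measurable_EFinP; apply: measurable_funM; last exact: measurable_cellw.
    by apply: measurable_funX; exact: measurable_moment.
  have psi1 : 0 <= dot psi psi + 1 by have := dot_ge0 psi; lra.
  have := l2_integrable f f => /integrableP[mff].
  rewrite fubini_tonelli1//; last exact: measurableT_comp.
  move=> foo.
  apply: (@le_lt_trans _ _ ((dot psi psi + 1)%:E * \int[mu]_x
     fubini_F mu (fun z => `|(f z * f z * phasew rho T z)%:E|) x)%E); last first.
    by rewrite lte_mul_pinfty// ?lee_fin//.
  have mF : measurable_fun setT (fubini_F mu (fun z =>
      `|(f z * f z * phasew rho T z)%:E|)%E).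
    apply: measurable_fun_fubini_tonelli_F => //.
    exact: measurableT_comp.
  rewrite -ge0_integralZl//; last first.
    by move=> x _; exact: integral_ge0.
  apply: ge0_le_integral => //.
  + apply: measurableT_comp => //; apply/measurable_EFinP.
    apply: measurable_funM; last exact: measurable_cellw.
    by apply: measurable_funX; exact: measurable_moment.
  + exact: measurable_funeM.
  move=> x _; rewrite /= (ger0_norm (mulr_ge0 (sqr_ge0 _) (cellw_ge0 x))).
  rewrite EFinM.
  apply: (@le_trans _ _ ((dot psi psi + 1)%:E *
     \int[mu]_v (f (x, v) ^+ 2 / finf v)%:E * (cellw x)%:E)%E).
    by rewrite lee_wpmul2r ?lee_fin ?cellw_ge0// moment_sqr_le.
  rewrite -muleA lee_wpmul2l// ?lee_fin//.
  rewrite muleC -ge0_integralZl//; last 3 first.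
  + apply/measurable_EFinP; apply: measurable_funM => //; apply: measurable_funX.
    by apply: (measurableT_comp (l2_measurable f)); exact: measurable_pair1.
  + by move=> v _; rewrite lee_fin mulr_ge0 ?sqr_ge0// invr_ge0 ltW// f_inf_gt0.
  + by rewrite lee_fin cellw_ge0.
  rewrite le_eqVlt; apply/orP; left; apply/eqP; apply: eq_integral => v _.
  rewrite /= -EFinM phasewE// ger0_norm; last first.
    by rewrite mulr_ge0 -?expr2 ?sqr_ge0// mulr_ge0 ?cellw_ge0// invr_ge0 ltW// f_inf_gt0.
  by congr EFin; rewrite /=; ring.
- move=> i x; apply: eq_Rintegral => v _; congr (_ * _).
  exact: (l2_sideP f v i x).
Qed.

Definition moment psi f : BS := to_l2 _ (moment_fun psi f).

Lemma momentE psi f x : moment psi f x = \int[mu]_v (psi v * f (x, v)).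
Proof. by rewrite /moment to_l2E//; exact: moment_l2. Qed.

Lemma dot_moment psi f b : dot (moment psi f) b = dot f (lift psi b).
Proof.
rewrite /dot -(Rfubini1 (l2_integrable f (lift psi b))).
apply: eq_Rintegral => x _; rewrite momentE -mulrA mulrC.
rewrite -RintegralZl_measurable; last first.
  apply: measurable_funM; first exact: l2_measurable.
  by apply: (measurableT_comp (l2_measurable f)); exact: measurable_pair1.
apply: eq_Rintegral => v _; rewrite liftE /= phasewE//=; field; exact: finf_neq0.
Qed.

Lemma dot_lift_transport t (chi psi : VS) (b c : BS) :
  dot (transport t (lift chi b)) (lift psi c) =
  \int[mu]_v (chi v * psi v * finf v * corr b c (scale t v)).
Proof.
rewrite {1}/dot -(Rfubini2 (l2_integrable (transport t (lift chi b)) (lift psi c))).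
apply: eq_Rintegral => v _; rewrite /corr /dot -RintegralZl//; last exact: l2_integrable.
apply: eq_Rintegral => x _; rewrite transportE !liftE/= phasewE//=.
rewrite shiftE (_ : translate x 1 (scale t v) = translate x t v).
  by field; exact: finf_neq0.
by apply: eq_from_tnth => i; rewrite !tnth_mktuple mul1r.
Qed.

Lemma dot_lift (chi psi : VS) (b c : BS) :
  dot (lift chi b) (lift psi c) = dot chi psi * dot b c.
Proof.
rewrite -[lift chi b]transport0 dot_lift_transport.
transitivity (\int[mu]_v (dot b c * (chi v * psi v * finf v))).
  apply: eq_Rintegral => v _; rewrite mulrC; congr (dot _ _ * _).
  apply: l2_ext => x; rewrite shiftE; congr (b _).
  by apply: eq_from_tnth => i; rewrite !tnth_mktuple mul0r mulr0 subr0.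
rewrite RintegralZl_measurable; last first.
  apply: measurable_funM => //.
  by apply: measurable_funM; exact: l2_measurable.
by rewrite mulrC; congr (_ * _); apply: eq_Rintegral => v _; rewrite /= velocity_weightE.
Qed.

End phase_operators.

End torus_operators.

(** * Equidistribution of correlations *)

Section equidistribution.
Context (R : realType) (d : nat).
Local Notation X := (space R d).
Local Notation mu := (lebesgue R d).
Local Notation cell := (@unit_cell R d).
Local Notation BS := (l2 (torus_setting R d)).
Local Notation nrm := (seminorm (@dot _ _ _ _)).

Lemma integral_reflect_translate (y : X) (f : X -> \bar R) : measurable_fun setT f ->
  (\int[mu]_x f (translate y 1 x) = \int[mu]_x f x)%E.
Proof.
move=> mf; rewrite -(integral_reflect_space y mf); apply: eq_integral => x _.
by congr f; apply: eq_from_tnth => i; rewrite !tnth_mktuple mul1r.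
Qed.

Lemma integral_translate t (v : X) (f : X -> \bar R) : measurable_fun setT f ->
  (\int[mu]_x f (translate x t v) = \int[mu]_x f x)%E.
Proof.
move=> mf; pose z : X := [tuple 0 | i < d].
have mg : measurable_fun setT (fun x => f (translate z 1 x)).
  apply: (measurableT_comp mf).
  by apply: (measurable_translate (x := cst z) (t := cst 1) (v := id)).
rewrite -[RHS](integral_reflect_translate z mf).
rewrite -[RHS](integral_reflect_translate (scale t v) mg).
apply: eq_integral => x _; congr f.
by apply: eq_from_tnth => i; rewrite !tnth_mktuple; ring.
Qed.

Lemma Rintegral_translate t (v : X) (f : X -> R) : measurable_fun setT f ->
  \int[mu]_x f (translate x t v) = \int[mu]_x f x.
Proof.
move=> mf; congr fine.
by apply: (@integral_translate _ _ (EFin \o f)); exact/measurable_EFinP.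
Qed.

Lemma Rintegral_reflect_translate (y : X) (f : X -> R) : measurable_fun setT f ->
  \int[mu]_x f (translate y 1 x) = \int[mu]_x f x.
Proof.
move=> mf; congr fine.
by apply: (@integral_reflect_translate _ (EFin \o f)); exact/measurable_EFinP.
Qed.

Lemma Rintegral_cell1 : \int[mu]_x cellw x = 1 :> R.
Proof.
rewrite -(dot_one R d); apply: eq_Rintegral => x _.
by rewrite !l2_oneE !mul1r.
Qed.

(** Coordinatewise (a + y)^2 >= a^2 / 2 - y^2 with |y| <= 1. Hence a shift by a vector of the cell
    costs a Gaussian bound a constant factor and half of its rate. *)
Lemma sqnorm_translate_ge (v z : X) t : 0 <= t <= 1 -> cell z ->
  sqnorm v / 2 - d%:R <= sqnorm (translate v (- t) z).
Proof.
move=> /andP[t0 t1] cz; rewrite /sqnorm mulr_suml.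
rewrite -[X in _ - X%:R]card_ord -sumr_const -sumrB.
apply: ler_sum => i _; rewrite tnth_mktuple.
have /andP[z0 z1] := cz i; set a := tnth v i; set c := tnth z i.
have tc : 0 <= t * c <= 1 by rewrite mulr_ge0//= mulr_ile1.
have : (t * c) ^+ 2 <= 1 by rewrite expr_le1//; lra.
have := sqr_ge0 (a + 2 * (t * c)); lra.
Qed.

Variable k : X -> R.
Hypothesis mk : measurable_fun setT k.
Variables (A c : R).
Hypotheses (A_ge0 : 0 <= A) (c_gt0 : 0 < c).
Hypothesis k_le : forall v, `|k v| <= A * expR (- (c * sqnorm v)).
Hypothesis k_cvg : forall v z,
  k (translate v (- (n.+1%:R)^-1) z) @[n --> \oo] --> k v.

(** The exponential compensates the term - d in [sqnorm_translate_ge]. *)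
Let B := A * expR (c * d%:R).
Let dom (v : X) : R := B * expR (- (c / 2 * sqnorm v)).

Let integrable_dom : mu.-integrable setT (EFin \o dom).
Proof.
have c20 : 0 < c / 2 by rewrite divr_gt0.
exact: (integrableZl measurableT B (integrable_gauss d c20)).
Qed.

Let k_shift_le v z t : 0 <= t <= 1 -> cell z -> `|k (translate v (- t) z)| <= dom v.
Proof.
move=> t01 cz; apply: (le_trans (k_le _)).
rewrite /dom /B -mulrA -expRD ler_wpM2l// ler_expR.
have := sqnorm_translate_ge v t01 cz; set q := sqnorm (translate _ _ _).
have cc : 0 < c by exact: c_gt0.
move=> /(ler_wpM2l (ltW cc)); lra.
Qed.

Let k_dom v : `|k v| <= dom v.
Proof.
have z0 : cell [tuple 0 | i < d] by move=> i; rewrite tnth_mktuple lexx ler01.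
have := @k_shift_le v _ 0 _ z0; rewrite lexx ler01 => /(_ isT).
congr (`|k _| <= _); apply: eq_from_tnth => i.
by rewrite !tnth_mktuple mulr0 subr0.
Qed.

(* Integrating in the velocity over a shift by z / (n + 1), z in the unit cell,
   replaces [C ((n + 1) v)] by [C ((n + 1) v + z)], whose mean over z is the mean
   of the periodic function C; the error is the integral of [jump]. *)
Let jump n (p : X * X) : R :=
  cellw p.1 * `|k p.2 - k (translate p.2 (- (n.+1%:R)^-1) p.1)|.

Let mshift n : measurable_fun setT (fun p : X * X => k (translate p.2 (- (n.+1%:R)^-1) p.1)).
Proof.
apply: (measurableT_comp mk).
by apply: (measurable_translate (x := snd) (t := cst (- (n.+1%:R)^-1)) (v := fst)).
Qed.

Let mcell1 : measurable_fun setT (fun p : X * X => cellw p.1).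
Proof. by apply: measurableT_comp => //; exact: measurable_cellw. Qed.

Let mk2 : measurable_fun setT (fun p : X * X => k p.2).
Proof. exact: measurableT_comp. Qed.

Let mjump n : measurable_fun setT (jump n).
Proof.
apply: measurable_funM => //; apply: measurableT_comp => //.
by apply: measurable_funB => //; exact: mshift.
Qed.

Let n01 (n : nat) : (0 : R) <= (n.+1%:R)^-1 <= (1 : R).
Proof. by apply/andP; split; [rewrite invr_ge0 ler0n|rewrite invf_le1 ?ltr0n ?ler1n]. Qed.

Let jump_le n p : `|jump n p| <= cellw p.1 * (2 * dom p.2).
Proof.
rewrite /jump normrM (ger0_norm (cellw_ge0 _)) normr_id /cellw indicE.
case: (boolP (p.1 \in cell)) => [|_]; last by rewrite !mul0r.
rewrite inE => cz; rewrite !mul1r (le_trans (ler_normB _ _))//.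
have := k_dom p.2; have := k_shift_le p.2 (n01 n) cz; lra.
Qed.

Let integrable_jdom : (mu \x mu)%E.-integrable setT
  (fun p : X * X => (cellw p.1 * (2 * dom p.2))%:E).
Proof.
apply: (integrable_tensor (f := @cellw R d) (g := fun v => 2 * dom v)).
  exact: integrable_cellw.
exact: (integrableZl measurableT 2 integrable_dom).
Qed.

Let integrable_jump n : (mu \x mu)%E.-integrable setT (EFin \o jump n).
Proof.
apply: (le_integrable _ _ _ integrable_jdom) => //.
  by apply/measurable_EFinP; exact: mjump.
move=> p _ /=; rewrite lee_fin (le_trans (jump_le n p))// ler_norm//.
Qed.

Let jump_cvg0 : (\int[(mu \x mu)%E]_p (jump n p)%:E)%E @[n --> \oo] --> 0%E.
Proof.
have f_f : {ae (mu \x mu)%E, forall p, setT p ->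
    (jump n p)%:E @[n --> \oo] --> (cst 0%E : X * X -> \bar R) p}.
  apply: aeW => p _; apply: cvg_EFin; first by near=> n.
  rewrite -(mulr0 (cellw p.1)); apply: cvgMr.
  rewrite -(@normr0 _ R) -(subrr (k p.2)).
  apply: cvg_norm; apply: cvgB; first exact: cvg_cst.
  exact: k_cvg.
have f_g : {ae (mu \x mu)%E, forall p n, setT p ->
    (`|(jump n p)%:E| <= (cellw p.1 * (2 * dom p.2))%:E)%E}.
  by apply: aeW => p n _; rewrite lee_fin jump_le.
have [_ _] := dominated_convergence measurableT
  (fun n => (measurable_EFinP _ _).2 (mjump n)) (measurable_cst _) f_f integrable_jdom f_g.
by rewrite integral0.
Unshelve. all: by end_near.
Qed.

Let I := \int[mu]_v k v.

Lemma corr_jump_le (b e : BS) n :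
  `|\int[mu]_v (k v * corr b e (scale n.+1%:R v)) - I * (dot b (l2_one R d) * dot e (l2_one R d))|
  <= nrm b * nrm e * \int[(mu \x mu)%E]_p jump n p.
Proof.
set C := corr b e; set m := dot b _ * _.
have K0 : 0 <= nrm b * nrm e by rewrite mulr_ge0 ?l2norm_ge0.
have mC : measurable_fun setT C by exact: measurable_corr.
have CK y : `|C y| <= nrm b * nrm e by exact: corr_le.
move: (nrm b * nrm e) K0 CK => K K0 CK.
pose N : R := n.+1%:R.
have N0 : N != 0 by rewrite pnatr_eq0.
have mscale : measurable_fun setT (fun v : X => scale N v).
  apply: measurable_fun_space => i; under eq_fun do rewrite tnth_mktuple.
  by apply: measurable_funM => //; exact: measurable_tnth.
have mCN : measurable_fun setT (fun p : X * X => C (scale N p.2)).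
  by apply: (measurableT_comp mC); apply: (measurableT_comp mscale).
(* [F1] integrates to the velocity average and [F3], by [mean_corr], to its limit. The substitution
   of v + z / N for v at fixed z turns [F3] into [F2], and [F1 - F2] is bounded pointwise by the
   jump of k. *)
pose F1 (p : X * X) : R := cellw p.1 * (k p.2 * C (scale N p.2)).
pose F2 (p : X * X) : R := cellw p.1 * (k (translate p.2 (- N^-1) p.1) * C (scale N p.2)).
pose F3 (p : X * X) : R := cellw p.1 * (k p.2 * C (translate (scale N p.2) 1 p.1)).
have idomK : (mu \x mu)%E.-integrable setT (fun p : X * X => (cellw p.1 * (K * dom p.2))%:E).
  apply: (integrable_tensor (f := @cellw R d) (g := fun v => K * dom v)).
    exact: integrable_cellw.
  exact: (integrableZl measurableT K integrable_dom).
have kC_le v y : `|k v| <= dom v -> `|k v * C y| <= K * dom v.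
  by move=> kv; rewrite normrM mulrC ler_pM.
have iF1 : (mu \x mu)%E.-integrable setT (EFin \o F1).
  apply: (le_integrable _ _ _ idomK) => //.
    by apply/measurable_EFinP; apply: measurable_funM => //; exact: measurable_funM.
  move=> p _ /=; rewrite lee_fin !(normrM (cellw _)) ler_wpM2l//.
  by rewrite (le_trans (kC_le _ _ (k_dom _)))// ler_norm.
have iF3 : (mu \x mu)%E.-integrable setT (EFin \o F3).
  apply: (le_integrable _ _ _ idomK) => //.
    apply/measurable_EFinP; apply: measurable_funM => //; apply: measurable_funM => //.
    apply: (measurableT_comp mC).
    apply: (measurable_translate (x := fun p : X * X => scale N p.2) (t := cst 1) (v := fst)) => //.
    by apply: (measurableT_comp mscale).
  move=> p _ /=; rewrite lee_fin !(normrM (cellw _)) ler_wpM2l//.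
  by rewrite (le_trans (kC_le _ _ (k_dom _)))// ler_norm.
have iF2 : (mu \x mu)%E.-integrable setT (EFin \o F2).
  apply: (le_integrable _ _ _ idomK) => //.
    apply/measurable_EFinP; apply: measurable_funM => //; apply: measurable_funM => //.
    exact: mshift.
  move=> p _ /=; rewrite lee_fin !(normrM (cellw _)) (ger0_norm (cellw_ge0 _)).
  rewrite /cellw indicE; case: (boolP (p.1 \in cell)) => [|_]; last by rewrite !mul0r.
  rewrite inE => cz; rewrite !mul1r normrM (le_trans _ (ler_norm _))// mulrC.
  by rewrite ler_pM// k_shift_le// n01.
have E1 : \int[mu]_v (k v * C (scale N v)) = \int[(mu \x mu)%E]_p F1 p.
  rewrite -(Rfubini1 iF1).
  transitivity (\int[mu]_z ((\int[mu]_v (k v * C (scale N v))) * @cellw R d z)).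
    by rewrite RintegralZl ?Rintegral_cell1 ?mulr1//; exact: integrable_cellw.
  apply: eq_Rintegral => z _; rewrite mulrC -RintegralZl_measurable//.
  by apply: measurable_funM => //; exact: (measurableT_comp mC).
have E3 : I * m = \int[(mu \x mu)%E]_p F3 p.
  rewrite -(Rfubini2 iF3) mulrC -RintegralZl_measurable//; apply: eq_Rintegral => v _.
  rewrite /m -(mean_corr b e (scale N v)) -Rintegral_cellw mulrC -RintegralZl_measurable.
    by apply: eq_Rintegral => z _; rewrite /F3/= /C; ring.
  apply: measurable_funM; last exact: measurable_cellw.
  apply: (measurableT_comp mC).
  by apply: (measurable_translate (x := cst (scale N v)) (t := cst 1) (v := id)).
have E2 : \int[(mu \x mu)%E]_p F3 p = \int[(mu \x mu)%E]_p F2 p.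
  rewrite -(Rfubini1 iF3) -(Rfubini1 iF2); apply: eq_Rintegral => z _.
  have mG : measurable_fun setT (fun v => F3 (z, v)).
    rewrite /F3 /=; apply: measurable_funM => //; apply: measurable_funM => //.
    apply: (measurableT_comp mC).
    by apply: (measurable_translate (x := fun v => scale N v) (t := cst 1) (v := cst z)).
  rewrite -(Rintegral_translate (- N^-1) z mG); apply: eq_Rintegral => v _.
  rewrite /F2 /F3/=; congr (_ * (_ * C _)).
  by apply: eq_from_tnth => i; rewrite !tnth_mktuple; field.
rewrite -/N E1 E3 E2 -(RintegralB measurableT iF1 iF2).
apply: (le_trans (le_normr_Rintegral measurableT (integrableB measurableT iF1 iF2))).
apply: (@le_trans _ _ (\int[(mu \x mu)%E]_p (K * jump n p))); last first.
  by rewrite (RintegralZl K measurableT (integrable_jump n)).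
apply: (le_Rintegral measurableT).
- exact: (integrable_norm (integrableB measurableT iF1 iF2)).
- exact: (integrableZl measurableT K (integrable_jump n)).
- move=> p _; rewrite /jump; set x := k p.2 - _; set y := C (scale N p.2).
  rewrite (_ : F1 p - F2 p = cellw p.1 * (x * y)); last by rewrite /F1 /F2 -mulrBr -mulrBl.
  rewrite normrM (ger0_norm (cellw_ge0 _)) normrM [leRHS]mulrCA.
  apply: ler_wpM2l; first exact: cellw_ge0.
  by rewrite [leLHS]mulrC; apply: ler_wpM2r; [exact: normr_ge0|exact: CK].
Qed.

(** The threshold is uniform in b and e: they enter [corr_jump_le] through their norms only, while
    the jump depends on k alone. *)
Lemma corr_equidistribution (eps : R) : 0 < eps ->
  exists N : nat, forall n, (N <= n)%N -> forall b e : BS,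
  `|\int[mu]_v (k v * corr b e (scale n.+1%:R v)) -
    I * (dot b (l2_one R d) * dot e (l2_one R d))| <= eps * (nrm b * nrm e).
Proof.
move=> eps0.
have : (fun n => \int[(mu \x mu)%E]_p jump n p) @ \oo --> (0 : R).
  by have /fine_cvg := jump_cvg0.
move=> /cvgrPdist_le/(_ eps eps0)[N _ jN]; exists N => n Nn b e.
have := jN n Nn; rewrite /= sub0r normrN ger0_norm => [jn|]; last first.
  by apply: Rintegral_ge0 => p _; rewrite mulr_ge0 ?cellw_ge0.
apply: (le_trans (corr_jump_le b e n)).
by rewrite mulrC ler_wpM2r// mulr_ge0 ?l2norm_ge0.
Qed.

End equidistribution.

(** * Velocity profiles of local equilibria *)

Section radial_weights.
Context (R : realType) (d : nat) (rho T : R).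
Hypotheses (rho0 : 0 < rho) (T0 : 0 < T).
Local Notation X := (space R d).
Local Notation mu := (lebesgue R d).
Local Notation BS := (l2 (torus_setting R d)).
Local Notation VS := (l2 (velocity_setting d rho T)).
Local Notation nrm := (seminorm (@dot _ _ _ _)).
Local Notation finf := (@f_inf R d rho T).

Lemma sqnorm_translate (v z : X) (t : R) :
  sqnorm (translate v (- t) z) =
  sqnorm v + t * (2 * \sum_(i < d) tnth v i * tnth z i) + t * t * sqnorm z.
Proof.
rewrite /sqnorm !mulr_sumr -!big_split/=; apply: eq_bigr => i _.
by rewrite tnth_mktuple; ring.
Qed.

Lemma radial_cvg (p : R -> R) (v z : X) : continuous p ->
  p (sqnorm (translate v (- (n.+1%:R)^-1) z)) *
    maxwellian T (translate v (- (n.+1%:R)^-1) z) @[n --> \oo]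
  --> p (sqnorm v) * maxwellian T v.
Proof.
move=> cp.
have h0 : (fun n : nat => (n.+1%:R)^-1 : R) @ \oo --> (0 : R) by exact: cvg_harmonic.
have cs : sqnorm (translate v (- (n.+1%:R)^-1) z) @[n --> \oo] --> sqnorm v.
  under eq_fun do rewrite sqnorm_translate.
  have cst x : (fun=> x : R) @ \oo --> x by exact: cvg_cst.
  have := cvgD (cvgD (cst (sqnorm v))
    (cvgM h0 (cst (2 * \sum_(i < d) tnth v i * tnth z i))))
    (cvgM (cvgM h0 h0) (cst (sqnorm z))).
  by rewrite !mul0r !addr0; exact.
apply: cvgM; first by apply: (cvg_comp _ _ cs); exact: cp.
apply: cvgM; first exact: cvg_cst.
apply: (@cvg_comp _ _ _ (fun n => - (sqnorm (translate v (- (n.+1%:R)^-1) z) / T)) expR).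
  by apply: cvgN; apply: cvgM; [exact: cs|exact: cvg_cst].
exact: continuous_expR.
Qed.

(** As a function of s = |v|^2. The product of the profiles [phi i] and [phi j] with f_inf is
    [phi_poly (i + j)] times the Maxwellian, so exponents up to 2 occur. *)
Definition phi_poly (j : nat) (s : R) : R := rho * (s / T - d%:R / 2) ^+ j.

Lemma continuous_phi_poly j : continuous (phi_poly j).
Proof.
move=> s; apply: cvgM; first exact: cvg_cst.
apply: (cvg_comp (fun s => s / T - d%:R / 2) (fun x => x ^+ j)).
  by apply: (@cvgB _ R^o); [apply: cvgM; [exact: cvg_id|exact: cvg_cst]|exact: cvg_cst].
exact: exprn_continuous.
Qed.

Lemma phi_poly_le j s : (j <= 2)%N -> 0 <= s ->
  `|phi_poly j s| <= rho * (1 + d%:R) ^+ 2 * (1 + s / T) ^+ 2.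
Proof.
move=> j2 s0; rewrite /phi_poly normrM (gtr0_norm rho0) -mulrA ler_pM2l//.
have sT : 0 <= s / T by rewrite divr_ge0// ltW.
have d0 : 0 <= d%:R :> R by [].
rewrite -exprMn normrX.
set x := `|s / T - d%:R / 2|; set y := (1 + d%:R) * (1 + s / T).
have xy : x <= y.
  rewrite /x /y (le_trans (ler_normB _ _))// (ger0_norm sT) ger0_norm ?divr_ge0//.
  have := mulr_ge0 d0 sT; lra.
have y1 : 1 <= y by rewrite /y mulr_ege1//; lra.
have x0 : x \is Num.nneg by rewrite nnegrE; exact: normr_ge0.
have y0 : y \is Num.nneg by rewrite nnegrE; lra.
have xyj : x ^+ j <= y ^+ j by apply: lerXn2r.
apply: (le_trans xyj).
by rewrite ler_weXn2l.
Qed.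

Lemma phi_weightE j v :
  phi_poly j (sqnorm v) * maxwellian T v = (sqnorm v / T - d%:R / 2) ^+ j * finf v.
Proof. by rewrite /phi_poly /f_inf; ring. Qed.

Lemma measurable_phi_poly j : measurable_fun setT (phi_poly j).
Proof. by apply: continuous_measurable_fun; exact: continuous_phi_poly. Qed.

Lemma gauss_bounded_phi j : (j <= 2)%N ->
  gauss_bounded (fun v : X => phi_poly j (sqnorm v) * maxwellian T v).
Proof.
move=> j2; apply: (@gauss_bounded_radial _ d T (rho * (1 + d%:R) ^+ 2)) => //.
- by rewrite mulr_ge0 ?sqr_ge0// ltW.
- exact: measurable_phi_poly.
- by move=> s s0; exact: phi_poly_le.
Qed.

Definition phi_fun (j : nat) (v : X) : R := (sqnorm v / T - d%:R / 2) ^+ j.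

Lemma measurable_phi_fun j : measurable_fun setT (phi_fun j).
Proof.
apply: measurable_funX; apply: measurable_funB => //.
by apply: measurable_funM => //; exact: measurable_sqnorm.
Qed.

Lemma phi_l2 j : (j <= 1)%N -> is_l2 (velocity_setting d rho T) (phi_fun j).
Proof.
move=> j1; split => //; first exact: measurable_phi_fun.
have j2 : (j * 2 <= 2)%N by case: j j1 => [|[|]].
have := integrable_gauss_bounded (gauss_bounded_phi j2).
rewrite (_ : _ \o _ = (fun v => (phi_fun j v ^+ 2 * (`|rho| * maxwellian T v))%:E))//.
apply/funext => v /=; congr EFin.
by rewrite phi_weightE velocity_weightE// exprM.
Qed.

(** [phi 0] and [phi 1] are the density and temperature directions of local equilibria. Subtracting
    d / 2, the mean of |v|^2 / T, makes them orthogonal ([dot_phi01]). *)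
Definition phi j : VS := to_l2 _ (phi_fun j).

Lemma phiE j v : (j <= 1)%N -> phi j v = (sqnorm v / T - d%:R / 2) ^+ j.
Proof. by move=> j1; rewrite /phi to_l2E//; exact: phi_l2. Qed.

Lemma dot_phi i j : (i <= 1)%N -> (j <= 1)%N -> dot (phi i) (phi j) =
  \int[mu]_v (phi_poly (i + j) (sqnorm v) * maxwellian T v).
Proof.
move=> i1 j1; apply: eq_Rintegral => v _.
by rewrite !phiE// /= velocity_weightE// -exprD phi_weightE.
Qed.

Lemma dot_phi00 : dot (phi 0) (phi 0) = rho.
Proof.
rewrite dot_phi//; under eq_Rintegral do rewrite /phi_poly expr0 mulr1.
by rewrite RintegralZl ?Rintegral_maxwellian ?mulr1//; exact: integrable_maxwellian.
Qed.

Lemma dot_phi01 : dot (phi 0) (phi 1) = 0.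
Proof.
rewrite dot_phi//.
have i1 := integrable_maxwellian d T0.
have i2 : mu.-integrable setT (EFin \o (fun v : X => sqnorm v / T * maxwellian T v)).
  apply: integrable_gauss_bounded.
  apply: (@gauss_bounded_radial _ d T 1 (fun s => s / T)) => //.
    exact: measurable_funM.
  move=> s s0; have sT : 0 <= s / T by rewrite divr_ge0// ltW.
  by rewrite ger0_norm// mul1r; have := sqr_ge0 (s / T); lra.
transitivity (\int[mu]_v (rho * (sqnorm v / T * maxwellian T v)
    - rho * (d%:R / 2 * maxwellian T v))).
  by apply: eq_Rintegral => v _; rewrite /phi_poly; ring.
rewrite RintegralB//; last 2 first.
- exact: (integrableZl measurableT rho i2).
- exact: (integrableZl measurableT rho (integrableZl measurableT (d%:R / 2) i1)).
rewrite (RintegralZl rho measurableT i2) second_moment//.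
rewrite (RintegralZl rho measurableT (integrableZl measurableT (d%:R / 2) i1)).
by rewrite (RintegralZl _ measurableT i1) Rintegral_maxwellian// mulr1 subrr.
Qed.

(** A box near the origin, of positive measure, on which |v|^2 / T stays away from d / 2 already
    bounds the integral from below. *)
Lemma dot_phi11_gt0 : (0 < d)%N -> 0 < dot (phi 1) (phi 1).
Proof.
move=> d0; rewrite dot_phi//.
(* On the box |v|^2 / T <= d / 4, so the squared profile is at least (d / 4)^2 >= 1 / 16 and the
   Gaussian factor at least exp (- d / 4). *)
pose e := Num.sqrt T / 2.
have e0 : 0 < e by rewrite divr_gt0// sqrtr_gt0.
pose box : set X := [set v | forall i, `[0%R, e]%classic (tnth v i)].
have mbox : measurable box.
  rewrite (_ : box = \bigcap_(i in [set: 'I_d])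
      ((fun x : X => tnth x i) @^-1` `[0%R, e]%classic)).
    apply: fin_bigcap_measurable => // i _; rewrite -[Y in measurable Y]setTI.
    exact: measurable_tnth.
  by apply/seteqP; split => [x Ax i _|x Ax i] /=; [exact: Ax|exact: (Ax i I)].
have mubox : mu box = (\prod_(i < d) e%:E)%E.
  rewrite (lebesgue_box (A := fun=> `[0%R, e]%classic)) => [|i]; last exact: measurable_itv.
  by apply: eq_bigr => i _; rewrite lebesgue_measure_itv/= lte_fin e0 sube0.
have muboxE : mu box = (e ^+ d)%:E.
  by rewrite mubox prodEFin prodr_const card_ord.
pose c : R := rho * 16^-1 * ((pi * T) `^ (- (d%:R / 2)) * expR (- (d%:R / 4))).
have c0 : 0 < c by rewrite !mulr_gt0 ?expR_gt0 ?powR_gt0 ?mulr_gt0 ?pi_gt0.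
apply: (@lt_le_trans _ _ (c * e ^+ d)); first by rewrite mulr_gt0// exprn_gt0.
have ibox : mu.-integrable setT (EFin \o (\1_box : X -> R)).
  apply/integrableP; split; first by apply/measurable_EFinP; exact: measurable_indic.
  under eq_integral do rewrite /= ger0_norm//.
  by rewrite integral_indic// setIT [Y in (Y < _)%E]muboxE ltry.
have -> : c * e ^+ d = \int[mu]_v (c * \1_box v).
  rewrite RintegralZl// /Rintegral integral_indic// setIT.
  by rewrite [Y in fine Y]muboxE.
apply: le_Rintegral => //.
- exact: (integrableZl measurableT c ibox).
- exact: (integrable_gauss_bounded (gauss_bounded_phi (leqnn 2))).
move=> v _; rewrite indicE; case: (boolP (v \in box)) => [|_]; last first.
  by rewrite mulr0 mulr_ge0 ?maxwellian_ge0// /phi_poly mulr_ge0 ?sqr_ge0// ltW.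
rewrite inE mulr1 => bv.
have sv : sqnorm v / T <= d%:R / 4.
  rewrite ler_pdivrMr// /sqnorm (_ : d%:R / 4 * T = \sum_(i < d) (T / 4)); last first.
    by rewrite sumr_const card_ord -[RHS]mulr_natl; field.
  apply: ler_sum => i _; have := bv i; rewrite /= in_itv/= => /andP[v0 ve].
  rewrite (_ : T / 4 = e ^+ 2); last by rewrite /e expr_div_n sqr_sqrtr ?ltW//; field.
  by rewrite ler_pXn2r// nnegrE// ltW.
have s0 : 0 <= sqnorm v / T by rewrite divr_ge0 ?sqnorm_ge0// ltW.
have d1 : 1 <= d%:R :> R by rewrite ler1n.
rewrite /c /phi_poly -[leLHS]mulrA -[leRHS]mulrA ler_pM2l//; apply: ler_pM.
- by [].
- by rewrite mulr_ge0 ?powR_ge0 ?expR_ge0.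
- set x := sqnorm v / T in s0 sv *; set D := d%:R : R in d1 sv *.
  have DD : 1 <= D * D by rewrite mulr_ege1.
  have h1 : 0 <= (D / 4 - x) * D by rewrite mulr_ge0//; lra.
  have h2 : 0 <= (D / 4 - x) * (D / 4 - x) by rewrite mulr_ge0//; lra.
  have : 16^-1 <= (x - D / 2) ^+ 2 by rewrite expr2; lra.
  exact.
- by rewrite /maxwellian ler_wpM2l ?powR_ge0// ler_expR; lra.
Qed.

Lemma transport_equidistribution (eps : R) : 0 < eps ->
  exists2 N : R, 0 <= N & forall i j, (i <= 1)%N -> (j <= 1)%N -> forall b c : BS,
  `|dot (transport N (lift (phi i) b)) (lift (phi j) c)
    - dot (phi i) (phi j) * (dot b (l2_one R d) * dot c (l2_one R d))|
  <= eps * (nrm b * nrm c).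
Proof.
move=> eps0.
have H m : (m <= 2)%N -> exists N : nat, forall n, (N <= n)%N -> forall b c : BS,
    `|\int[mu]_v (phi_poly m (sqnorm v) * maxwellian T v * corr b c (scale n.+1%:R v)) -
      \int[mu]_v (phi_poly m (sqnorm v) * maxwellian T v) *
      (dot b (l2_one R d) * dot c (l2_one R d))| <= eps * (nrm b * nrm c).
  move=> m2; have [mk [A [c [A0 c0 kA]]]] := gauss_bounded_phi m2.
  apply: (corr_equidistribution mk A0 c0 kA _ eps0) => v z.
  by apply: radial_cvg; exact: continuous_phi_poly.
have [N0 H0] := H 0%N isT; have [N1 H1] := H 1%N isT; have [N2 H2] := H 2%N isT.
(* One time has to serve all pairs (i, j); only the kernels with i + j = 0, 1, 2 occur. *)
pose n := (N0 + N1 + N2)%N; exists n.+1%:R => // i j i1 j1 b c.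
rewrite dot_lift_transport// dot_phi//.
under eq_Rintegral do rewrite !phiE// -exprD -phi_weightE.
have : (i + j <= 2)%N by rewrite (leq_add i1 j1).
case: (i + j)%N => [|[|[|//]]] _.
- by apply: H0; rewrite /n -addnA leq_addr.
- by apply: H1; rewrite /n addnAC leq_addl.
- by apply: H2; rewrite /n leq_addl.
Qed.

End radial_weights.

(** * The heat semigroup *)

Section heat_semigroup.
Context (R : realType) (d : nat) (D : R).
Hypothesis D0 : 0 < D.
Local Notation X := (space R d).
Local Notation mu := (lebesgue R d).
Local Notation BS := (l2 (torus_setting R d)).
Local Notation nrm := (seminorm (@dot _ _ _ _)).

(* The heat semigroup is free transport for unit time of a Maxwellian of
   temperature 4Dt, followed by integration over the velocity. *)
Definition heat_op (t : R) (b : BS) : BS :=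
  if t <= 0 then b else
  moment (phi d 1 (4 * D * t) 0) (transport 1 (lift (phi d 1 (4 * D * t) 0) b)).

Let T_gt0 t : 0 < t -> 0 < 4 * D * t. Proof. by move=> t0; rewrite !mulr_gt0. Qed.

Lemma heat_op0 b : heat_op 0 b = b. Proof. by rewrite /heat_op lexx. Qed.

Lemma heat_opE t b : (heat_op t b : X -> R) = heat D t b.
Proof.
apply/funext => x; rewrite /heat_op /heat; case: leP => // t0.
have T0 := T_gt0 t0; rewrite momentE//.
pose f z := maxwellian (4 * D * t) z * b (translate x 1 z).
have mf : measurable_fun setT f.
  apply: measurable_funM; first exact: measurable_maxwellian.
  apply: (measurableT_comp (l2_measurable b)).
  by apply: (measurable_translate (x := cst x) (t := cst 1) (v := id)).
transitivity (\int[mu]_v f v).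
  apply: eq_Rintegral => v _.
  by rewrite transportE// liftE// !phiE// !expr0 !mul1r /f_inf mul1r.
rewrite -(Rintegral_reflect_translate x mf); apply: eq_Rintegral => v _.
rewrite /f /maxwellian; congr (_ `^ _ * _ * b _); first by ring.
by apply: eq_from_tnth => i; rewrite !tnth_mktuple; ring.
Qed.

Lemma heat_op_le0 t b : t <= 0 -> heat_op t b = b.
Proof. by rewrite /heat_op => ->. Qed.

Lemma heat_op_gt0 t b : 0 < t -> heat_op t b =
  moment (phi d 1 (4 * D * t) 0) (transport 1 (lift (phi d 1 (4 * D * t) 0) b)).
Proof. by move=> t0; rewrite /heat_op leNgt t0. Qed.

#[global] Opaque heat_op.

Lemma dot_heat_op t b c : 0 < t ->
  dot (heat_op t b) c = \int[mu]_v (maxwellian (4 * D * t) v * corr b c v).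
Proof.
move=> t0; have T0 := T_gt0 t0; rewrite heat_op_gt0//.
rewrite (dot_moment ltr01 T0) (dot_lift_transport ltr01 T0); apply: eq_Rintegral => v _.
rewrite !(phiE ltr01 T0 _ (isT : (0 <= 1)%N)) !expr0 !mul1r /f_inf mul1r; congr (_ * corr _ _ _).
by apply: eq_from_tnth => i; rewrite !tnth_mktuple mul1r.
Qed.

(** With density 1 the profile [phi 0] has norm 1: the operator is an isometric lift, followed by an
    isometric transport and the adjoint of that lift. *)
Lemma heat_op_contract t b : nrm (heat_op t b) <= nrm b.
Proof.
have [t0|t0] := leP t 0; first by rewrite !heat_op_le0.
have T0 := T_gt0 t0; apply: l2norm_le_dual; first exact: l2norm_ge0.
rewrite {1}heat_op_gt0// (dot_moment ltr01 T0).
apply: (le_trans (ler_norm _)); apply: (le_trans (dot_le _ _)).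
by rewrite /seminorm dot_transport !(dot_lift ltr01 T0) (dot_phi00 d ltr01 T0) !mul1r.
Qed.

(** The Gaussian is even, and reflecting v exchanges b and c in the correlation. *)
Lemma heat_op_sym t b c : dot (heat_op t b) c = dot b (heat_op t c).
Proof.
have [t0|t0] := leP t 0; first by rewrite !heat_op_le0.
have T0 := T_gt0 t0.
rewrite [RHS]dotC; apply: (etrans (dot_heat_op b c t0)).
apply: (etrans _ (esym (dot_heat_op c b t0))).
pose f v := maxwellian (4 * D * t) v * corr c b v.
have mf : measurable_fun setT f.
  by apply: measurable_funM; [exact: measurable_maxwellian|exact: measurable_corr].
rewrite -/f -(Rintegral_reflect_translate [tuple 0 | i < d] mf).
apply: eq_Rintegral => v _; rewrite /f -corr_sym /maxwellian.
rewrite (_ : sqnorm (translate [tuple 0 | i < d] 1 v) = sqnorm v)//.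
apply: eq_bigr => i _.
by rewrite tnth_mktuple (tnth_mktuple (fun=> 0)) mul1r sub0r sqrrN.
Qed.

Lemma corr_heat_op t b c y : 0 < t -> corr (heat_op t b) c y =
  \int[mu]_z (maxwellian (4 * D * t) z * corr b c (translate y (-1) z)).
Proof.
move=> t0; rewrite corr_sym /corr dotC (dot_heat_op _ _ t0).
set y' := translate _ 1 y; apply: eq_Rintegral => z _; congr (_ * _).
rewrite /corr -(dot_shift y (shift z b)) !shift_shift; congr (dot _ _).
apply: l2_ext => x; rewrite shiftE; congr (c _).
by apply: eq_from_tnth => i; rewrite !tnth_mktuple; ring.
Qed.

(** Substitute w = y + z, exchange the integrals, which is legitimate since C is bounded, and
    integrate out y with [maxwellian_convolution]. *)
Lemma maxwellian_semigroup (a e : R) (C : X -> R) (K : R) : 0 < a -> 0 < e ->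
  measurable_fun setT C -> (forall y, `|C y| <= K) ->
  \int[mu]_y (maxwellian a y * \int[mu]_z (maxwellian e z * C (translate y (-1) z))) =
  \int[mu]_w (maxwellian (a + e) w * C w).
Proof.
move=> a0 e0 mC CK.
have K0 : 0 <= K by apply: le_trans (CK [tuple 0 | i < d]).
have ae0 : 0 < a + e by rewrite addr_gt0.
pose G (p : X * X) := maxwellian a p.1 * (maxwellian e (translate p.2 1 p.1) * C p.2).
have mtr : measurable_fun setT (fun p : X * X => maxwellian e (translate p.2 1 p.1)).
  apply: (measurableT_comp (@measurable_maxwellian R d e)).
  by apply: (measurable_translate (x := snd) (t := cst 1) (v := fst)).
have m1 : measurable_fun setT (fun p : X * X => maxwellian a p.1).
  by apply: (measurableT_comp (@measurable_maxwellian R d a)).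
have mG : measurable_fun setT G.
  apply: measurable_funM => //; apply: measurable_funM => //.
  exact: measurableT_comp.
have Ie (x : X) : (\int[mu]_w (maxwellian e (translate w 1 x))%:E = 1)%E.
  rewrite (@integral_translate _ _ 1 x (EFin \o maxwellian e)) ?integral_maxwellian//.
  by apply/measurable_EFinP; exact: measurable_maxwellian.
have mte (x : X) : measurable_fun setT (fun w : X => (maxwellian e (translate w 1 x))%:E).
  have := measurable_translater 1 x (@measurable_maxwellian R d e).
  by move/measurable_EFinP.
have iG1 : (mu \x mu)%E.-integrable setT
    (fun p : X * X => (maxwellian a p.1 * maxwellian e (translate p.2 1 p.1))%:E).
  apply/integrable12ltyP.
    have := measurable_funM m1 mtr; by move/measurable_EFinP.
  have nE (x w : X) : (`|maxwellian a x * maxwellian e (translate w 1 x)|%:E =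
      (maxwellian a x)%:E * (maxwellian e (translate w 1 x))%:E)%E.
    by rewrite (ger0_norm (mulr_ge0 (maxwellian_ge0 _ _) (maxwellian_ge0 _ _))) EFinM.
  rewrite [ltLHS](_ : _ = (\int[mu]_x (maxwellian a x)%:E)%E).
    by rewrite integral_maxwellian// ltry.
  apply: eq_integral => x _; under eq_integral do rewrite /= nE.
  rewrite ge0_integralZl_EFin ?maxwellian_ge0//.
  - by rewrite Ie mule1.
  - by move=> w _; rewrite lee_fin maxwellian_ge0.
have iG0 := integrableZl measurableT K iG1.
have iG : (mu \x mu)%E.-integrable setT (EFin \o G).
  apply: (le_integrable _ _ _ iG0) => //; first exact/measurable_EFinP.
  move=> p _; rewrite /= lee_fin /G mulrA !normrM mulrC.
  by apply: ler_pM => //; rewrite (le_trans (CK _))// ler_norm.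
transitivity (\int[mu]_y \int[mu]_w G (y, w)).
  apply: eq_Rintegral => y _.
  pose f z := maxwellian e z * C (translate y (-1) z).
  have mf : measurable_fun setT f.
    apply: measurable_funM; first exact: measurable_maxwellian.
    apply: (measurableT_comp mC).
    by apply: (measurable_translate (x := cst y) (t := cst (-1)) (v := id)).
  rewrite -/f -(Rintegral_translate 1 y mf) -RintegralZl_measurable; last first.
    exact: (measurable_translater 1 y mf).
  apply: eq_Rintegral => w _; rewrite /G /f/=; congr (_ * (_ * C _)).
  by apply: eq_from_tnth => i; rewrite !tnth_mktuple; ring.
rewrite (Rfubini1 iG) -(Rfubini2 iG); apply: eq_Rintegral => w _.
have c0 : 0 < a * e / (a + e) by rewrite divr_gt0// mulr_gt0.
transitivity (\int[mu]_y (maxwellian (a + e) w * C w *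
    maxwellian (a * e / (a + e)) (translate y (a / (a + e)) w))).
  apply: eq_Rintegral => y _.
  rewrite /G/= mulrA maxwellian_convolution//; ring.
rewrite RintegralZl_measurable; last first.
  exact: (measurable_translater (a / (a + e)) w
    (@measurable_maxwellian R d (a * e / (a + e)))).
rewrite (@Rintegral_translate _ _ _ _ (maxwellian (a * e / (a + e)))).
  by rewrite Rintegral_maxwellian// mulr1.
exact: measurable_maxwellian.
Qed.

(** The semigroup law is proved in weak form, where the integrands are Gaussians times bounded
    correlations; taking c to be the difference of the two sides gives [heat_op_add]. *)
Lemma dot_heat_op_add s t b c : 0 <= s -> 0 <= t ->
  dot (heat_op s (heat_op t b)) c = dot (heat_op (s + t) b) c.
Proof.
rewrite le_eqVlt => /orP[/eqP <-|s0]; first by rewrite heat_op0 add0r.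
rewrite le_eqVlt => /orP[/eqP <-|t0]; first by rewrite heat_op0 addr0.
rewrite (dot_heat_op _ _ s0) (dot_heat_op _ _ (addr_gt0 s0 t0)).
under eq_Rintegral do rewrite (corr_heat_op _ _ _ t0).
rewrite (maxwellian_semigroup (T_gt0 s0) (T_gt0 t0) (measurable_corr b c)
  (corr_le b c)).
by apply: eq_Rintegral => w _; congr (maxwellian _ _ * _); ring.
Qed.

Lemma heat_op_add s t b : 0 <= s -> 0 <= t ->
  nrm (heat_op s (heat_op t b) - heat_op (s + t) b) = 0.
Proof.
by move=> s0 t0; rewrite /seminorm {1}dotBl dot_heat_op_add// subrr sqrtr0.
Qed.

(** By symmetry the operator passes to the test function, and linearity becomes that of [dot]. *)
Lemma heat_op_linear t a b c :
  nrm (heat_op t (b + a *: c) - (heat_op t b + a *: heat_op t c)) = 0.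
Proof.
have additive x : dot (heat_op t (b + a *: c)) x =
    dot (heat_op t b) x + a * dot (heat_op t c) x.
  transitivity (dot (b + a *: c) (heat_op t x)); first exact: heat_op_sym.
  transitivity (dot b (heat_op t x) + a * dot c (heat_op t x)).
    by rewrite dotDl dotZl.
  by congr (_ + a * _); apply/esym; exact: heat_op_sym.
have zero x : dot (heat_op t (b + a *: c) - (heat_op t b + a *: heat_op t c)) x = 0.
  by rewrite dotBl additive dotDl dotZl subrr.
by rewrite /seminorm zero sqrtr0.
Qed.

End heat_semigroup.

(** * The linearized system *)

Lemma subr_subr_addr (V : zmodType) (x y z t : V) : (x - y) - (z - t) = (x - z) - (y - t).
Proof. by rewrite !opprB addrACA [in RHS]addrACA (addrC (- y)). Qed.

Section linearized_system.
Context (R : realType) (d : nat) (D rho T : R).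
Hypotheses (d0 : (0 < d)%N) (D0 : 0 < D) (rho0 : 0 < rho) (T0 : 0 < T).
Local Notation X := (space R d).
Local Notation BS := (l2 (torus_setting R d)).
Local Notation FS := (l2 (phase_setting d rho T)).
Local Notation VS := (l2 (velocity_setting d rho T)).
Local Notation St := (FS * BS)%type.
Local Notation nrm := (seminorm (@dot _ _ _ _)).
Local Notation phi0 := (phi d rho T 0).
Local Notation phi1 := (phi d rho T 1).
Local Notation one := (l2_one R d).
Lemma norm_lift (psi : VS) (b : BS) : nrm (lift psi b) = nrm psi * nrm b.
Proof. by rewrite /seminorm dot_lift// sqrtrM// dot_ge0. Qed.

Lemma dot_momentr (psi : VS) (f : FS) b : dot b (moment psi f) = dot (lift psi b) f.
Proof. by rewrite dotC dot_moment// dotC. Qed.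

Lemma norm_momentB (psi : VS) (f g : FS) :
  nrm (moment psi f - moment psi g) <= nrm psi * nrm (f - g).
Proof.
apply: l2norm_le_dual; first by rewrite mulr_ge0 ?l2norm_ge0.
set b := _ - _; rewrite {1}/b dotBl !dot_moment// -dotBl.
apply: (le_trans (ler_norm _)); apply: (le_trans (dot_le _ _)).
by rewrite norm_lift mulrCA mulrA.
Qed.

Lemma norm_moment (psi : VS) (f : FS) : nrm (moment psi f) <= nrm psi * nrm f.
Proof.
apply: l2norm_le_dual; first by rewrite mulr_ge0 ?l2norm_ge0.
rewrite dot_moment//.
apply: (le_trans (ler_norm _)); apply: (le_trans (dot_le _ _)).
by rewrite norm_lift mulrCA mulrA.
Qed.

(** |v|^2 expressed in the orthogonal profiles, so that energy moments reduce to theirs. *)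
Definition energy_weight : VS := T *: phi1 + (T * (d%:R / 2)) *: phi0.

Lemma energy_weightE v : energy_weight v = sqnorm v.
Proof.
rewrite /energy_weight l2_funD !l2_funZ !phiE// expr0 expr1.
by field; rewrite gt_eqF.
Qed.

Lemma lift_energy_weight b :
  lift energy_weight b = T *: lift phi1 b + (T * (d%:R / 2)) *: lift phi0 b.
Proof.
apply: l2_ext => z; rewrite l2_funD !l2_funZ !liftE// /energy_weight l2_funD !l2_funZ.
by ring.
Qed.

(** The form whose quadratic part is twice the entropy ([entropy_raw]). *)
Definition ip (u w : St) : R := dot u.1 w.1 + T ^- 2 * dot u.2 w.2.
Local Notation snrm := (seminorm ip).

Let T20 : 0 < T ^- 2. Proof. by rewrite invr_gt0 exprn_gt0. Qed.

Lemma ipC u w : ip u w = ip w u.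
Proof. by rewrite /ip (dotC u.1) (dotC u.2). Qed.

Lemma ipDl u v w : ip (u + v) w = ip u w + ip v w.
Proof. by rewrite /ip !dotDl; ring. Qed.

Lemma ipZl a u w : ip (a *: u) w = a * ip u w.
Proof. by rewrite /ip !dotZl; ring. Qed.

Lemma ip_ge0 u : 0 <= ip u u.
Proof. by rewrite addr_ge0 ?dot_ge0// mulr_ge0 ?dot_ge0// ltW. Qed.

Lemma ip_sqr u : ip u u = nrm u.1 ^+ 2 + (nrm u.2 / T) ^+ 2.
Proof. by rewrite !expr_div_n !l2norm_sqr /ip mulrC (mulrC _ (T ^- 2)). Qed.

Lemma norm1_le u : nrm u.1 <= snrm u.
Proof.
by rewrite ler_wsqrtr// lerDl mulr_ge0 ?dot_ge0// ltW.
Qed.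

Lemma norm2_le u : nrm u.2 / T <= snrm u.
Proof.
have nT0 : 0 <= nrm u.2 / T by rewrite divr_ge0 ?l2norm_ge0// ltW.
by rewrite -(ger0_norm nT0) -sqrtr_sqr ler_wsqrtr// ip_sqr lerDr sqr_ge0.
Qed.

Lemma snorm_le u : snrm u <= nrm u.1 + nrm u.2 / T.
Proof.
have a0 := l2norm_ge0 u.1.
have nT0 : 0 <= nrm u.2 / T by rewrite divr_ge0 ?l2norm_ge0// ltW.
rewrite -[leRHS]ger0_norm ?addr_ge0// -sqrtr_sqr ler_wsqrtr// ip_sqr.
have := mulr_ge0 a0 nT0; lra.
Qed.

Definition flow (t : R) (u : St) : St := (transport t u.1, heat_op D t u.2).

Lemma flow_linear (h a : R) (u w : St) : 0 <= h ->
  snrm (flow h (u + a *: w) - (flow h u + a *: flow h w)) = 0.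
Proof.
move=> h0; apply/eqP; rewrite eq_le sqrtr_ge0 andbT (le_trans (snorm_le _))//.
rewrite /= heat_op_linear// mul0r addr0 transportD// transportZ// subrr.
by rewrite /seminorm -(scale0r 0) dotZl mul0r sqrtr0.
Qed.

Lemma flow_contract (h : R) (u : St) : 0 <= h -> snrm (flow h u) <= snrm u.
Proof.
move=> h0; rewrite ler_wsqrtr// /ip /= dot_transport// lerD2l ler_pM2l//.
rewrite -!l2norm_sqr ler_pXn2r ?nnegrE ?l2norm_ge0//.
exact: heat_op_contract.
Qed.

Lemma flow_add (h t : R) (u : St) : 0 <= h -> 0 <= t ->
  snrm (flow h (flow t u) - flow (h + t) u) = 0.
Proof.
move=> h0 t0; apply/eqP; rewrite eq_le sqrtr_ge0 andbT (le_trans (snorm_le _))//.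
rewrite /= heat_op_add// mul0r addr0 transport_add// subrr.
by rewrite /seminorm -(scale0r 0) dotZl mul0r sqrtr0.
Qed.

Lemma flow_ip (h r : R) (u w : St) : 0 <= r <= h ->
  `|ip (flow h u) (flow r w) - ip u w| <=
  snrm w * (snrm (flow (h - r) u - u) + snrm (flow (h + r) u - u)).
Proof.
move=> /andP[r0 rh]; have h0 := le_trans r0 rh.
have e1 : dot (transport h u.1) (transport r w.1) = dot (transport (h - r) u.1) w.1.
  transitivity (dot (transport r (transport (h - r) u.1)) (transport r w.1)).
    by rewrite transport_add addrC subrK.
  exact: dot_transport.
have e2 : dot (heat_op D h u.2) (heat_op D r w.2) = dot (heat_op D (h + r) u.2) w.2.
  transitivity (dot (heat_op D r (heat_op D h u.2)) w.2).
    by apply/esym; exact: heat_op_sym.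
  by rewrite (addrC h); exact: dot_heat_op_add.
have -> : ip (flow h u) (flow r w) - ip u w =
    dot (transport (h - r) u.1 - u.1) w.1
    + T ^- 2 * dot (heat_op D (h + r) u.2 - u.2) w.2.
  by rewrite /ip /= e1 e2 !dotBl; ring.
rewrite mulrDr; apply: (le_trans (ler_normD _ _)); apply: lerD.
  apply: (le_trans (dot_le _ _)); rewrite mulrC.
  apply: ler_pM; rewrite ?l2norm_ge0//; first exact: norm1_le.
  exact: (norm1_le (flow (h - r) u - u)).
rewrite normrM (gtr0_norm T20).
apply: (@le_trans _ _ ((nrm w.2 / T) * (nrm (heat_op D (h + r) u.2 - u.2) / T))).
  rewrite [leRHS](_ : _ = T ^- 2 * (nrm (heat_op D (h + r) u.2 - u.2) * nrm w.2)).
    by rewrite ler_pM2l// dot_le.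
  by field; rewrite gt_eqF.
apply: ler_pM.
- by rewrite divr_ge0 ?l2norm_ge0// ltW.
- by rewrite divr_ge0 ?l2norm_ge0// ltW.
- exact: norm2_le.
- exact: (norm2_le (flow (h + r) u - u)).
Qed.

Definition coll (u : St) : FS :=
  rho^-1 *: lift phi0 (moment phi0 u.1) + T^-1 *: lift phi1 u.2 - u.1.

Definition src (u : St) : St := (coll u, - moment energy_weight (coll u)).

Definition dissip (u : St) : R := dot (coll u) (coll u).

(** A state is a local equilibrium minus its collision term. The density of this equilibrium is that
    of f, but its temperature is the separate field u.2. *)
Lemma lift_coll (u : St) :
  u.1 = rho^-1 *: lift phi0 (moment phi0 u.1) + T^-1 *: lift phi1 u.2 - coll u.
Proof. by rewrite /coll opprB addrCA subrr addr0. Qed.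

Lemma norm_phi0_sqr : nrm phi0 * nrm phi0 = rho.
Proof. by rewrite -expr2 l2norm_sqr dot_phi00. Qed.

(** In the first factor, 2 counts u.1 and its projection on the density direction, and |phi1| the
    temperature term; the second factor adds the energy moment of the collision term. *)
Let L : R := (2 + nrm phi1) * (1 + nrm energy_weight / T).

Lemma L_ge0 : 0 <= L.
Proof.
by rewrite mulr_ge0 ?addr_ge0 ?divr_ge0 ?l2norm_ge0// ltW.
Qed.

Lemma coll_lipschitz u w : nrm (coll u - coll w) <= (2 + nrm phi1) * snrm (u - w).
Proof.
have -> : coll u - coll w = rho^-1 *: lift phi0 (moment phi0 u.1 - moment phi0 w.1)
    + T^-1 *: lift phi1 (u - w).2 - (u - w).1.
  rewrite !liftB// !scalerBr /coll /=.
  by rewrite subr_subr_addr addrACA opprD.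
apply: (le_trans (l2normB _ _)); apply: (le_trans (lerD (l2normD _ _) (lexx _))).
rewrite !l2normZ !norm_lift !gtr0_norm ?invr_gt0//.
have h1 := norm_momentB phi0 u.1 w.1.
have h2 := norm1_le (u - w); have h3 := norm2_le (u - w).
have e1 : rho^-1 * (nrm phi0 * nrm (moment phi0 u.1 - moment phi0 w.1)) <= nrm (u - w).1.
  rewrite ler_pdivrMl//; apply: (@le_trans _ _ (nrm phi0 * (nrm phi0 * nrm (u - w).1))).
    by rewrite ler_wpM2l ?l2norm_ge0.
  by rewrite mulrA norm_phi0_sqr.
have e2 : T^-1 * (nrm phi1 * nrm (u - w).2) <= nrm phi1 * snrm (u - w).
  by rewrite mulrC -mulrA ler_wpM2l ?l2norm_ge0.
apply: (le_trans (lerD (lerD e1 e2) (lexx _))).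
rewrite mulrDl mulr_natl mulr2n addrAC; apply: lerD => //; exact: lerD.
Qed.

Lemma src_lipschitz u w : snrm (src u - src w) <= L * snrm (u - w).
Proof.
apply: (le_trans (snorm_le _)); rewrite /=.
rewrite -opprD l2normN.
have h1 := norm_momentB energy_weight (coll u) (coll w).
have h2 := coll_lipschitz u w.
set m := nrm (moment _ _ - _) in h1 *; set c := nrm (coll u - coll w) in h1 h2 *.
have n0 : 0 <= nrm energy_weight / T by rewrite divr_ge0 ?l2norm_ge0// ltW.
apply: (@le_trans _ _ (c * (1 + nrm energy_weight / T))).
  rewrite mulrDr mulr1 lerD2l mulrCA mulrA ler_pM2r ?invr_gt0//.
by rewrite /L mulrAC ler_wpM2r// addr_ge0.
Qed.

Lemma dot_moment0_coll u b : dot b (moment phi0 (coll u)) = 0.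
Proof.
rewrite dot_momentr /coll dotBr dotDr !dotZr !dot_lift// dot_phi00// dot_phi01//.
by rewrite -dot_momentr; field; rewrite !gt_eqF.
Qed.

(** The weight T^-2 makes the heat exchange cancel the pairing of Q with the temperature part of
    [lift_coll]; conservation of mass kills the density part, and - |Q|^2 remains. *)
Lemma src_dissip u : ip u (src u) = - dissip u.
Proof.
rewrite /ip /src /= dotNr dot_momentr lift_energy_weight dotDl !dotZl.
rewrite -(dot_momentr phi0) dot_moment0_coll {1}(lift_coll u) dotBl dotDl !dotZl.
rewrite -(dot_momentr phi0) dot_moment0_coll /dissip.
by field; rewrite !gt_eqF.
Qed.

Let bb : R := 1 + (nrm energy_weight / T) ^+ 2.

Lemma bb_gt0 : 0 < bb. Proof. by rewrite ltr_wpDr ?sqr_ge0. Qed.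

Lemma src_bound u : ip (src u) (src u) <= bb * dissip u.
Proof.
rewrite ip_sqr /src /= l2normN /bb mulrDl mul1r /dissip -l2norm_sqr lerD2l.
rewrite -exprMn mulrAC ler_pXn2r ?nnegrE ?mulr_ge0 ?invr_ge0 ?l2norm_ge0 ?(ltW T0)//.
by rewrite ler_pM2r ?invr_gt0// norm_moment.
Qed.

End linearized_system.

(** Arithmetic core of [averaging]: r = |phi0| / rho, n = |phi1|, ic = 1 / |phi1|^2, m = |phi0| +
    |phi1|; A and t are the sizes of density and temperature of z, E the error of [moment_step], y
    the kinetic drift, qz and qw the norms of the collision terms, s and sz the norms of w and z. E
    enters with total weight r + (n + 1) ic, which explains the condition on del. *)
Lemma averaging_arith (R : realFieldType) (r n ic m del A t qz qw y E s z1 sz : R) :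
  0 <= r -> 0 <= n -> 0 <= ic -> 0 <= m -> 0 <= qz -> 0 <= qw -> 0 <= y ->
  A <= E -> t <= (n * qz + E) * ic + n * qw ->
  E <= (y + qw) * m + del * (r + 1) * s ->
  z1 <= r * A + n * t + qz -> sz <= z1 + t ->
  (r + (n + 1) * ic) * del * (r + 1) = 1 / 4 ->
  sz <= 1 / 4 * s
    + ((r + (n + 1) * ic) * m + (n + 1) * n * ic + 1 + (n + 1) * n) * (y + qw + qz).
Proof.
move=> r0 n0 ic0 m0 qz0 qw0 y0 hA ht hE hz1 hz dlE.
have n1 : 0 <= n + 1 by rewrite addr_ge0.
have al0 : 0 <= r + (n + 1) * ic by rewrite addr_ge0// mulr_ge0.
have nn0 : 0 <= (n + 1) * n by rewrite mulr_ge0.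
have nc0 : 0 <= (n + 1) * n * ic by rewrite mulr_ge0.
have h1 := ler_wpM2l r0 hA; have h2 := ler_wpM2l n1 ht.
have h3 := ler_wpM2l al0 hE.
have p1 := mulr_ge0 (mulr_ge0 al0 m0) qz0; have p2 := mulr_ge0 nc0 qw0.
have p3 := mulr_ge0 nn0 qz0; have p4 := mulr_ge0 nc0 y0; have p5 := mulr_ge0 nn0 y0.
have {}dlE : (r + (n + 1) * ic) * (del * (r + 1) * s) = 1 / 4 * s by rewrite -dlE; ring.
rewrite mulrDr dlE in h3.
apply: (le_trans hz); apply: (le_trans (lerD hz1 (lexx _))).
apply: (@le_trans _ _ ((r + (n + 1) * ic) * E + (n + 1) * n * ic * qz
  + (n + 1) * n * qw + qz)).
  by lra.
apply: (@le_trans _ _ ((r + (n + 1) * ic) * ((y + qw) * m) + 1 / 4 * s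
  + (n + 1) * n * ic * qz + (n + 1) * n * qw + qz)).
  by rewrite !lerD2r.
by lra.
Qed.

(** * The averaging estimate *)

Section averaging.
Context (R : realType) (d : nat) (D rho T : R).
Hypotheses (d0 : (0 < d)%N) (D0 : 0 < D) (rho0 : 0 < rho) (T0 : 0 < T).
Local Notation X := (space R d).
Local Notation BS := (l2 (torus_setting R d)).
Local Notation FS := (l2 (phase_setting d rho T)).
Local Notation VS := (l2 (velocity_setting d rho T)).
Local Notation St := (FS * BS)%type.
Local Notation nrm := (seminorm (@dot _ _ _ _)).
Local Notation snrm := (seminorm (@ip R d rho T)).
Local Notation phi0 := (phi d rho T 0).
Local Notation phi1 := (phi d rho T 1).
Local Notation one := (l2_one R d).
Local Notation a0 u := (moment phi0 u.1).
Local Notation Q u := (coll u).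
Local Notation n0 := (nrm phi0).
Local Notation n1 := (nrm phi1).
Local Notation c1 := (dot phi1 phi1).

Definition conserved (u : St) : Prop :=
  dot (a0 u) one = 0 /\ dot (moment (energy_weight d rho T) u.1) one + dot u.2 one = 0.

Lemma norm_one : nrm one = 1.
Proof. by rewrite /seminorm dot_one sqrtr1. Qed.

Lemma mean_le (b : BS) : `|dot b one| <= nrm b.
Proof. by apply: (le_trans (dot_le _ _)); rewrite norm_one mulr1. Qed.

Lemma dot_lift_le (f : FS) psi b : `|dot f (lift psi b)| <= nrm f * (nrm psi * nrm b).
Proof. by apply: (le_trans (dot_le _ _)); rewrite norm_lift. Qed.

Lemma norm_transport t (f : FS) : nrm (transport t f) = nrm f.
Proof. by rewrite /seminorm dot_transport. Qed.

Lemma dot_lift_phi1 (u : St) b :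
  dot u.1 (lift phi1 b) = T^-1 * c1 * dot u.2 b - dot (Q u) (lift phi1 b).
Proof.
rewrite {1}(lift_coll u) dotBl dotDl !dotZl !dot_lift// dot_phi01//.
by rewrite mul0r mulr0 add0r mulrA.
Qed.

(** Up to a term in Q, the mean kinetic energy is |phi1|^2 times the mean temperature. Having the
    same sign, the two parts of the conserved total energy cannot cancel each other, so both are
    small with Q. *)
Lemma mean_temperature_le (u : St) : conserved u -> `|dot u.2 one| <= T * n1 * nrm (Q u).
Proof.
move=> [m0]; rewrite dot_moment// lift_energy_weight// dotDr !dotZr.
rewrite -(dot_moment rho0 T0 phi0) m0 mulr0 addr0 dot_lift_phi1 => e.
have c10 : 0 <= c1 by exact: dot_ge0.
have {}e : (1 + c1) * dot u.2 one = T * dot (Q u) (lift phi1 one).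
  apply/eqP; rewrite -subr_eq0; apply/eqP; rewrite -[RHS]e.
  by field; rewrite gt_eqF.
have h := dot_lift_le (Q u) phi1 one; rewrite norm_one mulr1 in h.
apply: (@le_trans _ _ ((1 + c1) * `|dot u.2 one|)).
  by rewrite mulrDl mul1r lerDl mulr_ge0.
rewrite -{1}(ger0_norm (addr_ge0 ler01 c10)) -normrM e normrM gtr0_norm//.
by rewrite -mulrA ler_pM2l// mulrC.
Qed.

Section step.
Variables (delta N : R).
Hypothesis equi : forall i j, (i <= 1)%N -> (j <= 1)%N -> forall b c : BS,
  `|dot (transport N (lift (phi d rho T i) b)) (lift (phi d rho T j) c)
    - dot (phi d rho T i) (phi d rho T j) * (dot b one * dot c one)|
  <= delta * (nrm b * nrm c).
Variables w z : St.
Hypotheses (Kw : conserved w).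

Let Y := z.1 - transport N w.1.
Let E := (nrm Y + nrm (Q w)) * (n0 + n1) + delta * (nrm (a0 w) / rho + nrm w.2 / T).

(* Test the transported local equilibrium of w against that of z: its density
   part only contributes through the mean, which vanishes. *)
Lemma moment_step j b : (j <= 1)%N ->
  `|dot z.1 (lift (phi d rho T j) b)
    - T^-1 * (dot phi1 (phi d rho T j) * (dot w.2 one * dot b one))| <= E * nrm b.
Proof.
move=> j1; set ph := phi d rho T j.
have -> : z.1 = Y + transport N w.1 by rewrite /Y subrK.
rewrite {1}(lift_coll w) !transportD// transportN !transportZ dotDl dotBl dotDl !dotZl.
have h0 := equi (leq0n 1) j1 (a0 w) b; have h1 := equi (leqnn 1) j1 w.2 b.
rewrite Kw.1 mul0r mulr0 subr0 -/ph in h0; rewrite -/ph in h1.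
have nph : nrm ph <= n0 + n1.
  rewrite /ph; clear -j1; case: j j1 => [|[|//]] _.
    by rewrite lerDl; exact: l2norm_ge0.
  by rewrite lerDr; exact: l2norm_ge0.
have hY := dot_lift_le Y ph b.
have hQ := dot_lift_le (transport N (Q w)) ph b.
rewrite norm_transport in hQ.
have nb := l2norm_ge0 b.
have {}hY : `|dot Y (lift ph b)| <= nrm Y * (n0 + n1) * nrm b.
  by apply: (le_trans hY); rewrite -mulrA ler_wpM2l ?l2norm_ge0// ler_wpM2r.
have {}hQ : `|dot (transport N (Q w)) (lift ph b)| <= nrm (Q w) * (n0 + n1) * nrm b.
  by apply: (le_trans hQ); rewrite -mulrA ler_wpM2l ?l2norm_ge0// ler_wpM2r.
have {}h0 : `|rho^-1 * dot (transport N (lift phi0 (a0 w))) (lift ph b)|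
    <= delta * (nrm (a0 w) / rho) * nrm b.
  rewrite normrM gtr0_norm ?invr_gt0// ler_pdivrMl//; apply: (le_trans h0).
  by rewrite le_eqVlt; apply/orP; left; apply/eqP; field; rewrite gt_eqF.
have {}h1 : `|T^-1 * (dot (transport N (lift phi1 w.2)) (lift ph b)
    - dot phi1 ph * (dot w.2 one * dot b one))| <= delta * (nrm w.2 / T) * nrm b.
  rewrite normrM gtr0_norm ?invr_gt0// ler_pdivrMl//; apply: (le_trans h1).
  by rewrite le_eqVlt; apply/orP; left; apply/eqP; field; rewrite gt_eqF.
rewrite /E; move: hY hQ h0 h1.
move: (nrm Y) (nrm (Q w)) (nrm (a0 w) / rho) (nrm w.2 / T) (nrm b) (n0 + n1).
move: (dot Y _) (dot (transport N (Q w)) _) (dot (transport N (lift phi0 _)) _)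
  (dot (transport N (lift phi1 _)) _) (dot phi1 ph * _) => y q x0 x1 m nY nQ na nT nb' n hY hQ h0 h1.
have -> : y + (rho^-1 * x0 + T^-1 * x1 - q) - T^-1 * m =
  (y - q) + (rho^-1 * x0 + T^-1 * (x1 - m)) by ring.
apply: (le_trans (ler_normD _ _)).
have -> : ((nY + nQ) * n + delta * (na + nT)) * nb' =
  (nY * n * nb' + nQ * n * nb')
  + (delta * na * nb' + delta * nT * nb') by ring.
apply: lerD.
  by apply: (le_trans (ler_normB _ _)); exact: lerD.
by apply: (le_trans (ler_normD _ _)); exact: lerD.
Qed.

(** Test with b the density of z itself; the mean temperature drops out by orthogonality of the
    profiles. *)
Lemma density_step : 0 <= delta -> nrm (a0 z) <= E.
Proof.
move=> dl0; apply: l2norm_le_dual.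
  by rewrite addr_ge0 ?mulr_ge0 ?addr_ge0 ?divr_ge0 ?l2norm_ge0// ltW.
have := @moment_step 0 (a0 z) isT.
rewrite (dotC phi1) dot_phi01// mul0r mulr0 subr0 -(dot_moment rho0 T0).
exact/le_trans/ler_norm.
Qed.

(** Test with the temperature of z: by [dot_lift_phi1] this produces |phi1|^2 |z.2|^2 / T up to Q z,
    and the surviving product of means is controlled by [mean_temperature_le]. *)
Lemma temperature_step : 0 <= delta ->
  nrm z.2 / T <= (n1 * nrm (Q z) + E) / c1 + n1 * nrm (Q w).
Proof.
move=> dl0; have c10 : 0 < c1 by exact: dot_phi11_gt0.
have E0 : 0 <= E by rewrite addr_ge0 ?mulr_ge0 ?addr_ge0 ?divr_ge0 ?l2norm_ge0// ltW.
rewrite ler_pdivrMr//; apply: l2norm_le_dual.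
  apply: mulr_ge0; last exact: ltW.
  apply: addr_ge0; last by rewrite mulr_ge0 ?l2norm_ge0.
  apply: divr_ge0; last exact: ltW.
  by apply: addr_ge0 => //; rewrite mulr_ge0 ?l2norm_ge0.
have h := @moment_step 1 z.2 isT; rewrite dot_lift_phi1 in h.
have hQ := dot_lift_le (Q z) phi1 z.2.
have hm := mean_temperature_le Kw; have hz := mean_le z.2.
have hp : `|dot w.2 one * dot z.2 one| <= T * n1 * nrm (Q w) * nrm z.2.
  by rewrite normrM ler_pM.
move: h hQ hp E0 c10; move: c1 n1 (dot z.2 z.2) (dot (Q z) _) (dot w.2 one * _) (nrm (Q z))
  (nrm (Q w)) (nrm z.2) E => c n x q m nqz nqw nz e h hQ hp E0 c10.
have {}h : T^-1 * c * x <= e * nz + `|q| + T^-1 * c * `|m|.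
  have := ler_norm (T^-1 * c * x - q - T^-1 * (c * m)).
  have := ler_norm q; have := ler_norm m.
  have k0 : 0 <= T^-1 * c by rewrite mulr_ge0 ?invr_ge0 ?(ltW T0) ?(ltW c10).
  move=> hm' hq' hh.
  have := ler_wpM2l k0 hm'; lra.
have k1 : 0 < T^-1 * c by rewrite mulr_gt0 ?invr_gt0.
rewrite -(ler_pM2l k1); apply: (le_trans h).
have -> : T^-1 * c * (((n * nqz + e) / c + n * nqw) * T * nz) =
  e * nz + nqz * (n * nz) + T^-1 * c * (T * n * nqw * nz).
  by field; rewrite !gt_eqF.
by apply: lerD; [apply: lerD|rewrite ler_pM2l].
Qed.

End step.

Lemma averaging : exists N C : R, [/\ 0 <= N, 0 < C &
  forall w z : St, conserved w -> conserved z ->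
  ip z z <= 1/4 * ip w w
    + C * (dissip w + dissip z + ip (z - flow D N w) (z - flow D N w))].
Proof.
have c10 : 0 < c1 by exact: dot_phi11_gt0.
have ic0 : 0 < c1^-1 by rewrite invr_gt0.
have n00 : 0 <= n0 by exact: l2norm_ge0.
have n10 : 0 <= n1 by exact: l2norm_ge0.
have nr0 : 0 <= n0 / rho by rewrite divr_ge0// ltW.
pose al := n0 / rho + (n1 + 1) / c1.
have al0 : 0 < al by rewrite ltr_wpDl// divr_gt0// ltr_wpDl.
(* With this accuracy the equidistribution error contributes exactly a quarter of the norm of w to
   that of z. It involves only the profiles, so it can be fixed before N. *)
pose delta := (4 * (al * (n0 / rho + 1)))^-1.
have k0 : 0 < al * (n0 / rho + 1) by rewrite mulr_gt0// ltr_wpDl.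
have dl0 : 0 < delta by rewrite invr_gt0 mulr_gt0.
have dlE : al * delta * (n0 / rho + 1) = 1 / 4.
  by rewrite /delta mulrAC invfM mulrCA mulfV ?gt_eqF// mulr1 div1r.
have [N N0 equi] := transport_equidistribution d rho0 T0 dl0.
pose ga := al * (n0 + n1) + (n1 + 1) * n1 / c1 + 1 + (n1 + 1) * n1.
have n11 : 0 <= (n1 + 1) * n1 by rewrite mulr_ge0// addr_ge0.
have n1c : 0 <= (n1 + 1) * n1 / c1 by rewrite divr_ge0// ltW.
have aln : 0 <= al * (n0 + n1) by rewrite mulr_ge0 ?(ltW al0)// addr_ge0.
(* Squaring |z| <= |w| / 4 + ga (y + a + b), with y the drift and a, b the collision norms: 2 / 16
   <= 1 / 4, and 6 is 2 times the 3 from the square of a sum of three terms. The + 1 ensures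
   positivity. *)
exists N, (6 * ga ^+ 2 + 1); split => //.
  by rewrite ltr_wpDl// mulr_ge0// sqr_ge0.
move=> w z Kw Kz; move: dlE; move: equi.
clearbody delta => equi dlE.
have hd := density_step equi z Kw (ltW dl0).
have ht := temperature_step equi z Kw (ltW dl0).
set y := nrm (z.1 - transport N w.1) in hd ht.
set E := _ + delta * _ in hd ht.
have y0 : 0 <= y by exact: l2norm_ge0.
have qw0 : 0 <= nrm (Q w) by exact: l2norm_ge0.
have qz0 : 0 <= nrm (Q z) by exact: l2norm_ge0.
have hE : E <= (y + nrm (Q w)) * (n0 + n1) + delta * (n0 / rho + 1) * snrm w.
  rewrite lerD2l -mulrA ler_pM2l// mulrDl mul1r; apply: lerD; last exact: norm2_le.
  rewrite mulrAC ler_pM2r ?invr_gt0//.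
  apply: (le_trans (norm_moment rho0 T0 _ _)); rewrite ler_wpM2l//.
  exact: norm1_le.
have hz1 : nrm z.1 <= n0 / rho * nrm (a0 z) + n1 * (nrm z.2 / T) + nrm (Q z).
  rewrite {1}(lift_coll z); apply: (le_trans (l2normB _ _)); rewrite lerD2r.
  apply: (le_trans (l2normD _ _)); rewrite !l2normZ !gtr0_norm ?invr_gt0// !norm_lift//.
  by apply: lerD; [rewrite mulrA (mulrC rho^-1)|rewrite mulrCA (mulrC T^-1)].
have hz := snorm_le T0 z.
have key : snrm z <= 1 / 4 * snrm w + ga * (y + nrm (Q w) + nrm (Q z)).
  exact: (averaging_arith nr0 n10 (ltW ic0) (addr_ge0 n00 n10) qz0 qw0 y0 hd ht hE hz1 hz dlE).
have hy : y ^+ 2 <= ip (z - flow D N w) (z - flow D N w).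
  by rewrite ip_sqr// lerDl sqr_ge0.
have zz : ip z z = snrm z ^+ 2 by rewrite sqr_sqrtr// ip_ge0.
have ww : ip w w = snrm w ^+ 2 by rewrite sqr_sqrtr// ip_ge0.
have i0 := ip_ge0 T0 (z - flow D N w).
rewrite zz ww /dissip -!l2norm_sqr.
have sz : 0 <= snrm z by exact: sqrtr_ge0.
have sw : 0 <= snrm w by exact: sqrtr_ge0.
have ga0 : 0 <= ga by rewrite !addr_ge0.
move: key hy i0 sz sw ga0 y0 qw0 qz0; clear.
move: (snrm z) (snrm w) ga y (nrm (Q w)) (nrm (Q z)) (ip _ _).
move=> s t g y a b i key yi i0 s0 t0 g0 y0 a0 b0.
have r0 : 0 <= 1 / 4 * t + g * (y + a + b).
  by rewrite addr_ge0// mulr_ge0// !addr_ge0.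
have h1 : s ^+ 2 <= (1 / 4 * t + g * (y + a + b)) ^+ 2 by rewrite ler_pXn2r ?nnegrE.
apply: (le_trans h1).
have h2 : (y + a + b) ^+ 2 <= 3 * (y ^+ 2 + a ^+ 2 + b ^+ 2).
  by have := sqr_ge0 (y - a); have := sqr_ge0 (y - b); have := sqr_ge0 (a - b); lra.
have h3 := ler_wpM2l (sqr_ge0 g) h2.
have h4 := sqr_ge0 (1 / 4 * t - g * (y + a + b)).
have h5 := ler_wpM2l (sqr_ge0 g) yi.
have h6 := sqr_ge0 a; have h7 := sqr_ge0 b; have h8 := sqr_ge0 t.
lra.
Qed.

End averaging.

(** * Translation between raw states and the Hilbert space *)

Section states.
Context (R : realType) (d : nat) (D rho T : R).
Hypotheses (d0 : (0 < d)%N) (D0 : 0 < D) (rho0 : 0 < rho) (T0 : 0 < T).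
Local Notation X := (space R d).
Local Notation mu := (lebesgue R d).
Local Notation BS := (l2 (torus_setting R d)).
Local Notation FS := (l2 (phase_setting d rho T)).
Local Notation St := (FS * BS)%type.
Local Notation snrm := (seminorm (@ip R d rho T)).
Local Notation phi0 := (phi d rho T 0).
Local Notation one := (l2_one R d).

Theorem linearized_decay : exists M lambda : R, [/\ 0 < M, 0 < lambda &
  forall u : R -> St, mild (@ip R d rho T) (@flow R d D rho T) (@src R d rho T) u ->
    (forall t, 0 <= t -> conserved (u t)) ->
    forall t, 0 <= t -> ip (u t) (u t) <= M * expR (- lambda * t) * ip (u 0) (u 0)].
Proof.
have [N [C [N0 C0 avg]]] := averaging D d0 rho0 T0.
exact: (hypocoercive_decay (@ipC R d rho T) (@ipDl R d rho T) (@ipZl R d rho T)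
  (ip_ge0 T0) (flow_linear D0 T0) (flow_contract D0 T0)
  (flow_add D0 T0) (flow_ip D0 T0) (L_ge0 d rho T0)
  (src_lipschitz rho0 T0) (src_dissip rho0 T0) (bb_gt0 _ _ _) (src_bound rho0 T0) N0 C0 avg).
Qed.

Definition raw (u : St) : state R d := (u.1 : X * X -> R^o, u.2 : X -> R^o).

Lemma raw_is_linear : linear raw.
Proof. by []. Qed.

HB.instance Definition _ := GRing.isLinear.Build R St (state R d) _ raw raw_is_linear.

Lemma raw_flow t u : raw (flow D t u) = free_flow D t (raw u).
Proof.
congr pair; last exact: heat_opE.
by apply/funext => z; rewrite transportE.
Qed.

Lemma raw_src u : raw (src u) = source rho T (raw u).
Proof.
have e x v : coll u (x, v) = collision rho T (raw u) x v.
  rewrite /coll l2_funD l2_funN l2_funD !l2_funZ !liftE// momentE//= !phiE// expr1.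
  rewrite /collision /density /= /f_inf.
  rewrite (_ : \int[mu]_v (phi0 v * u.1 (x, v)) = \int[mu]_v u.1 (x, v)); last first.
    by apply: eq_Rintegral => w _; rewrite phiE// expr0 mul1r.
  by rewrite expr0; field; rewrite !gt_eqF.
rewrite /raw /source; congr (_, _); apply/funext.
  by case=> x v; exact: e.
move=> x; transitivity (- moment (energy_weight d rho T) (coll u) x) => //.
rewrite momentE//; congr (- _); apply: eq_Rintegral => v _.
by rewrite energy_weightE// e.
Qed.

(** The identity holds in the extended reals, infinite entropy included. Both terms being
    nonnegative, finite entropy makes each component square-integrable, which is how [raw_of_raw]
    uses it. *)
Lemma entropyE (v : state R d) : measurable_fun setT v.1 -> measurable_fun setT v.2 ->
  entropy rho T v =
  ((1 / 2)%:E * \int[mu \x mu]_z (v.1 z ^+ 2 * phasew rho T z)%:E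
   + (1 / 2 * T ^- 2)%:E * \int[mu]_x (v.2 x ^+ 2 * cellw x)%:E)%E.
Proof.
move=> m1 m2.
have f0 v' : 0 < f_inf rho T v' by exact: f_inf_gt0.
have mg : measurable_fun setT (fun z => (v.1 z ^+ 2 * phasew rho T z)%:E).
  apply/measurable_EFinP; apply: measurable_funM; last exact: measurable_phasew.
  exact: measurable_funX.
have g0 z : (0 <= (v.1 z ^+ 2 * phasew rho T z)%:E)%E.
  by rewrite lee_fin mulr_ge0 ?sqr_ge0// phasew_ge0.
have mh : measurable_fun setT (fun x => (v.2 x ^+ 2 * cellw x)%:E).
  apply/measurable_EFinP; apply: measurable_funM; last exact: measurable_cellw.
  exact: measurable_funX.
have h0 x : (0 <= (v.2 x ^+ 2 * cellw x)%:E)%E.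
  by rewrite lee_fin mulr_ge0 ?sqr_ge0// cellw_ge0.
have mF : measurable_fun setT (fubini_F mu (fun z => (v.1 z ^+ 2 * phasew rho T z)%:E)).
  exact: measurable_fun_fubini_tonelli_F.
rewrite fubini_tonelli1// -ge0_integralZl//; last by move=> x _; exact: integral_ge0.
rewrite -ge0_integralZl// -?ge0_integralD//; last 5 first.
- by move=> x _; rewrite mule_ge0// ?lee_fin//; exact: integral_ge0.
- exact: measurable_funeM.
- by move=> x _; rewrite mule_ge0// lee_fin mulr_ge0// invr_ge0 sqr_ge0.
- exact: measurable_funeM.
- by rewrite lee_fin mulr_ge0// invr_ge0 sqr_ge0.
rewrite /entropy -integral_cellw; apply: eq_integral => x _.
have m1x : measurable_fun setT (fun w => v.1 (x, w)).
  by apply: (measurableT_comp m1); exact: measurable_pair1.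
rewrite muleC ge0_muleDr ?lee_fin ?cellw_ge0//; last 2 first.
- apply: integral_ge0 => w _; rewrite lee_fin divr_ge0 ?sqr_ge0// mulr_ge0//.
  exact: ltW.
- by rewrite divr_ge0 ?sqr_ge0// mulr_ge0// sqr_ge0.
congr (_ + _)%E; last first.
  by rewrite -!EFinM; congr EFin; field; rewrite gt_eqF.
rewrite -!ge0_integralZl//.
- by apply: eq_integral => w _; rewrite -!EFinM; congr EFin; rewrite phasewE//=;
    field; rewrite gt_eqF.
- exact: (measurableT_comp mg (@measurable_pair1 _ _ _ _ x)).
- apply/measurable_EFinP; apply: measurable_funM; first exact: measurable_funX.
  rewrite (_ : (fun _ => _) = (fun w => 2^-1 * (f_inf rho T w)^-1)).
    by apply: measurable_funM => //; exact: measurable_f_infV.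
  by apply/funext => w; rewrite invfM.
- by move=> w _; rewrite lee_fin divr_ge0 ?sqr_ge0// mulr_ge0// ltW.
- by rewrite lee_fin cellw_ge0.
Qed.

Lemma entropy_raw (u : St) : entropy rho T (raw u) = (ip u u / 2)%:E.
Proof.
rewrite entropyE; [|exact: (l2_measurable u.1)|exact: (l2_measurable u.2)].
have e1 := dot_integralE u.1; have e2 := dot_integralE u.2.
rewrite -[in X in (X + _)%E]e1 -[in X in (_ + X)%E]e2 -!EFinM -EFinD /ip; congr EFin.
by field; rewrite gt_eqF.
Qed.

Definition of_raw (v : state R d) : St := (to_l2 _ v.1, to_l2 _ v.2).

Lemma raw_of_raw (v : state R d) : in_hilbert rho T v -> raw (of_raw v) = v.
Proof.
case=> m1 m2 p1 p2 foo _ _.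
move: foo; rewrite entropyE// => foo.
have i1 : (0 <= \int[mu \x mu]_z (v.1 z ^+ 2 * phasew rho T z)%:E)%E.
  by apply: integral_ge0 => z _; rewrite lee_fin mulr_ge0 ?sqr_ge0// phasew_ge0.
have i2 : (0 <= \int[mu]_x (v.2 x ^+ 2 * cellw x)%:E)%E.
  by apply: integral_ge0 => z _; rewrite lee_fin mulr_ge0 ?sqr_ge0// cellw_ge0.
have T20 : 0 < 1 / 2 * T ^- 2 by rewrite mulr_gt0// invr_gt0 exprn_gt0.
have l1 : is_l2 (phase_setting d rho T) v.1.
  split => //; apply/integrableP; split.
    apply/measurable_EFinP; apply: measurable_funM; last exact: measurable_phasew.
    exact: measurable_funX.
  rewrite ltey; apply/negP => /eqP e; move: foo.
  rewrite (_ : (\int[mu \x mu]_z (v.1 z ^+ 2 * phasew rho T z)%:E)%E = +oo%E).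
    rewrite gt0_muley ?lte_fin// addye// gt_eqF// (lt_le_trans (ltNyr 0))//.
    by rewrite mule_ge0// lee_fin ltW.
  rewrite -e; apply: eq_integral => z _.
  by rewrite /= ger0_norm// mulr_ge0 ?sqr_ge0// phasew_ge0.
have l2 : is_l2 (torus_setting R d) v.2.
  split => //; apply/integrableP; split.
    apply/measurable_EFinP; apply: measurable_funM; last exact: measurable_cellw.
    exact: measurable_funX.
  rewrite ltey; apply/negP => /eqP e; move: foo.
  rewrite (_ : (\int[mu]_x (v.2 x ^+ 2 * cellw x)%:E)%E = +oo%E).
    rewrite gt0_muley ?lte_fin// addey// gt_eqF// (lt_le_trans (ltNyr 0))//.
    by rewrite mule_ge0// lee_fin ltW.
  rewrite -e; apply: eq_integral => z _.
  by rewrite /= ger0_norm// mulr_ge0 ?sqr_ge0// cellw_ge0.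
by case: v l1 l2 {m1 m2 p1 p2 foo i1 i2} => v1 v2 l1 l2;
  congr pair; exact: to_l2E.
Qed.

Lemma conserved_raw (u : St) : in_hilbert rho T (raw u) -> conserved u.
Proof.
case=> _ _ _ _ _ zm ze; split.
  rewrite dotC dot_onel -[RHS]zm; apply: eq_Rintegral => x _.
  by rewrite momentE//; apply: eq_Rintegral => v _; rewrite phiE// expr0 mul1r.
rewrite -dotDl dotC dot_onel -[RHS]ze; apply: eq_Rintegral => x _.
rewrite l2_funD momentE//; congr (_ + _).
by apply: eq_Rintegral => v _; rewrite energy_weightE.
Qed.

Lemma snorm_le_entropy (u : St) (eps : R) : 0 < eps ->
  (entropy rho T (raw u) < (eps ^+ 2 / 2)%:E)%E -> snrm u <= eps.
Proof.
move=> e0; rewrite entropy_raw lte_fin ltr_pM2r// => /ltW h.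
by rewrite -(ger0_norm (ltW e0)) -sqrtr_sqr ler_wsqrtr.
Qed.

Lemma mild_raw (v : R -> state R d) (u : R -> St) : mild_solution D rho T v ->
  (forall s, 0 <= s -> v s = raw (u s)) ->
  mild (@ip R d rho T) (@flow R d D rho T) (@src R d rho T) u.
Proof.
case=> _ cont duh vE; split=> t t0 eps e0.
- have e20 : 0 < eps ^+ 2 / 2 by rewrite divr_gt0// exprn_gt0.
  have /(cont t t0) := @nbhs_open_ereal_lt R 0 (fun=> eps ^+ 2 / 2) e20.
  (* [mild] asks for a closed neighbourhood, the ball is open: hence half the radius. *)
  move=> /nbhs_ballP[delta /= delta0 h]; exists (delta / 2); first by rewrite divr_gt0.
  move=> s s0 st; apply: snorm_le_entropy => //; 
  have -> : raw (u s - u t) = v s - v t by rewrite !vE.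
  apply: (h s); last by rewrite /= in_itv /= s0.
  by rewrite /ball /= distrC (le_lt_trans st)// ltr_pdivrMr// ltr_pMr// ltr1n.
- have e20 : 0 < eps ^+ 2 / 2 by rewrite divr_gt0// exprn_gt0.
  have [delta delta0 h] := duh t t0 _ e20.
  exists delta => // n p p0 pn hp.
  have pge k : (k <= n)%N -> 0 <= p k.
    elim: k => [|k IHk] kn; first by rewrite p0.
    have := IHk (ltnW kn); have /andP[] := hp k kn; lra.
  apply: snorm_le_entropy => //.
  rewrite (linearB raw) (linear_sum raw) (linearB raw) /= raw_flow -!vE//.
  have -> : \sum_(k < n) raw ((p k.+1 - p k) *: flow D (t - p k) (src (u (p k)))) =
    \sum_(k < n) (p k.+1 - p k) *: free_flow D (t - p k) (source rho T (v (p k))).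
    by apply: eq_bigr => k _; rewrite linearZ /= raw_flow raw_src vE// pge// ltnW.
  (* The sample points are the left endpoints. *)
  apply: (h n p p) => // k kn; have /andP[h1 h2] := hp k kn.
  by split => //; rewrite lexx -subr_ge0.
Qed.

End states.

Theorem theorem1 (R : realType) (d : nat) (D rho_inf T_inf : R)
    (hd : (1 <= d)%N) (hD : 0 < D) (hrho : 0 < rho_inf) (hT : 0 < T_inf) :
  exists C lambda : R, [/\ 0 < C, 0 < lambda &
    forall u : R -> state R d, mild_solution D rho_inf T_inf u ->
    forall t : R, 0 <= t ->
      (entropy rho_inf T_inf (u t)
       <= (C * expR (- lambda * t))%:E * entropy rho_inf T_inf (u 0%R))%E].
Proof.
have [M [lambda [M0 lambda0 decay]]] := linearized_decay hd hD hrho hT.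
exists M, lambda; split => // u mu t t0.
(* For s < 0 the state u s is arbitrary and [of_raw] may send its components to 0; hence the
   restriction to s >= 0 in [uE]. *)
pose w s := of_raw rho_inf T_inf (u s).
have uE s : 0 <= s -> u s = raw (w s).
  by move=> s0; rewrite raw_of_raw//; exact: mild_in_hilbert mu s s0.
rewrite !uE// !entropy_raw// -EFinM lee_fin mulrA ler_pM2r//.
apply: decay => // [|s s0]; last first.
  by apply: conserved_raw => //; rewrite -uE//; exact: mild_in_hilbert mu s s0.
exact: mild_raw mu uE.
Qed.
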